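(* Let $-1<\alpha<\beta<1$, $\hat E:=[-1,\alpha]\cup[\beta,1]$, let $$k:=\sqrt{\frac{2(\beta-\alpha)}{(1-\alpha)(1+\beta)}}\in(0,1),$$ let $K=K(k)$, and let $\rho\in(0,K)$ be the unique number with $\operatorname{sn}^2(\rho,k)=\frac{1-\alpha}{2}$. Then, among all $\xi\in(\alpha,\beta)$, the convergence factor $\kappa(\hat E,\xi)$ is minimal for $$\xi^*=\alpha+\operatorname{zn}(\rho,k)\sqrt{(1-\alpha)(1+\beta)}.$$
   Context: Let $\mathbb{P}_n$ denote the set of real polynomials of degree at most $n$. For $\hat E=[-1,\alpha]\cup[\beta,1]$ and $\xi\in\mathbb{R}\setminus\hat E$, put $$L_n^r(\hat E,\xi):=\min\Bigl\{\max_{x\in\hat E}|P_n(x)| : P_n\in\mathbb{P}_n,\ P_n(\xi)=1\Bigr\}.$$ The (estimated) asymptotic convergence factor is the limit (known to exist) $\kappa(\hat E,\xi):=\lim_{n\to\infty}\sqrt[n]{L_n^r(\hat E,\xi)}$. Equivalently (known), $\kappa(\hat E,\xi)=\exp(-g(\xi))$, where $g$ is the Green's function of $\overline{\mathbb{C}}\setminus\hat E$ with pole at infinity. For modulus $k\in(0,1)$: $K=K(k)=\int_0^{\pi/2}\frac{d\theta}{\sqrt{1-k^2\sin^2\theta}}$ and $E(k)=\int_0^{\pi/2}\sqrt{1-k^2\sin^2\theta}\,d\theta$ are the complete elliptic integrals of the first and second kind; $\operatorname{sn}(u,k),\operatorname{cn}(u,k),\operatorname{dn}(u,k)$ are Jacobi's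 elliptic functions with modulus $k$; $\operatorname{zn}$ is Jacobi's zeta function, $\operatorname{zn}(u,k)=\int_0^u\operatorname{dn}^2(t,k)\,dt-\frac{E(k)}{K(k)}u$. *)

(* Defs.v *)
From Stdlib Require Import Reals.
From Coquelicot Require Import Coquelicot.
Open Scope R_scope.

Definition poly_deg_le (n : nat) (P : R -> R) : Prop :=
  exists a : nat -> R, forall x, P x = sum_n (fun i => a i * x ^ i) n.

(* For P continuous and E nonempty compact, the supremum is a maximum. *)
Definition max_abs_on (E : R -> Prop) (P : R -> R) : R :=
  real (Lub_Rbar (fun y => exists x, E x /\ y = Rabs (P x))).

(* For E infinite compact and xi outside E, the infimum is attained and is
   positive, so it is the minimum of the extremal problem. *)
Definition Lr (n : nat) (E : R -> Prop) (xi : R) : R :=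
  real (Glb_Rbar (fun M => exists P : R -> R,
    poly_deg_le n P /\ P xi = 1 /\ M = max_abs_on E P)).

(* Since Lr n E xi > 0, Rpower _ (/ n) is the n-th root for n >= 1; the junk
   term at n = 0 does not affect the limit. *)
Definition kappa (E : R -> Prop) (xi : R) : R :=
  real (Lim_seq (fun n => Rpower (Lr n E xi) (/ INR n))).

Definition two_intervals (alpha beta : R) : R -> Prop :=
  fun x => -1 <= x <= alpha \/ beta <= x <= 1.

Definition ellint_F (phi k : R) : R :=
  RInt (fun theta => / sqrt (1 - k ^ 2 * sin theta ^ 2)) 0 phi.

Definition ellK (k : R) : R := ellint_F (PI / 2) k.

Definition ellE (k : R) : R :=
  RInt (fun theta => sqrt (1 - k ^ 2 * sin theta ^ 2)) 0 (PI / 2).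

(* The amplitude am(., k) is the inverse of the increasing bijection
   ellint_F(., k) of R, for 0 <= k < 1; iota is definite description. *)
Definition am (u k : R) : R := iota (fun phi : R => ellint_F phi k = u).

Definition sn (u k : R) : R := sin (am u k).

Definition dn (u k : R) : R := sqrt (1 - k ^ 2 * sn u k ^ 2).

Definition zn (u k : R) : R :=
  RInt (fun t => dn t k ^ 2) 0 u - ellE k / ellK k * u.

(* Main.v *)
(* Let G be the Green function of the complement of E. On the gap,
   G' = (c - x) / sqrt H with H = (1 - x^2) (x - alpha) (beta - x), so the claim
   is that kappa = exp (- G) is smallest at the zero c of G', plus a formula for c.

   No complex analysis is needed. Among the polynomials of degree n with
   |P| <= 1 on E, choose P and c' in the gap with P c' maximal. Chebyshev
   alternation leaves P^2 - 1 and P' with almost all their zeros in common: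
     P'^2 H (g - x) (e - x) = n^2 (c' - x)^2 (d - x)^2 (P^2 - 1),  1 <= d <= g <= e,
   up to a reflection or a drop of the degree. On (g, e) the function acos P varies
   by at most PI, which forces e - d = O(d / n). Hence (arcosh P)' / n is uniformly
   close to (c' - x) / sqrt H on the gap, and Rolle's theorem applied to
   arcosh P / n - G gives c' -> c. Finally Lr n xi >= 1 / P c' for every xi in the
   gap, Lr n c <= 1 / P c, and ln (P c' / P c) = o(n).

   The condition G alpha = G beta = 0 for the c of the statement is Jacobi's
   reduction of the complete elliptic integral of the third kind to the zeta function. *)

Require Import Defs.
From Stdlib Require Import Reals Lra Lia List Sorted FinFun Classical ClassicalEpsilon.
From Coquelicot Require Import Coquelicot.
Import ListNotations.
Open Scope R_scope.

(** * Real polynomials and their roots *)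

(** Maximising over the point as well as over the polynomial ties two unknowns together: [c']
    becomes a critical point of [P], and [P c'] bounds every admissible polynomial on the whole gap.
    For a prescribed point, the zero of [P'] in the gap would be one more unknown. The obstacle is
    that [E] is in general not the full inverse image of [-1,1] under a polynomial. The additional
    interval [g,e] records this defect, and its position is not controlled: it may run off to
    infinity with n. Hence only a bound on e - d relative to d can be hoped for. It suffices,
    because the additional factors enter only through the weight (d - x) / sqrt ((g - x) (e - x)),
    which tends to 1 uniformly on the gap as soon as (e - d) / d tends to 0. Rolle's theorem is
    available because arcosh P and G both vanish at the two ends of the gap, and at an interior zero
    of the difference of derivatives the only discrepancy between c' and c is this weight. The
    comparison of convergence factors is made at each finite n, with an error factor whose n-th root
    is at most exp eta, and is carried to [Lim_seq] by monotonicity. *)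

Lemma poly_ext n P Q : (forall x, P x = Q x) -> poly_deg_le n P -> poly_deg_le n Q.
Proof. intros H [a Ha]. exists a. intros x. now rewrite <- H. Qed.

Lemma poly_0 P : poly_deg_le 0 P <-> exists c, forall x, P x = c.
Proof.
  split.
  - intros [a Ha]. exists (a O). intros x. rewrite Ha, sum_O. simpl. ring.
  - intros [c Hc]. exists (fun _ => c). intros x. rewrite Hc, sum_O. simpl. ring.
Qed.

(** Horner's scheme. With [poly_0] it turns every degree bound into an induction, so that
    coefficient sums do not occur beyond this point. *)
Lemma poly_S n P : poly_deg_le (S n) P <->
  exists c Q, poly_deg_le n Q /\ forall x, P x = c + x * Q x.
Proof.
  assert (Hs : forall (a : nat -> R) x, sum_n (fun i => a i * x ^ i) (S n) =
      a O + x * sum_n (fun i => a (S i) * x ^ i) n).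
  { intros a x. unfold sum_n. rewrite sum_Sn_m by lia.
    rewrite <- sum_n_m_S.
    rewrite (sum_n_m_ext (fun k => a (S k) * x ^ S k)
      (fun k => mult (K := R_Ring) x (a (S k) * x ^ k))).
    - rewrite (sum_n_m_mult_l (K := R_Ring) x (fun k => a (S k) * x ^ k)). change plus with Rplus. change mult with Rmult. simpl. now rewrite Rmult_1_r.
    - intros k. change mult with Rmult. simpl. ring. }
  split.
  - intros [a Ha]. exists (a O), (fun x => sum_n (fun i => a (S i) * x ^ i) n). split.
    + exists (fun i => a (S i)). reflexivity.
    + intros x. rewrite Ha. apply Hs.
  - intros [c [Q [[b Hb] HP]]].
    exists (fun i => match i with O => c | S j => b j end).
    intros x. rewrite Hs, HP, Hb. reflexivity.
Qed.

Lemma poly_const n c : poly_deg_le n (fun _ => c).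
Proof.
  revert c. induction n as [|n IH]; intros c.
  - apply poly_0. now exists c.
  - apply poly_S. exists c, (fun _ => 0). split; [apply IH|]. intros; ring.
Qed.

Lemma poly_plus n P Q : poly_deg_le n P -> poly_deg_le n Q -> poly_deg_le n (fun x => P x + Q x).
Proof.
  revert P Q. induction n as [|n IH]; intros P Q HP HQ.
  - apply poly_0 in HP, HQ. destruct HP as [c Hc], HQ as [d Hd].
    apply poly_0. exists (c + d). intros x. now rewrite Hc, Hd.
  - apply poly_S in HP, HQ. destruct HP as [c [P' [HP' Hc]]], HQ as [d [Q' [HQ' Hd]]].
    apply poly_S. exists (c + d), (fun x => P' x + Q' x). split; [now apply IH|].
    intros x. rewrite Hc, Hd. ring.
Qed.

Lemma poly_scal n c P : poly_deg_le n P -> poly_deg_le n (fun x => c * P x).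
Proof.
  revert P. induction n as [|n IH]; intros P HP.
  - apply poly_0 in HP. destruct HP as [d Hd]. apply poly_0. exists (c * d).
    intros x. now rewrite Hd.
  - apply poly_S in HP. destruct HP as [d [Q [HQ Hd]]]. apply poly_S.
    exists (c * d), (fun x => c * Q x). split; [now apply IH|]. intros x. rewrite Hd. ring.
Qed.

Lemma poly_le n m P : (n <= m)%nat -> poly_deg_le n P -> poly_deg_le m P.
Proof.
  revert m P. induction n as [|n IH]; intros m P Hm HP.
  - apply poly_0 in HP. destruct HP as [c Hc].
    apply (poly_ext m (fun _ => c)); [now intros; rewrite Hc|]. apply poly_const.
  - destruct m as [|m]; [lia|]. apply poly_S in HP. destruct HP as [c [Q [HQ HP]]].
    apply poly_S. exists c, Q. split; auto. apply IH; auto. lia.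
Qed.

Lemma poly_mulx n P : poly_deg_le n P -> poly_deg_le (S n) (fun x => x * P x).
Proof. intros H. apply poly_S. exists 0, P. split; auto. intros; ring. Qed.

Lemma poly_mult n m P Q :
  poly_deg_le n P -> poly_deg_le m Q -> poly_deg_le (n + m) (fun x => P x * Q x).
Proof.
  revert P. induction n as [|n IH]; intros P HP HQ.
  - apply poly_0 in HP. destruct HP as [c Hc].
    apply (poly_ext m (fun x => c * Q x)); [now intros; rewrite Hc|]. now apply poly_scal.
  - apply poly_S in HP. destruct HP as [c [P' [HP' Hc]]].
    apply (poly_ext _ (fun x => c * Q x + x * (P' x * Q x))).
    { intros x. rewrite Hc. ring. }
    apply poly_plus.
    + apply poly_le with m; [lia|]. now apply poly_scal.
    + apply (poly_mulx (n + m)). now apply IH.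
Qed.

Lemma poly_linear z : poly_deg_le 1 (fun x => x - z).
Proof. apply poly_S. exists (- z), (fun _ => 1). split; [apply poly_const|]. intros; ring. Qed.

Lemma poly_opp_arg n P : poly_deg_le n P -> poly_deg_le n (fun x => P (- x)).
Proof.
  revert P. induction n as [|n IH]; intros P HP.
  - apply poly_0 in HP. destruct HP as [c Hc]. apply poly_0. exists c. intros; apply Hc.
  - apply poly_S in HP. destruct HP as [c [Q [HQ Hc]]]. apply poly_S.
    exists c, (fun x => (-1) * Q (- x)). split; [now apply poly_scal, IH|].
    intros x. rewrite Hc. ring.
Qed.

Lemma poly_factor n P a : poly_deg_le (S n) P -> P a = 0 ->
  exists Q, poly_deg_le n Q /\ forall x, P x = (x - a) * Q x.
Proof.
  revert P. induction n as [|n IH]; intros P HP Ha.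
  - apply poly_S in HP. destruct HP as [c [Q [HQ HP]]].
    exists Q. split; auto. apply poly_0 in HQ. destruct HQ as [q Hq].
    intros x. rewrite HP in Ha. rewrite Hq in Ha. rewrite HP, Hq. nra.
  - apply poly_S in HP. destruct HP as [c [Q [HQ HP]]].
    destruct (IH (fun x => Q x + - Q a)) as [Q2 [HQ2 E2]].
    { apply poly_plus; auto. apply poly_const. }
    { ring. }
    exists (fun x => Q a + x * Q2 x). split.
    + apply poly_S. now exists (Q a), Q2.
    + intros x. rewrite HP. rewrite HP in Ha. specialize (E2 x).
      replace (Q x) with (Q a + (x - a) * Q2 x) by lra.
      replace c with (- (a * Q a)) by lra. ring.
Qed.

Lemma poly_derive n P : poly_deg_le n P ->
  exists D, poly_deg_le (pred n) D /\ forall x, is_derive P x (D x).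
Proof.
  revert P. induction n as [|n IH]; intros P HP.
  - apply poly_0 in HP. destruct HP as [c Hc]. exists (fun _ => 0). split.
    + apply poly_const.
    + intros x. apply (is_derive_ext (fun _ => c)); [now intros; rewrite Hc|].
      apply @is_derive_const.
  - apply poly_S in HP. destruct HP as [c [Q [HQ HP]]].
    destruct (IH Q HQ) as [D [HD HdQ]].
    exists (fun x => Q x + x * D x). split.
    + simpl. apply poly_plus; auto. destruct n as [|n].
      * apply poly_0 in HQ. destruct HQ as [q Hq]. apply poly_0. exists 0.
        intros x. replace (D x) with 0; [ring|].
        assert (H : is_derive Q x 0).
        { apply (is_derive_ext (fun _ => q)); [now intros; rewrite Hq|].
          apply @is_derive_const. }
        rewrite <- (is_derive_unique _ _ _ H). apply is_derive_unique, HdQ.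
      * apply poly_mulx. exact HD.
    + intros x. apply (is_derive_ext (fun x => c + x * Q x)); [now intros; rewrite HP|].
      auto_derive.
      * exists (D x). apply HdQ.
      * change (1 * Q x + x * (1 * Derive Q x) = Q x + x * D x). rewrite (is_derive_unique Q x (D x) (HdQ x)). ring.
Qed.

Lemma poly_ex_derive n P x : poly_deg_le n P -> ex_derive P x.
Proof. intros H. destruct (poly_derive n P H) as [D [_ HD]]. now exists (D x). Qed.

Lemma ex_derive_continuity_pt (f : R -> R) x : ex_derive f x -> continuity_pt f x.
Proof. intros H. now apply continuity_pt_filterlim, (ex_derive_continuous f x). Qed.

Lemma poly_continuity_pt n P x : poly_deg_le n P -> continuity_pt P x.
Proof.
  intros H. apply ex_derive_continuity_pt. now apply poly_ex_derive with n.
Qed.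

Lemma poly_is_derive n P x : poly_deg_le n P -> is_derive P x (Derive P x).
Proof. intros H. apply Derive_correct. now apply poly_ex_derive with n. Qed.

Lemma poly_Derive n P : poly_deg_le n P -> poly_deg_le (pred n) (Derive P).
Proof.
  intros H. destruct (poly_derive n P H) as [D [HD HdP]].
  apply (poly_ext _ D); auto. intros x. symmetry. now apply is_derive_unique.
Qed.

Definition root_prod (L : list R) (x : R) : R := fold_right (fun z p => (x - z) * p) 1 L.

Lemma root_prod_neq L x : ~ In x L -> root_prod L x <> 0.
Proof.
  induction L as [|z L IH]; simpl; intros H; [lra|].
  apply Rmult_integral_contrapositive_currified; [|tauto].
  intros E. apply H. left. lra.
Qed.

Lemma root_prod_poly L : poly_deg_le (length L) (root_prod L).
Proof.
  induction L as [|z L IH]; simpl.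
  - apply poly_const.
  - apply (poly_mult 1 (length L) (fun x => x - z) (root_prod L)); auto. apply poly_linear.
Qed.

Lemma poly_factor_list L m P : NoDup L -> poly_deg_le (length L + m) P ->
  (forall z, In z L -> P z = 0) ->
  exists Q, poly_deg_le m Q /\ forall x, P x = root_prod L x * Q x.
Proof.
  revert P. induction L as [|z L IH]; intros P ND HP HL.
  - exists P. split; auto. intros; simpl; ring.
  - simpl in HP. destruct (poly_factor _ P z HP) as [Q1 [HQ1 E1]]; [apply HL; now left|].
    inversion ND as [|? ? Nz ND']; subst.
    destruct (IH Q1 ND' HQ1) as [Q [HQ E]].
    + intros w Hw. assert (H := HL w (or_intror Hw)). rewrite E1 in H.
      apply Rmult_integral in H. destruct H as [H|H]; auto.
      exfalso. apply Nz. now replace z with w by lra.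
    + exists Q. split; auto. intros x. rewrite E1, E. simpl. ring.
Qed.

Lemma Derive_factor P Q z : (forall x, P x = (x - z) * Q x) -> (forall x, ex_derive Q x) ->
  forall x, Derive P x = Q x + (x - z) * Derive Q x.
Proof.
  intros E HQ x. rewrite (Derive_ext P (fun x => (x - z) * Q x) x E).
  rewrite (Derive_mult (fun x => x - z) Q); auto; [|auto_derive; auto].
  replace (Derive (fun x => x - z) x) with 1; [ring|].
  symmetry. apply is_derive_unique. auto_derive; auto; ring.
Qed.

(** At a zero z of P = (x - z) Q1 the derivative is Q1 z, so a double zero of P leaves a zero of Q1
    and a second factor can be split off. *)
Lemma poly_double_factor_list L m P : NoDup L -> poly_deg_le (2 * length L + m) P ->
  (forall z, In z L -> P z = 0 /\ Derive P z = 0) ->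
  exists Q, poly_deg_le m Q /\ forall x, P x = root_prod L x ^ 2 * Q x.
Proof.
  revert P. induction L as [|z L IH]; intros P ND HP HL.
  - exists P. split; auto. intros; simpl; ring.
  - assert (HP' : poly_deg_le (S (S (2 * length L + m))) P).
    { eapply poly_le; [|exact HP]. simpl. lia. }
    destruct (HL z (or_introl eq_refl)) as [Pz Dz].
    destruct (poly_factor _ P z HP' Pz) as [Q1 [HQ1 E1]].
    assert (HD : forall x, Derive P x = Q1 x + (x - z) * Derive Q1 x).
    { apply Derive_factor; auto. intros; eapply poly_ex_derive; eassumption. }
    destruct (poly_factor _ Q1 z HQ1) as [Q2 [HQ2 E2]].
    { rewrite HD in Dz. lra. }
    assert (HD2 : forall x, Derive Q1 x = Q2 x + (x - z) * Derive Q2 x).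
    { apply Derive_factor; auto. intros; eapply poly_ex_derive; eassumption. }
    inversion ND as [|? ? Nz ND']; subst.
    destruct (IH Q2 ND' HQ2) as [Q [HQ E]].
    + intros w Hw. destruct (HL w (or_intror Hw)) as [Pw Dw].
      assert (Hwz : w - z <> 0).
      { intros H. apply Nz. now replace z with w by lra. }
      assert (HQ2w : Q2 w = 0).
      { rewrite E1, E2 in Pw. apply Rmult_integral in Pw. destruct Pw as [?|Pw]; [tauto|].
        apply Rmult_integral in Pw. destruct Pw; tauto. }
      split; auto.
      rewrite HD, HD2, E2, HQ2w in Dw.
      assert (H : (w - z) * ((w - z) * Derive Q2 w) = 0) by lra.
      apply Rmult_integral in H. destruct H as [?|H]; [tauto|].
      apply Rmult_integral in H. destruct H; tauto.
    + exists Q. split; auto. intros x. rewrite E1, E2, E. simpl. ring.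
Qed.

Lemma poly_zero_of_roots n P L : poly_deg_le n P -> NoDup L -> (n < length L)%nat ->
  (forall z, In z L -> P z = 0) -> forall x, P x = 0.
Proof.
  revert P L. induction n as [|n IH]; intros P L HP ND HL HZ x;
    (destruct L as [|z L]; simpl in HL; [lia|]).
  - apply poly_0 in HP. destruct HP as [c Hc]. rewrite Hc, <- (Hc z). apply HZ. now left.
  - destruct (poly_factor _ P z HP) as [Q [HQ E]]; [apply HZ; now left|].
    inversion ND as [|? ? Nz ND']; subst.
    rewrite E, (IH Q L HQ ND'); [ring|lia|].
    intros w Hw. assert (H := HZ w (or_intror Hw)). rewrite E in H.
    apply Rmult_integral in H. destruct H as [H|H]; auto.
    exfalso. apply Nz. now replace z with w by lra.
Qed.

Lemma poly_root_list n P : poly_deg_le n P -> (exists x, P x <> 0) ->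
  exists L, forall x, In x L <-> P x = 0.
Proof.
  revert P. induction n as [|n IH]; intros P HP [x0 H0].
  - apply poly_0 in HP. destruct HP as [c Hc]. exists []. intros x. simpl.
    rewrite Hc in H0 |- *. tauto.
  - destruct (classic (exists a, P a = 0)) as [[a Ha]|N].
    + destruct (poly_factor _ P a HP Ha) as [Q [HQ E]].
      destruct (IH Q HQ) as [L HL].
      { exists x0. intros H. apply H0. rewrite E, H. ring. }
      exists (a :: L). intros x. simpl. rewrite HL, E. split.
      * intros [->|H]; [ring|]. rewrite H. ring.
      * intros H. apply Rmult_integral in H. destruct H; [left; lra|tauto].
    + exists []. intros x. simpl. split; [tauto|]. intros H. apply N. now exists x.
Qed.

(** * Sign alternation along increasing lists of points *)

Lemma strictly_sorted_list (L : list R) :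
  exists L', StronglySorted Rlt L' /\ forall x, In x L' <-> In x L.
Proof.
  assert (Hins : forall z L, StronglySorted Rlt L ->
    exists L', StronglySorted Rlt L' /\ forall x, In x L' <-> x = z \/ In x L).
  { intros z l. induction l as [|y l IH]; intros HS.
    - exists [z]. split; [repeat constructor|]. simpl. intuition.
    - inversion HS as [|? ? HS' HF]; subst.
      destruct (Rtotal_order z y) as [H|[H|H]].
      + exists (z :: y :: l). split.
        * constructor; auto. constructor; auto.
          eapply Forall_impl; [|exact HF]. simpl. intros; lra.
        * simpl. intuition.
      + exists (y :: l). split; auto. subst. simpl. intuition.
      + destruct (IH HS') as [l' [HS1 HI]]. exists (y :: l'). split.
        * constructor; auto. apply Forall_forall. intros x Hx. apply HI in Hx.
          destruct Hx as [->|Hx]; auto. now apply (proj1 (Forall_forall _ _) HF).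
        * simpl. intros x. rewrite HI. intuition. }
  induction L as [|z L [L1 [HS HI]]].
  - exists []. split; [constructor|tauto].
  - destruct (Hins z L1 HS) as [L2 [HS2 HI2]]. exists L2. split; auto.
    intros x. rewrite HI2, HI. simpl. intuition.
Qed.

Lemma sorted_NoDup (L : list R) : StronglySorted Rlt L -> NoDup L.
Proof.
  induction 1 as [|z L HS IH HF]; constructor; auto.
  intros Hz. assert (H := proj1 (Forall_forall _ _) HF z Hz). lra.
Qed.

Fixpoint alternates (s : R -> R) (l : list R) : Prop :=
  match l with
  | x :: (y :: _) as t => s x * s y < 0 /\ alternates s t
  | _ => True
  end.

Lemma alternates_tail s x l : alternates s (x :: l) -> alternates s l.
Proof. destruct l; simpl; tauto. Qed.

Lemma alternates_ext s t l : (forall x, In x l -> s x = t x) -> alternates s l -> alternates t l.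
Proof.
  induction l as [|x [|y l] IH]; intros E; simpl; auto.
  intros [H1 H2]. split.
  - rewrite <- !E; simpl; auto.
  - apply IH; auto. intros; apply E; now right.
Qed.

Lemma alternates_zeros P x l : (forall x, continuity_pt P x) ->
  StronglySorted Rlt (x :: l) -> alternates P (x :: l) ->
  exists Z, StronglySorted Rlt Z /\ length Z = length l /\
    forall z, In z Z -> x < z /\ P z = 0.
Proof.
  intros C. revert x. induction l as [|y l IH]; intros x HS HA.
  - exists []. simpl. repeat split; try constructor; tauto.
  - inversion HS as [|? ? HS' HF]; subst. destruct HA as [H1 HA].
    destruct (IH y HS' HA) as [Z [SZ [LZ HZ]]].
    inversion HF as [|? ? Hxy _]; subst.
    destruct (IVT_gen P x y 0) as [z [Hz Pz]].
    { intros w. apply C. }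
    { unfold Rmin, Rmax. destruct (Rle_dec (P x) (P y)); nra. }
    rewrite Rmin_left, Rmax_right in Hz by lra.
    assert (z <> x) by (intros ->; nra). assert (z <> y) by (intros ->; nra).
    exists (z :: Z). split; [|split].
    + constructor; auto. apply Forall_forall. intros w Hw. apply HZ in Hw. lra.
    + simpl. lia.
    + intros w [<-|Hw]; [split; auto; lra|]. apply HZ in Hw. split; [lra|tauto].
Qed.

Lemma alternates_length n P l : poly_deg_le n P ->
  StronglySorted Rlt l -> alternates P l -> (n + 2 <= length l)%nat -> False.
Proof.
  intros HP HS HA HL. destruct l as [|x [|y l]]; simpl in HL; try lia.
  destruct (alternates_zeros P x (y :: l)) as [Z [SZ [LZ HZ]]]; auto.
  { intros; now apply poly_continuity_pt with n. }
  assert (H0 : P x = 0).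
  { apply (poly_zero_of_roots n P Z HP).
    - now apply sorted_NoDup.
    - rewrite LZ. simpl. lia.
    - intros z Hz. now apply HZ. }
  simpl in HA. rewrite H0 in HA. lra.
Qed.

(** Each adjacent pair contributes one factor -1. The side condition excludes only a singleton at a
    zero of [s], where the product vanishes. *)
Lemma alternates_ends s x l : alternates s (x :: l) -> (l <> [] \/ s x <> 0) ->
  0 < (-1) ^ (length l) * (s x * s (last l x)).
Proof.
  revert x. induction l as [|y l IH]; intros x HA HN.
  - simpl. destruct HN as [?|HN]; [tauto|]. nra.
  - destruct HA as [H1 HA].
    assert (Hl : last (y :: l) x = last l y).
    { clear. revert x y. induction l as [|z l IH]; intros x y; [reflexivity|].
      change (last (z :: l) x = last (z :: l) y). rewrite (IH x z), (IH y z). reflexivity. }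
    rewrite Hl.
    assert (H2 : 0 < (-1) ^ length l * (s y * s (last l y))).
    { apply IH; auto. right. intros E. rewrite E in H1. lra. }
    simpl length. rewrite <- tech_pow_Rmult.
    set (p := (-1) ^ length l) in *. set (w := s (last l y)) in *.
    clearbody p w.
    assert (H3 : (p * (s y * w)) * (s x * s y) < 0) by nra.
    assert (H4 : 0 < s y * s y) by nra.
    assert (H5 : (p * w * s x) * (s y * s y) < 0) by nra.
    nra.
Qed.

(* Peeling the list from the left, the polynomial gains one zero exactly where
   the prescribed signs change. *)
Lemma sign_interpolation (s : R -> R) x l :
  StronglySorted Rlt (x :: l) -> (forall z, In z (x :: l) -> s z <> 0) ->
  exists y t Q, StronglySorted Rlt (y :: t) /\ incl (y :: t) (x :: l) /\
    alternates s (y :: t) /\ poly_deg_le (length t) Q /\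
    (forall z, In z (x :: l) -> 0 < Q z * s z) /\
    (forall z, z <= x -> 0 < Q z * s y).
Proof.
  revert x. induction l as [|x' l IH]; intros x HS HN.
  - exists x, [], (fun _ => s x). assert (Hx : s x <> 0) by (apply HN; now left).
    split; [repeat constructor|]; split; [apply incl_refl|]; split; [exact I|]; split; [apply poly_const|]; split.
    + intros z [<-|[]]. nra.
    + intros. nra.
  - inversion HS as [|? ? HS' HF]; subst. inversion HF as [|? ? Hxx _]; subst.
    destruct (IH x' HS') as [y [t [Q [SY [IY [AY [DQ [QL QH]]]]]]]].
    { intros; apply HN; now right. }
    assert (Hx : s x <> 0) by (apply HN; now left).
    assert (Hy : s y <> 0) by (apply HN; right; apply IY; now left).
    destruct (Rlt_or_le (s x * s y) 0) as [Hs|Hs].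
    + exists x, (y :: t), (fun z => Q z * (z - (x + x') / 2)).
      assert (Hyx : forall z, In z (x' :: l) -> x' <= z).
      { intros z [<-|Hz]; [lra|]. inversion HS' as [|? ? _ HF']; subst.
        apply (proj1 (Forall_forall _ _) HF') in Hz. lra. }
      assert (HQ : forall z, z <= x -> 0 < Q z * (z - (x + x') / 2) * s x).
      { intros z Hz. assert (H := QH z ltac:(lra)).
        assert (H1 : 0 < (Q z * s y) * - (s x * s y)) by nra.
        assert (H2 : 0 < - (Q z * s x)).
        { assert (0 < s y * s y) by nra. nra. }
        nra. }
      split; [|split; [|split; [|split; [|split]]]]; auto.
      * constructor; auto. apply Forall_forall. intros z Hz.
        apply IY in Hz. apply Hyx in Hz. lra.
      * intros z [<-|Hz]; [now left|]. right. now apply IY.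
      * simpl. split; auto.
      * simpl. eapply poly_le; [|apply (poly_mult (length t) 1 Q); [exact DQ|apply poly_linear]]. lia.
      * intros z [<-|Hz]; [apply HQ; lra|]. assert (H := QL z Hz). apply Hyx in Hz. nra.
    + exists y, t, Q. split; [|split; [|split; [|split; [|split]]]]; auto.
      * intros z Hz. right. now apply IY.
      * intros z [<-|Hz]; [|now apply QL]. assert (H := QH x ltac:(lra)).
        assert (H1 : 0 < s x * s y).
        { destruct Hs as [?|E]; auto. symmetry in E. apply Rmult_integral in E. tauto. }
        assert (H2 : 0 < (Q x * s y) * (s x * s y)) by nra.
        assert (0 < s y * s y) by nra. nra.
      * intros z Hz. apply QH. lra.
Qed.

(** * Compactness and the extremal polynomial *)

Lemma choice_fun {A B} (R : A -> B -> Prop) :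
  (forall x, exists y, R x y) -> exists f, forall x, R x (f x).
Proof.
  intros H. exists (fun x => proj1_sig (constructive_indefinite_description _ (H x))).
  intros x. apply (proj2_sig (constructive_indefinite_description _ (H x))).
Qed.

Lemma bounded_subseq (u : nat -> R) a b : (forall n, a <= u n <= b) ->
  exists phi l, (forall k, (phi k < phi (S k))%nat) /\ a <= l <= b /\
    is_lim_seq (fun k => u (phi k)) l.
Proof.
  intros Hu.
  destruct (Bolzano_Weierstrass u (fun x => a <= x <= b) (compact_P3 a b) Hu) as [l Hl].
  (* The index is sought beyond a prescribed N, so that the recursion for [phi] can start past its
     previous value and increase strictly. *)
  assert (Hf : forall p : nat * nat, exists q, (snd p <= q)%nat /\ Rabs (u q - l) < / (INR (fst p) + 1)).
  { intros [k N]. simpl. assert (Hk : 0 < / (INR k + 1)).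
    { apply Rinv_0_lt_compat. assert (H := pos_INR k). lra. }
    destruct (Hl (disc l (mkposreal _ Hk)) N) as [q [H1 H2]].
    - exists (mkposreal _ Hk). intros x Hx. exact Hx.
    - exists q. split; auto. }
  destruct (choice_fun _ Hf) as [f Hf'].
  set (phi := fix phi k := match k with O => f (O, O) | S j => f (S j, S (phi j)) end).
  assert (Hphi : forall k, Rabs (u (phi k) - l) < / (INR k + 1)).
  { intros [|k]; [apply (proj2 (Hf' (O, O)))|apply (proj2 (Hf' (S k, S (phi k))))]. }
  assert (Hlim : is_lim_seq (fun k => u (phi k)) l).
  { apply is_lim_seq_spec. intros eps.
    destruct (nfloor_ex (/ eps)) as [N HN].
    { left. apply Rinv_0_lt_compat, cond_pos. }
    exists (S N). intros k Hk. eapply Rlt_le_trans; [apply Hphi|].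
    apply Rle_trans with (/ / eps); [|rewrite Rinv_inv; apply Rle_refl].
    apply Rinv_le_contravar; [apply Rinv_0_lt_compat, cond_pos|].
    apply le_INR in Hk. rewrite S_INR in Hk. lra. }
  exists phi, l. split; [|split]; auto.
  - intros k. destruct (Hf' (S k, S (phi k))) as [H _]. simpl in H. simpl. lia.
  - split.
    + apply (is_lim_seq_le (fun _ => a) (fun k => u (phi k)) a l); auto.
      * intros; apply Hu.
      * apply is_lim_seq_const.
    + apply (is_lim_seq_le (fun k => u (phi k)) (fun _ => b) l b); auto.
      * intros; apply Hu.
      * apply is_lim_seq_const.
Qed.

Lemma poly_expand_at n P u : poly_deg_le (S n) P ->
  exists Q, poly_deg_le n Q /\ forall x, P x = P u + (x - u) * Q x.
Proof.
  intros HP. destruct (poly_factor n (fun x => P x + - P u) u) as [Q [HQ E]].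
  - apply poly_plus; auto. apply poly_const.
  - ring.
  - exists Q. split; auto. intros x. specialize (E x). lra.
Qed.

(** [Q] is the divided difference at [u]. On the right half of [u,v] its denominator is at least (v
    - u) / 2, and its numerator is at most 2 B. *)
Lemma quotient_bound P Q u v B x : u < v -> (forall x, P x = P u + (x - u) * Q x) ->
  (forall x, u <= x <= v -> Rabs (P x) <= B) -> (u + v) / 2 <= x <= v ->
  Rabs (Q x) <= 4 * B / (v - u).
Proof.
  intros Huv E HB Hx. assert (H1 := HB x ltac:(lra)). assert (H2 := HB u ltac:(lra)).
  apply Rmult_le_reg_r with ((v - u) / 2); [lra|].
  replace (4 * B / (v - u) * ((v - u) / 2)) with (2 * B) by (field; lra).
  apply Rle_trans with (Rabs (Q x) * (x - u)).
  - apply Rmult_le_compat_l; [apply Rabs_pos|lra].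
  - rewrite <- (Rabs_right (x - u)) by lra. rewrite <- Rabs_mult.
    replace (Q x * (x - u)) with (P x + - P u) by (rewrite (E x); ring).
    eapply Rle_trans; [apply Rabs_triang|]. rewrite Rabs_Ropp. lra.
Qed.

(** Induction on the degree through the divided difference at [u], bounded on the right half by
    [quotient_bound]. The interval shrinks at each degree, so [u] must stay general; the scaling by
    (v - u) / 4 restores the normalisation to 1. *)
Lemma poly_bounded n u v : -1 <= u -> u < v -> v <= 1 ->
  exists C, forall P, poly_deg_le n P -> (forall x, u <= x <= v -> Rabs (P x) <= 1) ->
    forall x, -1 <= x <= 1 -> Rabs (P x) <= C.
Proof.
  revert u. induction n as [|n IH]; intros u Hu Huv Hv.
  - exists 1. intros P HP HB x _. apply poly_0 in HP. destruct HP as [c Hc].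
    rewrite Hc, <- (Hc u). apply HB. lra.
  - destruct (IH ((u + v) / 2)) as [C HC]; try lra.
    exists (1 + 2 * (4 / (v - u) * C)). intros P HP HB x Hx.
    destruct (poly_expand_at n P u HP) as [Q [HQ E]].
    assert (HQB : Rabs (Q x) <= 4 / (v - u) * C).
    { assert (H : Rabs ((v - u) / 4 * Q x) <= C).
      { apply (HC (fun x => (v - u) / 4 * Q x)); auto; [now apply poly_scal|].
        intros y Hy. assert (Hq := quotient_bound P Q u v 1 y Huv E HB Hy).
        rewrite Rabs_mult, Rabs_right by lra.
        apply Rle_trans with ((v - u) / 4 * (4 * 1 / (v - u))).
        - apply Rmult_le_compat_l; lra.
        - right. field. lra. }
      rewrite Rabs_mult, Rabs_right in H by lra.
      apply Rmult_le_reg_l with ((v - u) / 4); [lra|].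
      replace ((v - u) / 4 * (4 / (v - u) * C)) with C by (field; lra). exact H. }
    rewrite E. eapply Rle_trans; [apply Rabs_triang|].
    assert (H1 := HB u ltac:(lra)). rewrite Rabs_mult.
    assert (H2 : Rabs (x - u) <= 2) by (apply Rabs_le; lra).
    assert (H3 := Rabs_pos (Q x)). assert (H4 := Rabs_pos (x - u)). nra.
Qed.

(** Each divided difference costs one extraction of a subsequence. Convergence is stated along
    converging arguments, because the nearly maximal points of a maximising sequence move with the
    polynomials. *)
Lemma poly_seq_compact n u v B (P : nat -> R -> R) : u < v ->
  (forall k, poly_deg_le n (P k)) ->
  (forall k x, u <= x <= v -> Rabs (P k x) <= B) ->
  exists phi P', (forall k, (phi k < phi (S k))%nat) /\ poly_deg_le n P' /\
    forall (x : nat -> R) (l : R), is_lim_seq x l ->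
      is_lim_seq (fun k => P (phi k) (x k)) (P' l).
Proof.
  revert u B P. induction n as [|n IH]; intros u B P Huv HP HB.
  - destruct (bounded_subseq (fun k => P k u) (- B) B) as [phi [l [Hphi [_ Hl]]]].
    { intros k. apply Rabs_le_between, HB. lra. }
    exists phi, (fun _ => l). split; [|split]; auto; [apply poly_const|].
    intros x _ _. apply is_lim_seq_ext with (2 := Hl). intros k.
    destruct (proj1 (poly_0 _) (HP (phi k))) as [c Hc]. now rewrite !Hc.
  - destruct (bounded_subseq (fun k => P k u) (- B) B) as [phi [l [Hphi [_ Hl]]]].
    { intros k. apply Rabs_le_between, HB. lra. }
    destruct (choice_fun _ (fun k => poly_expand_at n (P k) u (HP k))) as [Q HQ].
    destruct (IH ((u + v) / 2) (4 * B / (v - u)) (fun k => Q (phi k))) as [psi [Q' [Hpsi [HQ' HC]]]].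
    { lra. }
    { intros k. apply HQ. }
    { intros k x Hx. eapply (quotient_bound (P (phi k))); eauto. apply HQ. }
    exists (fun k => phi (psi k)), (fun x => l + (x - u) * Q' x). split; [|split].
    + assert (Hm : forall i j, (i < j)%nat -> (phi i < phi j)%nat).
      { intros i j Hij. induction Hij; [apply Hphi|]. specialize (Hphi m). lia. }
      intros k. apply Hm, Hpsi.
    + apply (poly_plus (S n) (fun _ => l)); [apply poly_const|].
      apply (poly_mult 1 n (fun x => x - u)); auto. apply poly_linear.
    + intros x y Hx.
      apply is_lim_seq_ext with (fun k => P (phi (psi k)) u + (x k - u) * Q (phi (psi k)) (x k)).
      { intros k. symmetry. apply HQ. }
      apply is_lim_seq_plus'.
      * apply (is_lim_seq_subseq (fun k => P (phi k) u) l psi); auto.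
        now apply eventually_subseq.
      * apply is_lim_seq_mult'; [|now apply HC].
        apply is_lim_seq_minus'; auto. apply is_lim_seq_const.
Qed.

Definition admissible (n : nat) (alpha beta : R) (P : R -> R) : Prop :=
  poly_deg_le n P /\ forall x, two_intervals alpha beta x -> Rabs (P x) <= 1.

Definition extremal (n : nat) (alpha beta : R) (P : R -> R) (c : R) : Prop :=
  admissible n alpha beta P /\ alpha < c < beta /\ 1 < P c /\
  forall Q xi, admissible n alpha beta Q -> alpha <= xi <= beta -> Q xi <= P c.

Lemma extremal_exists n alpha beta : (2 <= n)%nat -> -1 < alpha -> alpha < beta -> beta < 1 ->
  exists P c, extremal n alpha beta P c.
Proof.
  intros Hn H1 H2 H3.
  destruct (poly_bounded n (-1) alpha) as [C HC]; try lra.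
  set (S := fun y => exists Q xi, admissible n alpha beta Q /\ alpha <= xi <= beta /\ y = Q xi).
  (* The competitor 1 + (x - alpha) (beta - x) / 4 is admissible, since the product lies in [-4,0]
     on the two intervals. Its value at the middle of the gap pushes the supremum strictly above
     1. *)
  assert (HT : S (1 + / 4 * ((beta - alpha) / 2) ^ 2)).
  { exists (fun x => 1 + / 4 * ((x - alpha) * ((-1) * (x - beta)))), ((alpha + beta) / 2).
    split; [split|split]; [| |lra|field].
    - apply poly_le with 2%nat; auto. apply poly_plus; [apply poly_const|]. apply poly_scal.
      apply (poly_mult 1 1 (fun x => x - alpha)); [apply poly_linear|].
      apply poly_scal, poly_linear.
    - intros x Hx. apply Rabs_le. destruct Hx; nra. }
  destruct (completeness S) as [M [HM1 HM2]].
  { exists C. intros y [Q [xi [[HQ1 HQ2] [Hxi ->]]]].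
    eapply Rle_trans; [apply Rle_abs|]. apply HC; auto; [|lra].
    intros x Hx. apply HQ2. left. lra. }
  { eexists. exact HT. }
  assert (Hk : forall k : nat, exists p : (R -> R) * R, admissible n alpha beta (fst p) /\
      alpha <= snd p <= beta /\ M - / (INR k + 1) < fst p (snd p)).
  { intros k. apply NNPP. intros N.
    assert (Hpos : 0 < / (INR k + 1)) by (apply Rinv_0_lt_compat; assert (H := pos_INR k); lra).
    assert (M <= M - / (INR k + 1)); [|lra]. apply HM2.
    intros y [Q [xi [HQ [Hxi ->]]]]. apply Rnot_lt_le. intros Hlt. apply N.
    now exists (Q, xi). }
  destruct (choice_fun _ Hk) as [p Hp].
  destruct (bounded_subseq (fun k => snd (p k)) alpha beta) as [phi [c [Hphi [Hc Hlc]]]].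
  { intros; apply Hp. }
  destruct (poly_seq_compact n (-1) alpha 1 (fun k => fst (p (phi k)))) as [psi [P [Hpsi [HP HPl]]]].
  { lra. }
  { intros; apply Hp. }
  { intros k x Hx. apply (Hp (phi k)). left. lra. }
  assert (HPc : is_lim_seq (fun k => fst (p (phi (psi k))) (snd (p (phi (psi k))))) (P c)).
  { apply HPl. apply (is_lim_seq_subseq (fun k => snd (p (phi k))) c psi); auto.
    now apply eventually_subseq. }
  assert (HPM : P c = M).
  { assert (HL : is_lim_seq (fun k => fst (p (phi (psi k))) (snd (p (phi (psi k))))) M).
    { assert (Hinv : is_lim_seq (fun k => M - / (INR k + 1)) M).
      { replace (Finite M) with (Finite (M - 0)) by (f_equal; ring).
        apply is_lim_seq_minus'; [apply is_lim_seq_const|].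
        apply is_lim_seq_ext with (fun k => / (INR (k + 1))).
        { intros k. now rewrite plus_INR. }
        apply (is_lim_seq_incr_n (fun k => / INR k) 1).
        apply (is_lim_seq_inv INR p_infty); [apply is_lim_seq_INR|discriminate]. }
      apply (is_lim_seq_le_le (fun k => M - / (INR k + 1)) _ (fun _ => M)); auto;
        [|apply is_lim_seq_const].
      intros k. destruct (Hp (phi (psi k))) as [A1 [A2 A3]]. split.
      - assert (Hge : (k <= phi (psi k))%nat).
        { assert (G : forall f : nat -> nat, (forall i, (f i < f (Datatypes.S i))%nat) -> forall i, (i <= f i)%nat).
          { intros f Hf i. induction i; [lia|]. specialize (Hf i). lia. }
          transitivity (psi k); now apply G. }
        apply le_INR in Hge. assert (Hk0 := pos_INR k).
        assert (/ (INR (phi (psi k)) + 1) <= / (INR k + 1)) by (apply Rinv_le_contravar; lra).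
        lra.
      - apply HM1. now exists (fst (p (phi (psi k)))), (snd (p (phi (psi k)))). }
    apply is_lim_seq_unique in HL. apply is_lim_seq_unique in HPc.
    rewrite HL in HPc. now injection HPc. }
  assert (HadP : admissible n alpha beta P).
  { split; auto. intros x Hx.
    apply (is_lim_seq_le (fun k => Rabs (fst (p (phi (psi k))) x)) (fun _ => 1) (Rabs (P x)) 1).
    - intros k. now apply (Hp (phi (psi k))).
    - apply (is_lim_seq_abs _ (Finite (P x))). apply (HPl (fun _ => x)). apply is_lim_seq_const.
    - apply is_lim_seq_const. }
  assert (HM : 1 < P c).
  { rewrite HPM. apply HM1 in HT. assert (0 < ((beta - alpha) / 2) ^ 2) by (apply pow_lt; lra). lra. }
  exists P, c. split; auto. split; [|split; auto].
  - destruct HadP as [_ HB]. split.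
    + destruct (Rle_lt_or_eq_dec alpha c) as [?|E]; try lra. exfalso.
      assert (H := HB c). assert (Hle := Rle_abs (P c)).
      assert (two_intervals alpha beta c) by (left; lra). specialize (H ltac:(auto)). lra.
    + destruct (Rle_lt_or_eq_dec c beta) as [?|E]; try lra. exfalso.
      assert (H := HB c). assert (Hle := Rle_abs (P c)).
      assert (two_intervals alpha beta c) by (right; lra). specialize (H ltac:(auto)). lra.
  - intros Q xi HQ Hxi. rewrite HPM. apply HM1. now exists Q, xi.
Qed.

Lemma Derive_local_max f a b c : (forall x, ex_derive f x) -> a < c < b ->
  (forall x, a < x < b -> f x <= f c) -> Derive f c = 0.
Proof.
  intros Hd Hc Hm. assert (pr : derivable_pt f c) by (apply ex_derive_Reals_0, Hd).
  rewrite <- (Derive_Reals f c pr). destruct Hc. apply (deriv_maximum f a b c pr); auto.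
Qed.

Lemma Derive_local_sqr_max f a b c : (forall x, ex_derive f x) -> a < c < b ->
  (forall x, a < x < b -> Rabs (f x) <= 1) -> f c ^ 2 = 1 -> Derive f c = 0.
Proof.
  intros Hd Hc Hm Hfc.
  assert (Hcases : f c = 1 \/ f c = -1).
  { assert (E : (f c - 1) * (f c + 1) = 0) by lra. apply Rmult_integral in E. lra. }
  destruct Hcases as [E|E].
  - apply (Derive_local_max f a b c); auto. intros x Hx. rewrite E.
    apply Rabs_le_between, (Hm x Hx).
  - assert (H : Derive (fun x => - f x) c = 0).
    { apply (Derive_local_max (fun x => - f x) a b c); auto.
      - intros x. apply @ex_derive_opp, Hd.
      - intros x Hx. rewrite E. assert (H := proj1 (Rabs_le_between _ _) (Hm x Hx)). lra. }
    rewrite Derive_opp in H. lra.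
Qed.

Lemma extremal_Derive n alpha beta P c : extremal n alpha beta P c -> Derive P c = 0.
Proof.
  intros [[HP HB] [Hc [HM Hopt]]].
  apply (Derive_local_max P alpha beta c); auto.
  - intros; now apply poly_ex_derive with n.
  - intros x Hx. apply Hopt; [split; auto|lra].
Qed.

(** * Alternation *)

Lemma list_filter_Prop {A} (L : list A) (Q : A -> Prop) :
  exists L', forall x, In x L' <-> In x L /\ Q x.
Proof.
  induction L as [|z L [L' IH]].
  - exists []. simpl. tauto.
  - destruct (classic (Q z)) as [H|H].
    + exists (z :: L'). intros x. simpl. rewrite IH. intuition (subst; auto).
    + exists L'. intros x. simpl. rewrite IH. intuition (subst; tauto).
Qed.

Lemma list_avoids_interval (L : list R) a b : a < b -> exists x, a < x < b /\ ~ In x L.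
Proof.
  intros Hab.
  assert (H : exists a' b', a <= a' /\ a' < b' /\ b' <= b /\ forall x, a' < x < b' -> ~ In x L).
  { induction L as [|z L [a' [b' [H1 [H2 [H3 H4]]]]]].
    - exists a, b. simpl. repeat split; try lra. tauto.
    - destruct (classic (a' < z < b')) as [Hz|Hz].
      + exists a', z. repeat split; try lra. intros x Hx [->|Hin]; [lra|].
        apply (H4 x); auto; lra.
      + exists a', b'. repeat split; try lra. intros x Hx [->|Hin]; [lra|]. now apply (H4 x). }
  destruct H as [a' [b' [H1 [H2 [H3 H4]]]]].
  exists ((a' + b') / 2). split; [lra|]. apply H4. lra.
Qed.

Lemma continuity_pt_max f g x : continuity_pt f x -> continuity_pt g x ->
  continuity_pt (fun x => Rmax (f x) (g x)) x.
Proof.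
  intros Hf Hg.
  apply (continuity_pt_ext (fun x => (f x + g x + Rabs (f x - g x)) / 2)).
  - intros y. unfold Rmax, Rabs. destruct (Rle_dec (f y) (g y)), (Rcase_abs (f y - g y)); lra.
  - assert (H : continuity_pt (fun x => Rabs (f x - g x)) x).
    { apply (continuity_pt_comp (fun x => f x - g x) Rabs).
      - now apply continuity_pt_minus.
      - apply Rcontinuity_abs. }
    apply (continuity_pt_mult (fun x => f x + g x + Rabs (f x - g x)) (fun _ => / 2)).
    + apply (continuity_pt_plus (fun x => f x + g x)); auto. now apply continuity_pt_plus.
    + apply continuity_pt_const. now intros ? ?.
Qed.

(** The continuous function max (1 - P^2, P Q) is positive on the compact interval, hence at least
    some mu > 0. Where 1 - P^2 is large there is room for any small change; where P Q is large the
    linear term of (P - e Q)^2 decreases the square. *)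
Lemma perturbation_bounded n m a b P Q : a <= b -> poly_deg_le n P -> poly_deg_le m Q ->
  (forall x, a <= x <= b -> Rabs (P x) <= 1) ->
  (forall x, a <= x <= b -> P x ^ 2 = 1 -> 0 < P x * Q x) ->
  exists e0, 0 < e0 /\ forall e, 0 < e <= e0 -> forall x, a <= x <= b -> Rabs (P x - e * Q x) <= 1.
Proof.
  intros Hab HP HQ HB Hpos.
  assert (CP := fun x => poly_continuity_pt n P x HP).
  assert (CQ := fun x => poly_continuity_pt m Q x HQ).
  destruct (continuity_ab_min (fun x => Rmax (1 - P x * P x) (P x * Q x)) a b Hab) as [x0 [Hmin Hx0]].
  { intros x _. apply continuity_pt_max.
    - apply (continuity_pt_minus (fun _ => 1)).
      + apply continuity_pt_const. now intros ? ?.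
      + now apply continuity_pt_mult.
    - now apply continuity_pt_mult. }
  destruct (continuity_ab_maj (fun x => Rabs (Q x)) a b Hab) as [x1 [Hmaj _]].
  { intros x _. apply (continuity_pt_comp Q Rabs); auto. apply Rcontinuity_abs. }
  set (mu := Rmax (1 - P x0 * P x0) (P x0 * Q x0)) in *. set (B := Rabs (Q x1)) in *.
  assert (HB0 : 0 <= B) by apply Rabs_pos.
  assert (Hmu : 0 < mu).
  { assert (H := HB x0 Hx0). apply Rabs_le_between in H. unfold mu.
    destruct (Req_EM_T (P x0 ^ 2) 1) as [E|E].
    - eapply Rlt_le_trans; [apply Hpos; eauto|apply Rmax_r].
    - eapply Rlt_le_trans; [|apply Rmax_l].
      assert (P x0 ^ 2 <= 1) by nra. assert (P x0 ^ 2 < 1) by lra. lra. }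
  (* In (P - e Q)^2 the cross term costs at most 2 e B and, for e at most 1, the quadratic term at
     most e B^2. The summand 1 makes [D] positive when B = 0. *)
  set (D := 2 * B + B ^ 2 + 1). assert (HD : 1 <= D) by (unfold D; nra).
  exists (Rmin 1 (mu / D)). split.
  { apply Rmin_pos; [lra|]. apply Rdiv_lt_0_compat; lra. }
  intros e [He1 He2] x Hx.
  assert (e <= 1) by (eapply Rle_trans; [exact He2|apply Rmin_l]).
  assert (HeD : e * D <= mu).
  { apply Rle_trans with (mu / D * D); [|right; field; lra].
    apply Rmult_le_compat_r; [lra|]. eapply Rle_trans; [exact He2|apply Rmin_r]. }
  assert (Hq := Hmaj x Hx). simpl in Hq. fold B in Hq. apply Rabs_le_between in Hq.
  assert (Hp := HB x Hx). apply Rabs_le_between in Hp.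
  assert (Hm := Hmin x Hx). simpl in Hm.
  assert (Hqq : Q x ^ 2 <= B ^ 2) by nra.
  assert (Hpp : P x ^ 2 <= 1) by nra.
  assert (Hpq : - (P x * Q x) <= B) by nra.
  assert (Hsq : (P x - e * Q x) ^ 2 <= 1).
  { replace ((P x - e * Q x) ^ 2) with (P x ^ 2 - 2 * e * (P x * Q x) + e * (e * Q x ^ 2)) by ring.
    assert (He3 : e * (e * Q x ^ 2) <= e * B ^ 2).
    { apply Rmult_le_compat_l; [lra|]. assert (0 <= Q x ^ 2) by apply pow2_ge_0. nra. }
    unfold D in HeD. unfold Rmax in Hm.
    destruct (Rle_dec (1 - P x * P x) (P x * Q x)).
    - assert (e * mu <= e * (P x * Q x)) by (apply Rmult_le_compat_l; lra).
      assert (e * (e * B ^ 2) <= e * mu).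
      { apply Rmult_le_compat_l; [lra|]. nra. }
      assert (e * (e * Q x ^ 2) <= e * (e * B ^ 2)).
      { apply Rmult_le_compat_l; [lra|]. apply Rmult_le_compat_l; lra. }
      assert (0 <= e * mu) by nra.
      lra.
    - assert (e * (- (P x * Q x)) <= e * B) by (apply Rmult_le_compat_l; lra).
      nra. }
  apply Rabs_le. split; nra.
Qed.

Lemma sorted_firstn k (l : list R) : StronglySorted Rlt l -> StronglySorted Rlt (firstn k l).
Proof.
  revert k. induction l as [|x l IH]; intros [|k] H; simpl; try constructor.
  - apply IH. now inversion H.
  - inversion H as [|? ? _ HF]; subst. apply Forall_forall. intros z Hz.
    apply (proj1 (Forall_forall _ _) HF). rewrite <- (firstn_skipn k l).
    apply in_or_app. now left.
Qed.

Lemma alternates_firstn s k l : alternates s l -> alternates s (firstn k l).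
Proof.
  revert k. induction l as [|x [|y l] IH]; intros [|[|k]] H; try exact I.
  destruct H as [H1 H2]. split; [exact H1|]. exact (IH (S k) H2).
Qed.

Lemma alternates_app s l1 l2 : alternates s (l1 ++ l2) -> alternates s l2.
Proof.
  induction l1 as [|x l1 IH]; auto. intros H. apply IH. now apply alternates_tail in H.
Qed.

Lemma sorted_app (l1 l2 : list R) x : StronglySorted Rlt (l1 ++ x :: l2) ->
  (forall z, In z l1 -> z < x) /\ (forall z, In z l2 -> x < z).
Proof.
  induction l1 as [|y l1 IH]; simpl; intros H; inversion H as [|? ? HS HF]; subst.
  - split; [tauto|]. now apply Forall_forall.
  - destruct (IH HS) as [H1 H2]. split; auto. intros z [<-|Hz]; auto.
    apply (proj1 (Forall_forall _ _) HF). apply in_or_app. right. now left.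
Qed.

Definition epoint alpha beta (P : R -> R) z := two_intervals alpha beta z /\ P z ^ 2 = 1.

(* Otherwise a polynomial of degree at most n having the sign of P at the
   e-points and negative at c could be subtracted to improve P. *)
Lemma extremal_alternation n alpha beta P c :
  -1 < alpha -> beta < 1 -> extremal n alpha beta P c ->
  exists y, StronglySorted Rlt y /\ length y = (n + 2)%nat /\
    alternates (fun z => if Req_EM_T z c then -1 else P z) y /\
    forall z, In z y -> z = c \/ epoint alpha beta P z.
Proof.
  intros Ha Hb [[HP HB] [Hc [HM Hopt]]]. set (s := fun z => if Req_EM_T z c then -1 else P z).
  destruct (poly_root_list (n + n) (fun x => P x * P x + - 1)) as [L0 HL0].
  { apply poly_plus; [now apply poly_mult|apply poly_const]. }
  { exists c. nra. }
  destruct (list_filter_Prop L0 (two_intervals alpha beta)) as [L1 HL1].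
  destruct (strictly_sorted_list (c :: L1)) as [L [SL HL]].
  assert (HLe : forall z, In z L <-> z = c \/ epoint alpha beta P z).
  { intros z. rewrite HL. simpl. rewrite HL1, HL0. unfold epoint.
    split; intros [H|[H1 H2]]; auto; right; split; auto; lra. }
  destruct L as [|x l]; [exfalso; apply (HL c); now left|].
  destruct (sign_interpolation s x l SL) as [y [t [Q [SY [IY [AY [DQ [HQ _]]]]]]]].
  { intros z Hz. unfold s. destruct (Req_EM_T z c); [lra|].
    apply HLe in Hz. destruct Hz as [?|[_ E]]; [tauto|]. intros E'. rewrite E' in E. lra. }
  destruct (Nat.lt_ge_cases (length t) (S n)) as [Hl|Hl].
  - exfalso.
    assert (HQ' : poly_deg_le n Q) by (apply poly_le with (length t); auto; lia).
    assert (HPQ : forall z, epoint alpha beta P z -> 0 < P z * Q z).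
    { intros z Hz. assert (H := HQ z (proj2 (HLe z) (or_intror Hz))). unfold s in H.
      destruct (Req_EM_T z c) as [->|_]; [|lra]. destruct Hz as [[?|?] _]; lra. }
    assert (HQc : Q c < 0).
    { assert (H := HQ c (proj2 (HLe c) (or_introl eq_refl))). unfold s in H.
      destruct (Req_EM_T c c); [lra|tauto]. }
    destruct (perturbation_bounded n n (-1) alpha P Q) as [e1 [He1 H1]]; auto; try lra.
    { intros z Hz. apply HB. now left. }
    { intros z Hz E. apply HPQ. split; auto. now left. }
    destruct (perturbation_bounded n n beta 1 P Q) as [e2 [He2 H2]]; auto; try lra.
    { intros z Hz. apply HB. now right. }
    { intros z Hz E. apply HPQ. split; auto. now right. }
    set (e := Rmin e1 e2). assert (He : 0 < e) by now apply Rmin_pos.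
    assert (H : P c + (- e) * Q c <= P c); [|nra].
    apply (Hopt (fun x => P x + (- e) * Q x)); [split|lra].
    + apply poly_plus; auto. now apply poly_scal.
    + intros z Hz. replace (P z + - e * Q z) with (P z - e * Q z) by ring. destruct Hz as [Hz|Hz].
      * apply H1; auto. split; auto. apply Rmin_l.
      * apply H2; auto. split; auto. apply Rmin_r.
  - exists (firstn (n + 2) (y :: t)). split; [|split; [|split]].
    + now apply sorted_firstn.
    + rewrite length_firstn. simpl. lia.
    + now apply alternates_firstn.
    + intros z Hz. apply HLe, IY. rewrite <- (firstn_skipn (n + 2) (y :: t)).
      apply in_or_app. now left.
Qed.

Lemma poly_roots_derive_length n P L : poly_deg_le (S n) P -> (exists x y, P x <> P y) ->
  NoDup L -> (forall z, In z L -> Derive P z = 0) -> (length L <= n)%nat.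
Proof.
  intros HP [x [y Hxy]] ND HL. destruct (Nat.le_gt_cases (length L) n) as [?|Hgt]; auto.
  exfalso. assert (HD := poly_Derive _ _ HP). simpl in HD.
  assert (HZ := poly_zero_of_roots n (Derive P) L HD ND Hgt HL).
  apply Hxy. destruct (MVT_gen P x y (Derive P)) as [z [_ E]].
  - intros; eapply poly_is_derive; eassumption.
  - intros; eapply poly_continuity_pt; eassumption.
  - rewrite HZ in E. lra.
Qed.

Lemma Rolle_Derive (P : R -> R) a b : (forall x : R, ex_derive P x) -> a < b -> P a = P b ->
  exists d, a < d < b /\ Derive P d = 0.
Proof.
  intros HD Hab E.
  assert (pr : forall x, a < x < b -> derivable_pt P x).
  { intros x _. apply ex_derive_Reals_0, HD. }
  destruct (Rolle P a b pr) as [d [Hd E']]; auto.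
  - intros x _. apply ex_derive_continuity_pt, HD.
  - exists d. split; auto. rewrite <- E'. symmetry. apply Derive_Reals.
Qed.

(** From the value 1 at [u] the polynomial dips below 1 and has to pass 1 again before [c]; Rolle
    applies between the two passages. *)
Lemma critical_right P u x c : (forall x, ex_derive P x) ->
  u < x < c -> P u = 1 -> P x < 1 -> 1 < P c -> exists d, u < d < c /\ Derive P d = 0.
Proof.
  intros HD Hx Hu Hlt Hc.
  destruct (IVT_gen P x c 1) as [z [Hz Ez]].
  - intros w. apply ex_derive_continuity_pt, HD.
  - rewrite Rmin_left, Rmax_right; lra.
  - rewrite Rmin_left, Rmax_right in Hz by lra.
    assert (z <> c) by (intros ->; lra).
    destruct (Rolle_Derive P u z) as [d [Hd Ed]]; auto; try lra. exists d. split; auto. lra.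
Qed.

Lemma critical_left P c x u : (forall x, ex_derive P x) ->
  c < x < u -> P u = 1 -> P x < 1 -> 1 < P c -> exists d, c < d < u /\ Derive P d = 0.
Proof.
  intros HD Hx Hu Hlt Hc.
  destruct (IVT_gen P c x 1) as [z [Hz Ez]].
  - intros w. apply ex_derive_continuity_pt, HD.
  - rewrite Rmin_right, Rmax_left; lra.
  - rewrite Rmin_left, Rmax_right in Hz by lra.
    assert (z <> c) by (intros ->; lra).
    destruct (Rolle_Derive P z u) as [d [Hd Ed]]; auto; try lra. exists d. split; auto. lra.
Qed.

(** P - 1 has finitely many zeros, so P cannot equal 1 throughout an interval. *)
Lemma poly_lt_one_somewhere n P a b c : poly_deg_le n P -> 1 < P c -> a < b ->
  (forall x, a < x < b -> P x <= 1) -> exists x, a < x < b /\ P x < 1.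
Proof.
  intros HP Hc Hab HB.
  destruct (poly_root_list n (fun x => P x + - (1))) as [L HL].
  { apply poly_plus; auto. apply poly_const. }
  { exists c. lra. }
  destruct (list_avoids_interval L a b Hab) as [x [Hx Nx]].
  exists x. split; auto. assert (H := HB x Hx). rewrite HL in Nx. lra.
Qed.

(** A count from both sides. The n + 2 alternation points lie among c, the four endpoints and the
    interior points [I], while P' has at most n - 1 distinct zeros, among them c and all of [I]. So
    [I] has at most n - 2 elements, and at least n - 3 when all endpoints occur; few endpoints can
    be missing. *)
Lemma extremal_structure n alpha beta P c :
  (3 <= n)%nat -> -1 < alpha -> beta < 1 -> extremal n alpha beta P c ->
  exists I, NoDup I /\
    (forall z, In z I -> (-1 < z < alpha \/ beta < z < 1) /\ P z ^ 2 = 1 /\ Derive P z = 0) /\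
    P alpha = 1 /\ P beta = 1 /\
    ((length I + 2 = n)%nat /\ (P (-1) ^ 2 = 1 \/ P 1 ^ 2 = 1) \/
     (length I + 3 = n)%nat /\ P (-1) ^ 2 = 1 /\ P 1 ^ 2 = 1 /\
       0 < (-1) ^ (n + 1) * (P (-1) * P 1)).
Proof.
  intros Hn Ha Hb Hext. destruct (extremal_alternation _ _ _ _ _ Ha Hb Hext) as [y [Sy [Ly [Ay Ey]]]].
  assert (Dc := extremal_Derive _ _ _ _ _ Hext).
  destruct Hext as [[HP HB] [Hc [HM _]]].
  assert (HD : forall x, ex_derive P x) by (intros; eapply poly_ex_derive; eassumption).
  assert (HB' : forall x, -1 <= x <= alpha \/ beta <= x <= 1 -> P x <= 1).
  { intros x Hx. eapply Rle_trans; [apply Rle_abs|]. now apply HB. }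
  assert (NC : exists u v, P u <> P v).
  { exists alpha, c. assert (H := HB' alpha ltac:(lra)). lra. }
  assert (HPn : poly_deg_le (S (n - 1)) P) by (replace (S (n - 1)) with n by lia; auto).
  set (s := fun z => if Req_EM_T z c then -1 else P z) in *.
  assert (Hs : forall z, z <> c -> s z = P z).
  { intros z Hz. unfold s. destruct (Req_EM_T z c); tauto. }
  assert (Hsc : s c = -1) by (unfold s; destruct (Req_EM_T c c); tauto).
  assert (NDy := sorted_NoDup _ Sy).
  set (inner := fun z => -1 < z < alpha \/ beta < z < 1).
  set (I := filter (fun z => if excluded_middle_informative (inner z) then true else false) y).
  assert (HI : forall z, In z I <-> In z y /\ inner z).
  { intros z. unfold I. rewrite filter_In.
    destruct (excluded_middle_informative (inner z)); intuition discriminate. }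
  assert (NDI : NoDup I) by now apply NoDup_filter.
  assert (PI : forall z, In z I -> inner z /\ P z ^ 2 = 1 /\ Derive P z = 0).
  { intros z Hz. apply HI in Hz. destruct Hz as [Hz Hin]. split; auto.
    destruct (Ey z Hz) as [->|[_ E]]; [unfold inner in Hin; lra|]. split; auto.
    destruct Hin as [Hin|Hin]; eapply Derive_local_sqr_max with (2 := Hin); auto;
      intros x Hx; apply HB; unfold two_intervals; lra. }
  assert (Ncrit : forall L, NoDup L -> (forall z, In z L -> Derive P z = 0) -> (length L <= n - 1)%nat).
  { intros L HL HZ. now apply (poly_roots_derive_length (n - 1) P L). }
  assert (NcI : ~ In c I) by (intros H; apply HI in H; unfold inner in H; lra).
  assert (LI : (length I + 2 <= n)%nat).
  { assert (H := Ncrit (c :: I)). simpl in H. enough (S (length I) <= n - 1)%nat by lia. apply H.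
    - now constructor.
    - intros z [<-|Hz]; auto. now apply PI. }
  assert (Cases : forall z, In z y -> z = c \/ z = -1 \/ z = alpha \/ z = beta \/ z = 1 \/ In z I).
  { intros z Hz. destruct (Ey z Hz) as [->|[Hz2 E]]; auto.
    destruct (classic (inner z)) as [H|H].
    - do 5 right. apply HI. auto.
    - unfold inner in H. unfold two_intervals in Hz2. lra. }
  assert (Count : forall L, (forall z, In z y -> In z L) -> (n + 2 <= length L)%nat).
  { intros L HL. rewrite <- Ly. now apply NoDup_incl_length. }
  (* Without c the signs are those of P itself, and a polynomial of degree n cannot alternate at n +
     2 points. *)
  assert (Hcy : In c y).
  { apply NNPP. intros N. apply (alternates_length n P y HP Sy); [|lia].
    apply alternates_ext with s; auto. intros z Hz. apply Hs. intros ->. tauto. }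
  destruct (in_split c y Hcy) as [l1 [l2 Ey12]].
  assert (S12 := Sy). rewrite Ey12 in S12. destruct (sorted_app _ _ _ S12) as [Sl1 Sl2].
  assert (A12 := Ay). rewrite Ey12 in A12.
  assert (Iny : forall z, In z y <-> In z l1 \/ z = c \/ In z l2).
  { intros z. rewrite Ey12, in_app_iff. simpl. intuition. }
  assert (Hal : In alpha y /\ P alpha = 1).
  { destruct (exists_last (l := l1)) as [l1' [u E1]].
    { intros ->. enough (n + 2 <= length (c :: beta :: 1%R :: I))%nat by (simpl in *; lia).
      apply Count. intros z Hz. assert (Hz' := Hz). apply Iny in Hz'.
      destruct Hz' as [[]|[->|Hz']]; [now left|]. apply Sl2 in Hz'.
      destruct (Cases z Hz) as [?|[?|[?|[?|[?|?]]]]]; simpl; auto; lra. }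
    assert (Hu : In u y) by (apply Iny; left; rewrite E1; apply in_or_app; right; now left).
    assert (Huc : u < c) by (apply Sl1; rewrite E1; apply in_or_app; right; now left).
    assert (Pu : P u = 1).
    { rewrite E1, <- app_assoc in A12. apply alternates_app in A12. simpl in A12.
      destruct A12 as [A12 _]. rewrite Hsc, Hs in A12 by lra.
      destruct (Ey u Hu) as [?|[_ E]]; [lra|].
      assert (E' : (P u - 1) * (P u + 1) = 0) by lra. apply Rmult_integral in E'. lra. }
    assert (Hua : -1 <= u <= alpha).
    { destruct (Ey u Hu) as [?|[[?|?] _]]; lra. }
    (* If the left neighbour u of c in the list is not alpha, P has one more critical point between
       u and c, leaving at most n - 3 points in [I]. As alpha is then missing from the list, [I]
       would need n - 2. *)
    destruct (Req_EM_T u alpha) as [->|Nu]; [auto|exfalso].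
    destruct (poly_lt_one_somewhere n P u alpha c) as [x [Hx Px]]; auto; try lra.
    { intros x Hx. apply HB'. lra. }
    destruct (critical_right P u x c) as [d [Hd Dd]]; auto; try lra.
    assert (Gap : forall z, In z y -> ~ (u < z < c)).
    { intros z Hz Hz2. apply Iny in Hz. destruct Hz as [Hz|[->|Hz]].
      - rewrite E1 in Hz, S12. rewrite <- app_assoc in S12. destruct (sorted_app _ _ _ S12) as [S3 _].
        apply in_app_or in Hz. destruct Hz as [Hz|[->|[]]]; [apply S3 in Hz|]; lra.
      - lra.
      - apply Sl2 in Hz. lra. }
    enough (length (d :: c :: I) <= n - 1 /\ n + 2 <= length (c :: (-1)%R :: beta :: 1%R :: I))%nat
      by (simpl in *; lia).
    split.
    - apply Ncrit.
      + constructor; [|now constructor]. intros [->|H]; [lra|]. apply HI in H. apply (Gap d); tauto.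
      + intros z [<-|[<-|Hz]]; auto. now apply PI.
    - apply Count. intros z Hz.
      destruct (Cases z Hz) as [?|[?|[E|[?|[?|?]]]]]; simpl; auto.
      exfalso. subst z. apply (Gap alpha); auto; lra. }
  assert (Hbe : In beta y /\ P beta = 1).
  { destruct l2 as [|u l2'] eqn:E2.
    { exfalso. enough (n + 2 <= length (c :: (-1)%R :: alpha :: I))%nat by (simpl in *; lia).
      apply Count. intros z Hz. assert (Hz' := Hz). apply Iny in Hz'.
      destruct Hz' as [Hz'|[->|[]]]; [|now left]. apply Sl1 in Hz'.
      destruct (Cases z Hz) as [?|[?|[?|[?|[?|?]]]]]; simpl; auto; lra. }
    assert (Hu : In u y) by (apply Iny; right; right; now left).
    assert (Huc : c < u) by (apply Sl2; now left).
    assert (Pu : P u = 1).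
    { apply alternates_app in A12. simpl in A12.
      destruct A12 as [A12 _]. rewrite Hsc, Hs in A12 by lra.
      destruct (Ey u Hu) as [?|[_ E]]; [lra|].
      assert (E' : (P u - 1) * (P u + 1) = 0) by lra. apply Rmult_integral in E'. lra. }
    assert (Hua : beta <= u <= 1).
    { destruct (Ey u Hu) as [?|[[?|?] _]]; lra. }
    destruct (Req_EM_T u beta) as [->|Nu]; [auto|exfalso].
    destruct (poly_lt_one_somewhere n P beta u c) as [x [Hx Px]]; auto; try lra.
    { intros x Hx. apply HB'. lra. }
    destruct (critical_left P c x u) as [d [Hd Dd]]; auto; try lra.
    assert (Gap : forall z, In z y -> ~ (c < z < u)).
    { intros z Hz Hz2. apply Iny in Hz. destruct Hz as [Hz|[->|Hz]].
      - apply Sl1 in Hz. lra.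
      - lra.
      - replace (l1 ++ c :: u :: l2') with ((l1 ++ [c]) ++ u :: l2') in S12 by now rewrite <- app_assoc.
        destruct (sorted_app _ _ _ S12) as [_ S3].
        destruct Hz as [->|Hz]; [|apply S3 in Hz]; lra. }
    enough (length (d :: c :: I) <= n - 1 /\ n + 2 <= length (c :: (-1)%R :: alpha :: 1%R :: I))%nat
      by (simpl in *; lia).
    split.
    - apply Ncrit.
      + constructor; [|now constructor]. intros [->|H]; [lra|]. apply HI in H. apply (Gap d); tauto.
      + intros z [<-|[<-|Hz]]; auto. now apply PI.
    - apply Count. intros z Hz.
      destruct (Cases z Hz) as [?|[?|[?|[E|[?|?]]]]]; simpl; auto.
      exfalso. subst z. apply (Gap beta); auto; lra. }
  assert (Hend : forall z, In z y -> z = -1 \/ z = 1 -> P z ^ 2 = 1).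
  { intros z Hz Hz1. destruct (Ey z Hz) as [?|[_ E]]; auto. lra. }
  exists I. split; [auto|split; [auto|split; [tauto|split; [tauto|]]]].
  (* With both outer endpoints in the list, [I] has n - 2 or n - 3 elements, and n - 3 makes n + 1
     sign changes from -1 to 1. With exactly one of them, [I] has n - 2; with none, it would need n
     - 1. *)
  destruct (classic (In (-1) y)) as [Im|Im]; destruct (classic (In 1 y)) as [Ip|Ip].
  - destruct (Nat.eq_dec (length I + 2) n) as [E|E]; [left; auto|right].
    assert (H5 : (n + 2 <= length (c :: (-1)%R :: alpha :: beta :: 1%R :: I))%nat).
    { apply Count. intros z Hz.
      destruct (Cases z Hz) as [?|[?|[?|[?|[?|?]]]]]; simpl; auto 7. }
    simpl in H5. split; [lia|]. split; [auto|split; [auto|]].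
    destruct y as [|y0 t]; [destruct Hcy|]. simpl in Ly.
    assert (Hall : forall z, In z (y0 :: t) -> -1 <= z <= 1).
    { intros z Hz. destruct (Ey z Hz) as [->|[[?|?] _]]; lra. }
    assert (y0 = -1).
    { destruct Im as [?|Im]; auto. inversion Sy as [|? ? _ HF]; subst.
      apply (proj1 (Forall_forall _ _) HF) in Im. assert (H := Hall y0 (or_introl eq_refl)). lra. }
    assert (last t y0 = 1).
    { assert (Ht : t <> []) by (intros ->; simpl in Ly; lia).
      destruct (exists_last Ht) as [t' [w Et]]. rewrite Et, last_last.
      rewrite Et, app_comm_cons in Ip, Sy. destruct (sorted_app _ _ _ Sy) as [S3 _].
      apply in_app_or in Ip. destruct Ip as [Ip|[Ip|[]]]; auto. apply S3 in Ip.
      assert (H1 := Hall w). rewrite Et in H1. specialize (H1 ltac:(right; apply in_or_app; right; now left)).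
      lra. }
    assert (HE := alternates_ends s y0 t Ay). replace (length t) with (n + 1)%nat in HE by lia.
    rewrite H0, H, !Hs in HE by lra. apply HE. left. intros ->. simpl in Ly. lia.
  - left. assert (H5 : (n + 2 <= length (c :: (-1)%R :: alpha :: beta :: I))%nat).
    { apply Count. intros z Hz.
      destruct (Cases z Hz) as [?|[?|[?|[?|[->|?]]]]]; simpl; auto 7; tauto. }
    simpl in H5. split; [lia|auto].
  - left. assert (H5 : (n + 2 <= length (c :: 1%R :: alpha :: beta :: I))%nat).
    { apply Count. intros z Hz.
      destruct (Cases z Hz) as [?|[->|[?|[?|[?|?]]]]]; simpl; auto 7; tauto. }
    simpl in H5. split; [lia|auto].
  - exfalso. assert (H5 : (n + 2 <= length (c :: alpha :: beta :: I))%nat).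
    { apply Count. intros z Hz.
      destruct (Cases z Hz) as [?|[->|[?|[?|[->|?]]]]]; simpl; auto 7; tauto. }
    simpl in H5. lia.
Qed.

(** * Factorization of P' and P^2 - 1 *)

(** The coefficient of x^n as a limit, which is compatible with products and avoids coefficient
    sequences. It may be 0, so a drop of the degree is the case a = 0. *)
Definition lead n (P : R -> R) (a : R) : Prop := is_lim (fun x => P x / x ^ n) p_infty a.

Lemma lead_unique n P a b : lead n P a -> lead n P b -> a = b.
Proof.
  intros H1 H2. apply is_lim_unique in H1, H2. rewrite H1 in H2. now injection H2.
Qed.

Lemma lead_ext n P Q a : (forall x, P x = Q x) -> lead n P a -> lead n Q a.
Proof. intros E. apply is_lim_ext. intros x. now rewrite E. Qed.

Lemma lead_plus n P Q a b : lead n P a -> lead n Q b -> lead n (fun x => P x + Q x) (a + b).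
Proof.
  intros H1 H2. apply (is_lim_ext (fun x => P x / x ^ n + Q x / x ^ n)).
  - intros x. unfold Rdiv. ring.
  - now apply is_lim_plus'.
Qed.

Lemma lead_mult n m P Q a b : lead n P a -> lead m Q b -> lead (n + m) (fun x => P x * Q x) (a * b).
Proof.
  intros H1 H2. apply (is_lim_ext (fun x => P x / x ^ n * (Q x / x ^ m))).
  - intros x. unfold Rdiv. rewrite pow_add, Rinv_mult. ring.
  - apply (is_lim_mult _ _ p_infty a b); auto. exact I.
Qed.

Lemma lead_const c : lead 0 (fun _ => c) c.
Proof.
  apply (is_lim_ext (fun _ => c)); [intros; simpl; field|]. apply is_lim_const.
Qed.

Lemma lead_mulx n P a : lead n P a -> lead (S n) (fun x => x * P x) a.
Proof.
  apply (is_lim_ext_loc (fun x => P x / x ^ n)).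
  exists 0. intros x Hx. simpl. field. split; [apply pow_nonzero|]; lra.
Qed.

Lemma lead_lower n P a : lead n P a -> lead (S n) P 0.
Proof.
  intros H. apply (is_lim_ext (fun x => P x / x ^ n * / x)).
  - intros x. simpl. unfold Rdiv. rewrite Rinv_mult. ring.
  - replace 0 with (a * 0) by ring.
    apply (is_lim_mult _ _ p_infty a 0); auto; [|exact I].
    apply (is_lim_inv (fun x => x) p_infty p_infty); [apply is_lim_id|discriminate].
Qed.

Lemma lead_const_S n c : lead (S n) (fun _ => c) 0.
Proof.
  induction n as [|n IH]; [apply lead_lower with c, lead_const|now apply lead_lower with 0].
Qed.

Lemma lead_S n P Q c a : (forall x, P x = c + x * Q x) -> lead n Q a -> lead (S n) P a.
Proof.
  intros E H. apply (lead_ext _ (fun x => c + x * Q x)); [intros; now rewrite E|].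
  replace a with (0 + a) by ring. apply lead_plus; [apply lead_const_S|now apply lead_mulx].
Qed.

Lemma lead_root_prod L : lead (length L) (root_prod L) 1.
Proof.
  induction L as [|z L IH]; [apply lead_const|].
  replace 1 with (1 * 1) by ring. apply (lead_mult 1 (length L) (fun x => x - z)); auto.
  apply (lead_S 0 _ (fun _ => 1) (- z)); [intros; ring|apply lead_const].
Qed.

Lemma poly_lead n P : poly_deg_le (S n) P -> exists a,
  lead (S n) P a /\ lead (S n) (fun x => P (- x)) ((-1) ^ S n * a) /\
  lead n (Derive P) (INR (S n) * a) /\ (a = 0 -> poly_deg_le n P).
Proof.
  revert P. induction n as [|n IH]; intros P HP;
    destruct (proj1 (poly_S _ _) HP) as [c [Q [HQ E]]].
  - destruct (proj1 (poly_0 _) HQ) as [q Hq]. exists q. split; [|split; [|split]].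
    + apply (lead_S 0 P Q c); auto. apply (lead_ext _ (fun _ => q)); [now intros|apply lead_const].
    + apply (lead_S 0 _ (fun _ => (-1) ^ 1 * q) c); [|apply lead_const].
      intros x. rewrite E, Hq. simpl. ring.
    + apply (lead_ext _ (fun _ => INR 1 * q)); [|apply lead_const].
      intros x. symmetry. apply is_derive_unique.
      apply (is_derive_ext (fun x => c + x * q)); [intros; now rewrite E, Hq|].
      auto_derive; auto.
    + intros ->. apply poly_0. exists c. intros x. rewrite E, Hq. ring.
  - destruct (IH Q HQ) as [a [L1 [L2 [L3 L4]]]]. exists a. split; [|split; [|split]].
    + now apply (lead_S _ P Q c).
    + apply (lead_S _ _ (fun x => (-1) * Q (- x)) c).
      * intros x. rewrite E. ring.
      * replace ((-1) ^ S (S n) * a) with ((-1) * ((-1) ^ S n * a)) by (simpl; ring).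
        apply (lead_mult 0 (S n) (fun _ => -1)); auto. apply lead_const.
    + apply (lead_ext _ (fun x => Q x + x * Derive Q x)).
      * intros x. symmetry. rewrite (Derive_ext P (fun x => c + x * Q x) x E).
        rewrite (Derive_plus (fun _ => c)), (Derive_const c); [|auto_derive; auto|].
        -- rewrite (Derive_mult (fun x => x) Q), (Derive_id x : Derive (fun x => x) x = 1).
           ++ ring.
           ++ auto_derive; auto.
           ++ eapply poly_ex_derive; eassumption.
        -- apply (ex_derive_mult (fun x => x) Q); [auto_derive; auto|].
           eapply poly_ex_derive; eassumption.
      * replace (INR (S (S n)) * a) with (a + INR (S n) * a) by (rewrite (S_INR (S n)); ring).
        apply lead_plus; auto. now apply lead_mulx.
    + intros H. apply poly_S. exists c, Q. auto.
Qed.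

Lemma lead_sign n P a M : lead n P a -> a <> 0 -> exists X, M < X /\ 0 < X /\ 0 < P X * a.
Proof.
  intros H Ha. apply is_lim_spec in H.
  assert (Hpos : 0 < Rabs a) by now apply Rabs_pos_lt.
  destruct (H (mkposreal _ Hpos)) as [M' HM']. simpl in HM'.
  set (X := Rmax 0 (Rmax M M') + 1).
  assert (H0 := Rmax_l 0 (Rmax M M')). assert (H1 := Rmax_r 0 (Rmax M M')).
  assert (H2 := Rmax_l M M'). assert (H3 := Rmax_r M M').
  assert (HX : 0 < X) by (unfold X; lra).
  exists X. split; [unfold X; lra|]. split; auto.
  assert (HR := HM' X ltac:(unfold X; lra)).
  assert (Hp : 0 < X ^ n) by now apply pow_lt.
  assert (HR2 : 0 < P X / X ^ n * a).
  { unfold Rabs in HR. destruct (Rcase_abs (P X / X ^ n - a)), (Rcase_abs a); nra. }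
  replace (P X * a) with (P X / X ^ n * a * X ^ n) by (field; lra). nra.
Qed.

Definition gapH alpha beta x := (1 - x ^ 2) * ((x - alpha) * (beta - x)).

(* A third interval [g,e] of the inverse image of [-1,1] lies to the right of 1,
   with critical point d; the case g = d = 1 means that [beta,1] is enlarged. *)
Definition right_pell n alpha beta P c : Prop := exists d g e,
  1 <= d /\ d <= g /\ g <= e /\
  (forall x, Derive P x ^ 2 * gapH alpha beta x * ((g - x) * (e - x)) =
             INR n ^ 2 * (c - x) ^ 2 * (d - x) ^ 2 * (P x ^ 2 - 1)) /\
  (forall x, alpha < x < beta -> x <> c -> Derive P x <> 0) /\
  (e = d \/ g < e /\ forall x, g < x < e -> P x ^ 2 < 1).

Definition inner_points alpha beta (P : R -> R) I : Prop := NoDup I /\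
  forall z, In z I -> (-1 < z < alpha \/ beta < z < 1) /\ P z ^ 2 = 1 /\ Derive P z = 0.

Section Factorization.

Variables (n : nat) (alpha beta : R) (P : R -> R) (c : R) (I : list R).
Hypotheses (Hn : (1 <= n)%nat) (Ha : -1 < alpha) (Hb : beta < 1) (Hc : alpha < c < beta).
Hypotheses (HP : poly_deg_le n P) (HI : inner_points alpha beta P I).
Hypotheses (Pa : P alpha = 1) (Pb : P beta = 1) (Pc : 1 < P c) (Dc : Derive P c = 0).

Lemma inner_notin x : (x <= -1 \/ alpha <= x <= beta \/ 1 <= x) -> ~ In x I.
Proof. intros H1 H2. destruct HI as [_ H]. apply H in H2. lra. Qed.

Lemma Derive_factorization m : (length I + 1 + m = n - 1)%nat ->
  exists Q, poly_deg_le m Q /\ forall x, Derive P x = (x - c) * root_prod I x * Q x.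
Proof.
  intros Hm. destruct HI as [ND HI'].
  destruct (poly_factor_list (c :: I) m (Derive P)) as [Q [HQ E]].
  - constructor; auto. apply inner_notin. lra.
  - simpl. replace (S (length I + m)) with (pred n) by lia. now apply poly_Derive.
  - intros z [<-|Hz]; auto. now apply HI'.
  - exists Q. split; auto.
Qed.

Lemma square_factorization L m : NoDup L ->
  (forall z, In z L -> (z <= -1 \/ alpha <= z <= beta \/ 1 <= z) /\ P z ^ 2 = 1) ->
  (2 * length I + (length L + m) = n + n)%nat ->
  exists Q, poly_deg_le m Q /\ forall x, P x ^ 2 - 1 = root_prod I x ^ 2 * (root_prod L x * Q x).
Proof.
  intros NL HL Hm. destruct HI as [ND HI'].
  assert (HPP : poly_deg_le (n + n) (fun x => P x * P x + - (1))).
  { apply poly_plus; [now apply poly_mult|apply poly_const]. }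
  destruct (poly_double_factor_list I (length L + m) (fun x => P x * P x + - (1))) as [R1 [HR1 E1]]; auto.
  - now rewrite Hm.
  - intros z Hz. destruct (HI' z Hz) as [_ [E D]]. split; [lra|].
    rewrite (Derive_plus (fun x => P x * P x) (fun _ => - (1))), Derive_const, Derive_mult.
    + rewrite D. ring.
    + eapply poly_ex_derive; eassumption.
    + eapply poly_ex_derive; eassumption.
    + eapply poly_ex_derive. apply poly_mult; eassumption.
    + auto_derive; auto.
  - destruct (poly_factor_list L m R1 NL HR1) as [Q [HQ E2]].
    + intros z Hz. destruct (HL z Hz) as [Hz1 Hz2]. specialize (E1 z).
      assert (Hr := root_prod_neq I z (inner_notin z Hz1)).
      assert (H0 : root_prod I z ^ 2 * R1 z = 0) by lra.
      apply Rmult_integral in H0. destruct H0 as [H0|H0]; auto.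
      exfalso. apply (pow_nonzero _ 2 Hr H0).
    + exists Q. split; auto. intros x. rewrite <- E2, <- E1. ring.
Qed.

Lemma lead_square a : lead n P a -> lead (n + n) (fun x => P x ^ 2 - 1) (a * a).
Proof.
  intros H. apply (lead_ext _ (fun x => P x * P x + - (1))); [intros; ring|].
  replace (a * a) with (a * a + 0) by ring. apply lead_plus; [now apply lead_mult|].
  replace (n + n)%nat with (S (n + n - 1)) by lia. apply lead_const_S.
Qed.

Lemma not_constant : ~ forall x, Derive P x = 0.
Proof.
  intros H. destruct (MVT_gen P alpha c (Derive P)) as [z [_ E]].
  - intros; eapply poly_is_derive; eassumption.
  - intros; eapply poly_continuity_pt; eassumption.
  - rewrite H in E. lra.
Qed.

(** Here P' is c and [I] up to a constant, and P^2 - 1 has the double zeros [I] and the simple zeros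
    -1, alpha, beta, which leaves one zero b. The sign at 1 forces b >= 1: the right interval
    extends to [beta,b]. Comparing leading coefficients gives the factor n^2. *)
Lemma right_pell_enlarged : (length I + 2 = n)%nat -> P (-1) ^ 2 = 1 -> P 1 ^ 2 <= 1 ->
  right_pell n alpha beta P c.
Proof.
  intros Hl Pm P1.
  destruct (Derive_factorization 0) as [Q [HQ ED]]; [lia|].
  destruct (proj1 (poly_0 _) HQ) as [q Hq].
  destruct (square_factorization [-1; alpha; beta] 1) as [R1 [HR1 ER]].
  { repeat constructor; simpl; intuition lra. }
  { intros z [<-|[<-|[<-|[]]]]; split; try lra; rewrite ?Pa, ?Pb; ring. }
  { simpl. lia. }
  destruct (proj1 (poly_S _ _) HR1) as [r0 [Q1 [HQ1 E1]]].
  destruct (proj1 (poly_0 _) HQ1) as [r1 Hr1].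
  assert (Hn1 : exists n', n = S n') by (exists (n - 1)%nat; lia). destruct Hn1 as [n' En].
  assert (HP' := HP). rewrite En in HP'.
  destruct (poly_lead n' P HP') as [a [L1 [_ [L3 _]]]]. rewrite <- En in L1, L3.
  assert (Eq : q = INR n * a).
  { apply lead_unique with n' (Derive P); auto.
    apply (lead_ext _ (fun x => root_prod (c :: I) x * Q x)).
    { intros x. rewrite ED. reflexivity. }
    replace n' with (length (c :: I) + 0)%nat by (simpl; lia).
    replace q with (1 * q) by ring. apply lead_mult; [apply lead_root_prod|].
    apply (lead_ext _ (fun _ => q)); auto. apply lead_const. }
  assert (Er : r1 = a ^ 2).
  { replace (a ^ 2) with (a * a) by ring.
    apply lead_unique with (n + n)%nat (fun x => P x ^ 2 - 1); [|now apply lead_square].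
    apply (lead_ext _ (fun x => root_prod I x * root_prod I x * (root_prod [-1; alpha; beta] x * R1 x))).
    { intros x. rewrite ER. ring. }
    replace (n + n)%nat with (length I + length I + (length [-1; alpha; beta]%R + 1))%nat by (simpl; lia).
    replace r1 with (1 * 1 * (1 * r1)) by ring.
    repeat apply lead_mult; try apply lead_root_prod.
    apply (lead_S 0 _ Q1 r0); auto. apply (lead_ext _ (fun _ => r1)); auto. apply lead_const. }
  assert (Hq0 : q <> 0).
  { intros H. apply not_constant. intros x. rewrite ED, Hq, H. ring. }
  assert (Ha0 : a <> 0) by (intros H; apply Hq0; rewrite Eq, H; ring).
  assert (Ha2 : 0 < a ^ 2) by nra.
  set (b := - r0 / a ^ 2).
  assert (ER1 : forall x, R1 x = a ^ 2 * (x - b)).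
  { intros x. rewrite E1, Hr1, Er. unfold b. field. auto. }
  assert (Hb1 : 1 <= b).
  { specialize (ER 1). rewrite ER1 in ER. unfold root_prod at 2 in ER. simpl in ER.
    assert (Hr := root_prod_neq I 1 (inner_notin 1 ltac:(lra))).
    assert (0 < root_prod I 1 ^ 2) by (apply pow2_gt_0; auto).
    apply Rnot_lt_le. intros Hlt.
    assert (0 < root_prod I 1 ^ 2 * (a ^ 2 * (1 - b))) by (apply Rmult_lt_0_compat; nra).
    assert (0 < (1 - alpha) * (1 - beta)) by nra. nra. }
  (* With d = g = 1 both sides of the equation carry the factor (1 - x)^2, so that in effect only
     the endpoint 1 is replaced by b. *)
  exists 1, 1, b. repeat split; try lra.
  - intros x. rewrite ER, ED, Hq, ER1, Eq. unfold gapH, root_prod at 3. simpl. ring.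
  - intros x Hx Hxc. rewrite ED, Hq.
    assert (Hr := root_prod_neq I x (inner_notin x ltac:(lra))).
    repeat apply Rmult_integral_contrapositive_currified; auto. lra.
  - destruct (Req_EM_T b 1) as [->|Nb]; [now left|right]. split; [lra|].
    intros x Hx. specialize (ER x). rewrite ER1 in ER. unfold root_prod at 2 in ER. simpl in ER.
    assert (Hr := root_prod_neq I x (inner_notin x ltac:(lra))).
    assert (0 < root_prod I x ^ 2) by (apply pow2_gt_0; auto).
    assert (0 < root_prod I x ^ 2 * (a ^ 2 * (b - x))) by (apply Rmult_lt_0_compat; nra).
    assert (0 < (x + 1) * ((x - alpha) * (x - beta))) by (repeat apply Rmult_lt_0_compat; lra).
    nra.
Qed.

(** With one interior point fewer, P' has one zero d left and P^2 - 1 has a quadratic factor left.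
    The point x0 makes this quadratic negative to the right of 1, so its zeros g and e enclose
    x0. *)
Lemma right_pell_detached a x0 : (length I + 3 = n)%nat -> P (-1) ^ 2 = 1 -> P 1 ^ 2 = 1 ->
  (forall x, beta <= x <= 1 -> P x ^ 2 <= 1) ->
  lead n P a -> a <> 0 -> 1 < x0 -> P x0 ^ 2 < 1 ->
  right_pell n alpha beta P c.
Proof.
  intros Hl Pm P1 PB La Ha0 Hx0 Px0.
  destruct (Derive_factorization 1) as [Q [HQ ED]]; [lia|].
  destruct (square_factorization [-1; alpha; beta; 1] 2) as [R1 [HR1 ER]].
  { repeat constructor; simpl; intuition lra. }
  { intros z [<-|[<-|[<-|[<-|[]]]]]; split; try lra; rewrite ?Pa, ?Pb; ring. }
  { simpl. lia. }
  destruct (proj1 (poly_S _ _) HQ) as [q0 [Q0 [HQ0 EQ0]]].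
  destruct (proj1 (poly_0 _) HQ0) as [q Hq].
  assert (Hn1 : exists n', n = S n') by (exists (n - 1)%nat; lia). destruct Hn1 as [n' En].
  assert (HP' := HP). rewrite En in HP'.
  destruct (poly_lead n' P HP') as [a' [L1 [_ [L3 _]]]]. rewrite <- En in L1, L3.
  assert (a' = a) by (eapply lead_unique; eassumption). subst a'.
  assert (Eq : q = INR n * a).
  { apply lead_unique with n' (Derive P); auto.
    apply (lead_ext _ (fun x => root_prod (c :: I) x * Q x)).
    { intros x. rewrite ED. reflexivity. }
    replace n' with (length (c :: I) + 1)%nat by (simpl; lia).
    replace q with (1 * q) by ring. apply lead_mult; [apply lead_root_prod|].
    apply (lead_S 0 _ Q0 q0); auto. apply (lead_ext _ (fun _ => q)); auto. apply lead_const. }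
  assert (Hn0 : 0 < INR n) by (apply lt_0_INR; lia).
  assert (Hq0 : q <> 0).
  { rewrite Eq. apply Rmult_integral_contrapositive_currified; lra. }
  assert (Ha2 : 0 < a ^ 2) by (apply pow2_gt_0; auto).
  assert (ER' : forall x, P x ^ 2 - 1 = root_prod I x ^ 2 * gapH alpha beta x * R1 x).
  { intros x. rewrite ER. unfold root_prod at 2, gapH. simpl. ring. }
  assert (Hr2 : forall x, (alpha <= x <= beta \/ 1 <= x) -> 0 < root_prod I x ^ 2).
  { intros x Hx. apply pow2_gt_0, root_prod_neq, inner_notin. lra. }
  assert (Hright : forall x, 1 < x -> 0 < root_prod I x ^ 2 * gapH alpha beta x).
  { intros x Hx. apply Rmult_lt_0_compat; [apply Hr2; lra|]. unfold gapH.
    replace ((1 - x ^ 2) * ((x - alpha) * (beta - x)))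
      with ((x - 1) * (x + 1) * ((x - alpha) * (x - beta))) by ring.
    repeat apply Rmult_lt_0_compat; lra. }
  assert (CR1 : forall x, continuity_pt R1 x) by (intros; eapply poly_continuity_pt; eassumption).
  assert (R10 : R1 x0 < 0).
  { specialize (ER' x0). assert (H := Hright x0 Hx0). nra. }
  (* Just to the left of 1, P^2 <= 1 and [gapH] is negative, so the remaining quadratic cannot be
     negative there. Continuity carries this to 1. *)
  assert (R11 : 0 <= R1 1).
  { apply Rnot_lt_le. intros Hlt.
    assert (Hcont : continuity_pt (fun x => root_prod I x ^ 2 * R1 x) 1).
    { apply continuity_pt_mult; auto.
      apply (continuity_pt_comp (root_prod I) (fun y => y ^ 2)).
      - eapply poly_continuity_pt. apply root_prod_poly.
      - apply ex_derive_continuity_pt. auto_derive; auto. }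
    apply continuity_pt_filterlim in Hcont.
    assert (Hneg : root_prod I 1 ^ 2 * R1 1 < 0).
    { assert (H := Hr2 1 ltac:(lra)). nra. }
    destruct (Hcont (fun y => y < 0)) as [eps Heps].
    { apply (open_lt 0). exact Hneg. }
    set (t := Rmin (eps / 2) ((1 - beta) / 2)).
    assert (Ht : 0 < t) by (apply Rmin_pos; [destruct eps; simpl; lra|lra]).
    assert (Ht1 : t <= eps / 2) by apply Rmin_l.
    assert (Ht2 : t <= (1 - beta) / 2) by apply Rmin_r.
    assert (Hy : root_prod I (1 - t) ^ 2 * R1 (1 - t) < 0).
    { apply Heps. change (Rabs ((1 - t) - 1) < eps). rewrite Rabs_left by lra.
      destruct eps; simpl in *; lra. }
    assert (HBt := PB (1 - t) ltac:(lra)). specialize (ER' (1 - t)).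
    assert (0 < - gapH alpha beta (1 - t)).
    { unfold gapH.
      replace (- ((1 - (1 - t) ^ 2) * ((1 - t - alpha) * (beta - (1 - t)))))
        with (t * (2 - t) * ((1 - t - alpha) * (1 - t - beta))) by ring.
      repeat apply Rmult_lt_0_compat; lra. }
    nra. }
  destruct (IVT_gen R1 1 x0 0 CR1) as [g [Hg Rg]].
  { rewrite Rmin_right, Rmax_left; lra. }
  rewrite Rmin_left, Rmax_right in Hg by lra.
  assert (Hgx0 : g <> x0) by (intros ->; lra).
  destruct (poly_factor 1 R1 g HR1 Rg) as [R2 [HR2 E2]].
  destruct (proj1 (poly_S _ _) HR2) as [s0 [S1 [HS1 ES1]]].
  destruct (proj1 (poly_0 _) HS1) as [s1 Hs1].
  assert (Es : s1 = a ^ 2).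
  { replace (a ^ 2) with (a * a) by ring.
    apply lead_unique with (n + n)%nat (fun x => P x ^ 2 - 1); [|now apply lead_square].
    apply (lead_ext _ (fun x => root_prod I x * root_prod I x *
       (root_prod [-1; alpha; beta; 1] x * (root_prod [g] x * R2 x)))).
    { intros x. rewrite ER, E2. unfold root_prod at 4. simpl. ring. }
    replace (n + n)%nat with
      (length I + length I + (length [-1; alpha; beta; 1]%R + (length [g] + 1)))%nat by (simpl; lia).
    replace s1 with (1 * 1 * (1 * (1 * s1))) by ring.
    repeat apply lead_mult; try apply lead_root_prod.
    apply (lead_S 0 _ S1 s0); auto. apply (lead_ext _ (fun _ => s1)); auto. apply lead_const. }
  set (e := - s0 / a ^ 2).
  assert (ER1 : forall x, R1 x = a ^ 2 * ((x - g) * (x - e))).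
  { intros x. rewrite E2, ES1, Hs1, Es. unfold e. field. auto. }
  assert (Hxe : x0 < e).
  { rewrite ER1 in R10. apply Rnot_le_lt. intros Hle.
    assert (0 <= a ^ 2 * ((x0 - g) * (x0 - e))) by (apply Rmult_le_pos; [lra|apply Rmult_le_pos; lra]). lra. }
  set (d := - q0 / q).
  assert (EQ : forall x, Q x = INR n * a * (x - d)).
  { intros x. rewrite EQ0, Hq, <- Eq. unfold d. field. auto. }
  assert (Hin : forall x, g < x < e -> P x ^ 2 < 1).
  { intros x Hx. specialize (ER' x). assert (H := Hright x ltac:(lra)). rewrite ER1 in ER'.
    assert (0 < a ^ 2 * ((x - g) * (e - x))) by (apply Rmult_lt_0_compat; [lra|apply Rmult_lt_0_compat; lra]).
    nra. }
  assert (Hcrit : forall y, 1 <= y -> Derive P y = 0 -> y = d).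
  { intros y Hy E. rewrite ED, EQ in E.
    assert (Hr := root_prod_neq I y (inner_notin y ltac:(lra))).
    apply Rmult_integral in E. destruct E as [E|E].
    - apply Rmult_integral in E. destruct E; [lra|tauto].
    - apply Rmult_integral in E. destruct E as [E|E]; [|lra].
      exfalso. apply Hq0. now rewrite Eq. }
  (* If g = 1, then 1 is a double zero of P^2 - 1 and hence critical. Otherwise P^2 >= 1 on [1,g],
     so P takes the same value, 1 or -1, at both ends and Rolle gives a critical point between. In
     both cases it must be d. *)
  assert (Hd : 1 <= d <= g).
  { destruct (Req_EM_T g 1) as [Eg|Ng].
    - enough (1 = d) by lra. apply Hcrit; [lra|].
      assert (Hder : Derive (fun x => P x ^ 2 - 1) 1 = 0).
      { set (G := fun x => (x - 1) * (root_prod I x * root_prod I x *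
          ((x - -1) * (x - alpha) * (x - beta) * (a ^ 2 * (x - e))))).
        assert (HG : poly_deg_le (1 + (length I + length I + (1 + 1 + 1 + 1))) G).
        { repeat apply poly_mult; try apply root_prod_poly; try apply poly_linear.
          apply poly_scal, poly_linear. }
        rewrite (Derive_factor _ G 1).
        - unfold G. ring.
        - intros x. rewrite ER', ER1, Eg. unfold G, gapH. ring.
        - intros; eapply poly_ex_derive; exact HG. }
      assert (Hder2 : Derive (fun x => P x ^ 2 - 1) 1 = 2 * P 1 * Derive P 1).
      { apply is_derive_unique. assert (H := poly_is_derive n P 1 HP).
        auto_derive; [eexists; exact H|]. change (Derive (fun x => P x) 1) with (Derive P 1). ring. }
      rewrite Hder in Hder2.
      symmetry in Hder2. apply Rmult_integral in Hder2. destruct Hder2 as [E|E]; auto.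
      exfalso. nra.
    - assert (Pg : P g ^ 2 = 1).
      { specialize (ER' g). rewrite Rg in ER'. lra. }
      assert (Hout : forall x, 1 <= x <= g -> 1 <= P x ^ 2).
      { intros x Hx. destruct (Req_EM_T x 1) as [->|]; [lra|].
        specialize (ER' x). assert (H := Hright x ltac:(lra)). rewrite ER1 in ER'.
        assert (0 <= a ^ 2 * ((g - x) * (e - x))) by (apply Rmult_le_pos; [lra|apply Rmult_le_pos; lra]).
        nra. }
      assert (E1g : P 1 = P g).
      { assert (E : (P 1 - P g) * (P 1 + P g) = 0) by lra.
        apply Rmult_integral in E. destruct E as [E|E]; [lra|]. exfalso.
        destruct (IVT_gen P 1 g 0) as [y [Hy Py]].
        - intros y. eapply poly_continuity_pt; eassumption.
        - unfold Rmin, Rmax. destruct (Rle_dec (P 1) (P g)); lra.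
        - rewrite Rmin_left, Rmax_right in Hy by lra.
          assert (H := Hout y Hy). rewrite Py in H. lra. }
      destruct (Rolle_Derive P 1 g) as [y [Hy Dy]]; auto; try lra.
      { intros; eapply poly_ex_derive; eassumption. }
      rewrite <- (Hcrit y); lra. }
  exists d, g, e. repeat split; try lra.
  - intros x. rewrite ER', ED, EQ, ER1. ring.
  - intros x Hx Hxc. rewrite ED, EQ.
    assert (Hr := root_prod_neq I x (inner_notin x ltac:(lra))).
    rewrite <- Eq. repeat apply Rmult_integral_contrapositive_currified; auto; lra.
  - right. split; [lra|auto].
Qed.

End Factorization.

(** A parity contradiction. If P^2 >= 1 held on both outer rays, P would have no zero there, and its
    signs at -1 and 1 would be those at infinity, which the leading coefficient relates by
    (-1)^(n+1). The hypothesis prescribes the opposite relation. *)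
Lemma outside_small n alpha beta P a : poly_deg_le (S n) P -> -1 < alpha -> beta < 1 ->
  P (-1) ^ 2 = 1 -> P 1 ^ 2 = 1 -> 0 < (-1) ^ (S n + 1) * (P (-1) * P 1) ->
  lead (S n) P a -> a <> 0 -> exists x0, (1 < x0 \/ x0 < -1) /\ P x0 ^ 2 < 1.
Proof.
  intros HP Ha Hb Pm Pp Hsgn La Ha0.
  assert (CP : forall x, continuity_pt P x) by (intros; eapply poly_continuity_pt; eassumption).
  destruct (poly_lead n P HP) as [a' [L1 [L2 _]]].
  assert (a' = a) by (eapply lead_unique; eassumption). subst a'.
  assert (Hsq : (-1) ^ S n * (-1) ^ S n = 1).
  { rewrite <- Rpow_mult_distr. replace (-1 * -1) with 1 by ring. apply pow1. }
  rewrite pow_add, pow_1 in Hsgn. set (sg := (-1) ^ S n) in *.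
  assert (Hsg0 : sg <> 0) by (intros E; rewrite E in Hsq; lra).
  destruct (lead_sign _ _ _ 1 L1 Ha0) as [X [HX [_ HXs]]].
  destruct (lead_sign _ _ _ 1 L2) as [Y [HY [_ HYs]]].
  { now apply Rmult_integral_contrapositive_currified. }
  apply NNPP. intros N.
  assert (Hout : forall x, (1 <= x \/ x <= -1) -> P x <> 0).
  { intros x Hx E. destruct (Req_EM_T x 1) as [->|]; [rewrite E in Pp; lra|].
    destruct (Req_EM_T x (-1)) as [->|]; [rewrite E in Pm; lra|].
    apply N. exists x. split; [lra|]. rewrite E. lra. }
  assert (H1 : 0 < P 1 * P X).
  { apply Rnot_le_lt. intros Hle. destruct (IVT_gen P 1 X 0 CP) as [z [Hz Ez]].
    - unfold Rmin, Rmax. destruct (Rle_dec (P 1) (P X)); nra.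
    - rewrite Rmin_left in Hz by lra. apply (Hout z); auto. lra. }
  assert (H2 : 0 < P (-1) * P (- Y)).
  { apply Rnot_le_lt. intros Hle. destruct (IVT_gen P (-1) (- Y) 0 CP) as [z [Hz Ez]].
    - unfold Rmin, Rmax. destruct (Rle_dec (P (-1)) (P (- Y))); nra.
    - rewrite Rmax_left in Hz by lra. apply (Hout z); auto. lra. }
  assert (H3 : 0 < (P 1 * P X) * (P X * a)) by nra.
  assert (H4 : 0 < P 1 * a).
  { assert (0 < P X ^ 2) by (apply pow2_gt_0; nra). nra. }
  assert (H5 : 0 < (P (-1) * P (- Y)) * (P (- Y) * (sg * a))) by nra.
  assert (H6 : 0 < P (-1) * (sg * a)).
  { assert (0 < P (- Y) ^ 2) by (apply pow2_gt_0; nra).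
    apply Rmult_lt_reg_l with (P (- Y) ^ 2); auto. nra. }
  assert (H7 : 0 < a ^ 2) by (apply pow2_gt_0; auto).
  assert (H8 : 0 < (P 1 * a) * (P (-1) * (sg * a))) by nra.
  assert (H9 : 0 < (sg * (P (-1) * P 1)) * a ^ 2) by nra.
  nra.
Qed.

(** * Smallness of the third interval *)

Lemma MVT_strict f a b : a < b -> (forall x, ex_derive f x) ->
  exists z, a < z < b /\ f b - f a = Derive f z * (b - a).
Proof.
  intros Hab HD. destruct (MVT_cor2 f (Derive f) a b Hab) as [z [E Hz]].
  - intros x _. apply is_derive_Reals, Derive_correct, HD.
  - now exists z.
Qed.

Lemma is_derive_acos x : -1 < x < 1 -> is_derive acos x (- / sqrt (1 - x ^ 2)).
Proof.
  intros Hx. apply is_derive_Reals.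
  replace (- / sqrt (1 - x ^ 2)) with (derive_pt acos x (derivable_pt_acos x Hx)).
  - destruct (derivable_pt_acos x Hx) as [l Hl]. exact Hl.
  - rewrite derive_pt_acos. unfold Rsqr, Rdiv. replace (x * x) with (x ^ 2) by ring. ring.
Qed.

(* Between consecutive solutions of |P| = 1, acos P varies by at most PI. *)
Lemma sqr_lt_1_derive_bound n P x1 x2 : poly_deg_le n P -> x1 < x2 ->
  (forall x, x1 <= x <= x2 -> P x ^ 2 < 1) ->
  exists z, x1 < z < x2 /\ Derive P z ^ 2 * (x2 - x1) ^ 2 <= PI ^ 2 * (1 - P z ^ 2).
Proof.
  intros HP Hx Hlt.
  destruct (MVT_cor2 (fun x => acos (P x)) (fun x => Derive P x * - / sqrt (1 - P x ^ 2)) x1 x2 Hx)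
    as [z [E Hz]].
  - intros x Hx'. apply is_derive_Reals. apply (is_derive_comp acos P).
    + apply is_derive_acos. specialize (Hlt x Hx'). nra.
    + eapply poly_is_derive; eassumption.
  - exists z. split; auto.
    assert (B1 := acos_bound (P x1)). assert (B2 := acos_bound (P x2)).
    assert (H1 : (acos (P x2) - acos (P x1)) ^ 2 <= PI ^ 2) by nra.
    rewrite E in H1. assert (Hp := Hlt z ltac:(lra)).
    assert (Hs : 0 < sqrt (1 - P z ^ 2)) by (apply sqrt_lt_R0; lra).
    assert (Hs2 : sqrt (1 - P z ^ 2) * sqrt (1 - P z ^ 2) = 1 - P z ^ 2) by (apply sqrt_sqrt; lra).
    set (s := sqrt (1 - P z ^ 2)) in *. rewrite <- Hs2.
    apply Rle_trans with ((Derive P z * - / s * (x2 - x1)) ^ 2 * (s * s)).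
    + right. field. lra.
    + apply Rmult_le_compat_r; nra.
Qed.

(** The square root of the equation in [right_pell], with everything that involves d, g, e collected
    in the weight [w]. [K] is the degree in that equation, which is smaller than n when the leading
    coefficient vanishes. *)
Definition near_pell n alpha beta eps P c : Prop := exists K w, 0 < K <= INR n /\
  forall x, alpha < x < beta -> 1 < P x /\ 1 - eps <= w x <= 1 /\
    Derive P x * sqrt (gapH alpha beta x) = K * w x * (c - x) * sqrt (P x ^ 2 - 1).

Lemma gapH_pos alpha beta x : -1 < alpha -> beta < 1 -> alpha < x < beta -> 0 < gapH alpha beta x.
Proof.
  intros Ha Hb Hx. unfold gapH. replace (1 - x ^ 2) with ((1 - x) * (1 + x)) by ring.
  repeat apply Rmult_lt_0_compat; lra.
Qed.

(** P' keeps one sign on each side of c, by the mean value theorem and the intermediate value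
    theorem. This sign later selects the right square root of the equation for P'^2. *)
Lemma poly_pos_of_ends n P alpha beta c : poly_deg_le n P -> alpha < c < beta ->
  P alpha = 1 -> P beta = 1 -> 1 < P c ->
  (forall x, alpha < x < beta -> x <> c -> Derive P x <> 0) ->
  forall x, alpha < x < beta -> 1 < P x /\ 0 <= Derive P x * (c - x).
Proof.
  intros HP Hc Pa Pb Pc Hnz.
  assert (HD : forall x, ex_derive P x) by (intros; eapply poly_ex_derive; eassumption).
  assert (CD : continuity (Derive P)).
  { intros x. eapply poly_continuity_pt, poly_Derive; eassumption. }
  assert (HL : forall x, alpha < x < c -> 0 < Derive P x).
  { intros x Hx. destruct (MVT_strict P alpha c) as [z [Hz E]]; auto; [lra|].
    apply Rnot_le_lt. intros Hle.
    destruct (IVT_gen (Derive P) x z 0 CD) as [y [Hy Ey]].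
    { assert (0 < Derive P z) by nra. rewrite Rmin_left, Rmax_right; lra. }
    assert (Hy' : alpha < y < c).
    { unfold Rmin, Rmax in Hy. destruct (Rle_dec x z); lra. }
    apply (Hnz y); auto; lra. }
  assert (HR : forall x, c < x < beta -> Derive P x < 0).
  { intros x Hx. destruct (MVT_strict P c beta) as [z [Hz E]]; auto; [lra|].
    apply Rnot_le_lt. intros Hle.
    destruct (IVT_gen (Derive P) z x 0 CD) as [y [Hy Ey]].
    { assert (Derive P z < 0) by nra. rewrite Rmin_left, Rmax_right; lra. }
    assert (Hy' : c < y < beta).
    { unfold Rmin, Rmax in Hy. destruct (Rle_dec z x); lra. }
    apply (Hnz y); auto; lra. }
  intros x Hx. destruct (Rtotal_order x c) as [H|[->|H]].
  - destruct (MVT_strict P alpha x) as [z [Hz E]]; auto; [lra|].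
    assert (H1 := HL z ltac:(lra)). assert (H2 := HL x ltac:(lra)). split; nra.
  - split; auto. right. ring.
  - destruct (MVT_strict P x beta) as [z [Hz E]]; auto; [lra|].
    assert (H1 := HR z ltac:(lra)). assert (H2 := HR x ltac:(lra)). split; nra.
Qed.

Lemma eq_of_sqr_same_sign u v t : 0 <= u * t -> 0 <= v * t -> t <> 0 -> u ^ 2 = v ^ 2 -> u = v.
Proof.
  intros Hu Hv Ht E. assert (H : (u - v) * (u + v) = 0) by lra.
  apply Rmult_integral in H. destruct H as [H|H]; [lra|].
  assert (u = - v) by lra. subst u. assert (v * t = 0) by lra.
  apply Rmult_integral in H0. destruct H0; [lra|tauto].
Qed.

(** At a point z of (g,e) the bound on P' from acos P and the equation for P'^2 combine: 1 - P^2
    cancels, and n (z - d) is bounded by a multiple of z. Taking z beyond the middle of (g,e) turns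
    this into a bound on e - d. *)
Lemma right_pell_near alpha beta eps : -1 < alpha -> alpha < beta -> beta < 1 -> 0 < eps ->
  exists N, forall n P c, (N <= n)%nat -> alpha < c < beta -> poly_deg_le n P ->
    P alpha = 1 -> P beta = 1 -> 1 < P c -> right_pell n alpha beta P c ->
    near_pell n alpha beta eps P c.
Proof.
  intros Ha Hab Hb Heps.
  (* A bounds (z - alpha) / (z - beta) for z >= 1, and B bounds d / (d - beta) for d >= 1. C comes
     from the square root of 64 A, which is at most 8 A since A > 1. *)
  set (A := (1 - alpha) / (1 - beta)). set (C := 8 * A). set (B := 1 + / (1 - beta)).
  assert (HA : 1 < A).
  { unfold A. apply Rmult_lt_reg_r with (1 - beta); [lra|]. field_simplify; lra. }
  assert (Hib : 0 < / (1 - beta)) by (apply Rinv_0_lt_compat; lra).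
  destruct (nfloor_ex (2 * C + 4 * C * B / eps)) as [N0 HN0].
  { assert (0 < 4 * C * B / eps); [|unfold C in *; lra].
    apply Rdiv_lt_0_compat; auto. unfold C, B. repeat apply Rmult_lt_0_compat; lra. }
  exists (S N0). intros n P c Hn Hc HP Pa Pb Pc [d [g [e [Hd [Hdg [Hge [HE [Hnz Hde]]]]]]]].
  apply le_INR in Hn. rewrite S_INR in Hn.
  assert (HCB : 0 < 4 * C * B / eps).
  { apply Rdiv_lt_0_compat; auto. unfold C, B. repeat apply Rmult_lt_0_compat; lra. }
  assert (Hn1 : 2 * C < INR n) by lra. assert (Hn2 : 4 * C * B / eps < INR n) by (unfold C in *; lra).
  assert (Hn0 : 0 < INR n) by (unfold C in *; lra).
  assert (Hshort : INR n * (e - d) <= 4 * C * d).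
  { destruct Hde as [->|[Hge' Hlt]]; [unfold C; nra|].
    (* The subinterval begins at the middle, so that e - d <= 2 (z - d), and ends before e, so that
       P^2 < 1 on its closure. *)
    destruct (sqr_lt_1_derive_bound n P ((g + e) / 2) ((g + 3 * e) / 4)) as [z [Hz Hbd]]; auto; try lra.
    { intros x Hx. apply Hlt. lra. }
    specialize (HE z). assert (Hpz := Hlt z ltac:(lra)).
    assert (Hgap : gapH alpha beta z = - ((z ^ 2 - 1) * ((z - alpha) * (z - beta))) * - 1).
    { unfold gapH. ring. }
    assert (Hhpos : 0 < gapH alpha beta z).
    { rewrite Hgap. replace (z ^ 2 - 1) with ((z - 1) * (z + 1)) by ring.
      assert (0 < (z - 1) * (z + 1) * ((z - alpha) * (z - beta))) by (repeat apply Rmult_lt_0_compat; lra).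
      lra. }
    (* The length (e - g) / 4 and PI^2 <= 16 give 256; the bound (e - g)^2 / 4 on (z - g) (e - z)
       reduces it to 64. *)
    assert (H1 : INR n ^ 2 * (c - z) ^ 2 * (d - z) ^ 2 <= 64 * gapH alpha beta z).
    { assert (HPI : PI ^ 2 <= 16) by (assert (H := PI_4); assert (H' := PI_RGT_0); nra).
      set (D2 := Derive P z ^ 2) in *. set (h := gapH alpha beta z) in *. set (u := 1 - P z ^ 2) in *.
      assert (Hu : 0 < u) by (unfold u; lra).
      assert (HD2 : 0 <= D2) by apply pow2_ge_0.
      assert (HE' : D2 * h * ((z - g) * (e - z)) = INR n ^ 2 * (c - z) ^ 2 * (d - z) ^ 2 * u).
      { unfold u. lra. }
      set (W := INR n ^ 2 * (c - z) ^ 2 * (d - z) ^ 2) in *.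
      assert (Hq : (z - g) * (e - z) <= (e - g) ^ 2 / 4).
      { assert (H := pow2_ge_0 ((z - g) - (e - z))). lra. }
      assert (H2 : D2 * (e - g) ^ 2 <= 256 * u).
      { replace ((g + 3 * e) / 4 - (g + e) / 2) with ((e - g) / 4) in Hbd by field.
        assert (PI ^ 2 * u <= 16 * u) by (apply Rmult_le_compat_r; lra). lra. }
      apply Rmult_le_reg_r with u; auto. rewrite <- HE'.
      apply Rle_trans with (D2 * h * ((e - g) ^ 2 / 4)).
      - apply Rmult_le_compat_l; auto. apply Rmult_le_pos; lra.
      - assert (h * (D2 * (e - g) ^ 2) <= h * (256 * u)) by (apply Rmult_le_compat_l; lra). lra. }
    assert (H2 : INR n * (z - d) <= C * z).
    { apply Rsqr_incr_0; [|nra|unfold C; nra].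
      assert (Hzb : 0 < z - beta) by lra.
      assert (H3 : gapH alpha beta z <= (A * (z - beta) ^ 2) * z ^ 2).
      { assert (H4 : z - alpha <= A * (z - beta)).
        { assert (E : A * (1 - beta) = 1 - alpha) by (unfold A; field; lra). nra. }
        rewrite Hgap.
        assert (H5 : (z - alpha) * (z - beta) <= A * (z - beta) ^ 2) by nra.
        assert (H6 : (z ^ 2 - 1) * ((z - alpha) * (z - beta)) <= z ^ 2 * (A * (z - beta) ^ 2)).
        { apply Rmult_le_compat; nra. }
        lra. }
      assert (H4 : (z - beta) ^ 2 <= (c - z) ^ 2) by nra.
      assert (H5 : INR n ^ 2 * (d - z) ^ 2 * (z - beta) ^ 2 <= 64 * A * z ^ 2 * (z - beta) ^ 2).
      { apply Rle_trans with (INR n ^ 2 * (c - z) ^ 2 * (d - z) ^ 2); [|lra].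
        assert (0 <= INR n ^ 2 * (d - z) ^ 2) by (apply Rmult_le_pos; apply pow2_ge_0). nra. }
      apply Rmult_le_reg_r in H5; [|apply pow_lt; auto].
      unfold Rsqr, C. assert (A * z ^ 2 <= A * A * z ^ 2) by (apply Rmult_le_compat_r; nra). nra. }
    (* Since n > 2 C, the bound n (z - d) <= C z keeps z within 2 d, so that z can be replaced by d
       in the estimate. *)
    assert (H3 : z <= 2 * d).
    { assert (2 * C * (z - d) <= INR n * (z - d)) by (apply Rmult_le_compat_r; lra).
      assert (0 < C) by (unfold C; lra). nra. }
    assert (H4 : INR n * (z - d) <= C * (2 * d)).
    { assert (0 < C) by (unfold C; lra). nra. }
    assert (H5 : INR n * (e - d) <= INR n * (2 * (z - d))) by (apply Rmult_le_compat_l; lra).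
    lra. }
  assert (Hpos := poly_pos_of_ends n P alpha beta c HP Hc Pa Pb Pc Hnz).
  (* As d <= g <= e, the square root lies between d - x and e - x, so the weight lies between (d -
     x) / (e - x) and 1. *)
  exists (INR n), (fun x => (d - x) / sqrt ((g - x) * (e - x))). split; [lra|].
  intros x Hx. destruct (Hpos x Hx) as [P1 Psgn]. split; auto.
  assert (Hgx : 0 < g - x) by lra. assert (Hex : 0 < e - x) by lra.
  assert (Hq : 0 < (g - x) * (e - x)) by now apply Rmult_lt_0_compat.
  set (q := sqrt ((g - x) * (e - x))).
  assert (Hq0 : 0 < q) by now apply sqrt_lt_R0.
  assert (Hqq : q ^ 2 = (g - x) * (e - x)) by (unfold q; rewrite pow2_sqrt; lra).
  assert (Hq1 : d - x <= q).
  { apply Rsqr_incr_0; try lra. rewrite !Rsqr_pow2, Hqq. nra. }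
  assert (Hq2 : q <= e - x).
  { apply Rsqr_incr_0; try lra. rewrite !Rsqr_pow2, Hqq. nra. }
  assert (Hdx : 0 < d - x) by lra.
  split; [split|].
  - apply Rle_trans with ((d - x) / (e - x)).
    + apply Rmult_le_reg_r with (e - x); auto. field_simplify; [|lra].
      assert (HB : d <= B * (d - beta)).
      { unfold B. assert (E : / (1 - beta) * (1 - beta) = 1) by (field; lra).
        assert (/ (1 - beta) * (1 - beta) <= / (1 - beta) * (d - beta)) by (apply Rmult_le_compat_l; lra).
        destruct (Rle_or_lt beta 0); [nra|].
        assert (beta * (/ (1 - beta) * (d - beta)) >= beta) by nra.
        assert (d - beta >= 0) by lra.
        enough (beta <= / (1 - beta) * (d - beta)) by lra. nra. }
      assert (H1 : 4 * C * B <= INR n * eps).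
      { apply Rmult_le_reg_r with (/ eps); [now apply Rinv_0_lt_compat|].
        replace (INR n * eps * / eps) with (INR n) by (field; lra). unfold Rdiv in Hn2. lra. }
      assert (H2 : INR n * (e - d) <= INR n * (eps * (d - beta))).
      { assert (HC : 0 < 4 * C) by (unfold C; lra).
        assert (4 * C * d <= 4 * C * (B * (d - beta))) by (apply Rmult_le_compat_l; lra).
        assert (4 * C * B * (d - beta) <= INR n * eps * (d - beta)) by (apply Rmult_le_compat_r; lra).
        lra. }
      apply Rmult_le_reg_l in H2; auto. nra.
    + apply Rmult_le_compat_l; [lra|]. apply Rinv_le_contravar; auto.
  - apply Rmult_le_reg_r with q; auto. field_simplify; lra.
  (* Elsewhere the square roots are compared by the sign of c - x, which gives no information at
     c. *)
  - destruct (Req_EM_T x c) as [->|Nc].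
    { assert (Dc0 : Derive P c = 0).
      { specialize (HE c). assert (Hh := gapH_pos alpha beta c Ha Hb Hc).
        assert (E0 : Derive P c ^ 2 * (gapH alpha beta c * ((g - c) * (e - c))) = 0) by nra.
        apply Rmult_integral in E0. destruct E0 as [E0|E0]; [nra|].
        exfalso. assert (0 < gapH alpha beta c * ((g - c) * (e - c))) by now apply Rmult_lt_0_compat.
        lra. }
      rewrite Dc0. ring. }
    assert (Hh := gapH_pos alpha beta x Ha Hb Hx).
    assert (Hw : 0 < (d - x) / q) by now apply Rdiv_lt_0_compat.
    assert (Hsp := sqrt_pos (P x ^ 2 - 1)). assert (Hsh := sqrt_pos (gapH alpha beta x)).
    apply eq_of_sqr_same_sign with (c - x); [nra| |lra|].
    + replace (INR n * ((d - x) / q) * (c - x) * sqrt (P x ^ 2 - 1) * (c - x))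
        with (INR n * ((d - x) / q) * ((c - x) ^ 2 * sqrt (P x ^ 2 - 1))) by ring.
      apply Rmult_le_pos; [|apply Rmult_le_pos; [apply pow2_ge_0|auto]].
      apply Rmult_le_pos; lra.
    + rewrite !Rpow_mult_distr, !pow2_sqrt by nra.
      apply Rmult_eq_reg_r with ((g - x) * (e - x)); [|lra].
      rewrite (HE x). unfold Rdiv. rewrite Rpow_mult_distr, pow_inv, Hqq. field. lra.
Qed.

Definition reflect (P : R -> R) (x : R) : R := P (- x).

Lemma Derive_reflect n P x : poly_deg_le n P -> Derive (reflect P) x = - Derive P (- x).
Proof.
  intros HP. apply is_derive_unique. replace (- Derive P (- x)) with (scal (-1) (Derive P (- x))).
  - apply (is_derive_comp P Ropp); [eapply poly_is_derive; eassumption|].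
    auto_derive; auto.
  - change (-1 * Derive P (- x) = - Derive P (- x)). ring.
Qed.

Lemma near_pell_reflect n alpha beta eps P c : poly_deg_le n P ->
  near_pell n (- beta) (- alpha) eps (reflect P) (- c) -> near_pell n alpha beta eps P c.
Proof.
  intros HP [K [w [HK H]]]. exists K, (fun x => w (- x)). split; auto.
  intros x Hx. destruct (H (- x) ltac:(lra)) as [H1 [H2 H3]].
  rewrite (Derive_reflect n) in H3 by auto. unfold reflect in *. rewrite Ropp_involutive in *.
  split; [auto|split; [auto|]].
  replace (gapH (- beta) (- alpha) (- x)) with (gapH alpha beta x) in H3 by (unfold gapH; ring).
  lra.
Qed.

Lemma inner_points_reflect n alpha beta P I : poly_deg_le n P -> inner_points alpha beta P I ->
  inner_points (- beta) (- alpha) (reflect P) (map Ropp I).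
Proof.
  intros HP [ND H]. split.
  - apply Injective_map_NoDup; auto. intros x y E. lra.
  - intros z Hz. apply in_map_iff in Hz. destruct Hz as [y [<- Hy]]. destruct (H y Hy) as [H1 [H2 H3]].
    rewrite (Derive_reflect n) by auto. unfold reflect. rewrite Ropp_involutive.
    split; [lra|split; [auto|lra]].
Qed.

Lemma extremal_near_pell alpha beta eps : -1 < alpha -> alpha < beta -> beta < 1 -> 0 < eps ->
  exists N, forall n P c, (N <= n)%nat -> extremal n alpha beta P c ->
    P alpha = 1 /\ P beta = 1 /\ near_pell n alpha beta eps P c.
Proof.
  intros Ha Hab Hb Heps.
  destruct (right_pell_near alpha beta eps) as [N1 HN1]; auto.
  destruct (right_pell_near (- beta) (- alpha) eps) as [N2 HN2]; auto; try lra.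
  exists (N1 + N2 + 4)%nat. intros n P c Hn Hext.
  destruct (extremal_structure n alpha beta P c) as [I [ND [HI [Pa [Pb Hcase]]]]]; auto; [lia|].
  assert (Dc := extremal_Derive _ _ _ _ _ Hext).
  destruct Hext as [[HP HB] [Hc [HM _]]].
  split; [auto|split; [auto|]].
  assert (HIp : inner_points alpha beta P I) by (split; auto).
  assert (HIr := inner_points_reflect n _ _ _ _ HP HIp).
  assert (HB2 : forall x, -1 <= x <= alpha \/ beta <= x <= 1 -> P x ^ 2 <= 1).
  { intros x Hx. assert (H := HB x Hx). apply Rabs_le_between in H. nra. }
  assert (HPr : poly_deg_le n (reflect P)) by now apply poly_opp_arg.
  assert (Hreff : forall x, reflect P (- x) = P x).
  { intros x. unfold reflect. now rewrite Ropp_involutive. }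
  assert (Hr1 : reflect P (-1) = P 1) by (unfold reflect; f_equal; ring).
  assert (Hr2 : reflect P 1 = P (-1)) by (unfold reflect; f_equal; ring).
  assert (Drc : Derive (reflect P) (- c) = 0).
  { rewrite (Derive_reflect n) by auto. rewrite Ropp_involutive. lra. }
  assert (HIl : length (map Ropp I) = length I) by apply length_map.
  (* The degree m is n or n - 1. When the coefficient of x^n vanishes, the count with n - 3 interior
     points is this case for m = n - 1. *)
  assert (Enl : forall m, poly_deg_le m P -> (N1 + N2 + 1 <= m <= n)%nat -> (length I + 2 = m)%nat ->
    P (-1) ^ 2 = 1 \/ P 1 ^ 2 = 1 -> near_pell n alpha beta eps P c).
  { intros m HPm Hmn Hl Hor.
    assert (Hup : near_pell m alpha beta eps P c).
    { destruct Hor as [Hm|Hm].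
      - apply HN1; auto; [lia|]. apply (right_pell_enlarged m alpha beta P c I); auto; try lia.
        apply HB2. lra.
      - apply (near_pell_reflect m); auto.
        apply HN2; auto; try lia; try lra; rewrite ?Hreff; auto.
        + now apply poly_opp_arg.
        + apply (right_pell_enlarged m _ _ _ _ (map Ropp I)); rewrite ?Hreff, ?Hr1, ?Hr2; auto; try lia; try lra.
          * now apply poly_opp_arg.
          * apply HB2. lra. }
    destruct Hup as [K [w [HK H]]]. exists K, w. split; auto.
    destruct Hmn as [_ Hmn]. apply le_INR in Hmn. lra. }
  destruct Hcase as [[Hl Hor]|[Hl [Pm [Pp Hsgn]]]].
  - apply (Enl n); auto. lia.
  - destruct n as [|n']; [lia|]. destruct (poly_lead n' P HP) as [a [L1 [L2 [_ L4]]]].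
    destruct (Req_EM_T a 0) as [Ea|Na].
    { apply (Enl n'); auto; lia. }
    (* The third interval lies to the right of 1 or to the left of -1; the second possibility
       becomes the first under x -> - x. *)
    destruct (outside_small n' alpha beta P a) as [x0 [Hx0 Px0]]; auto.
    destruct Hx0 as [Hx0|Hx0].
    + apply HN1; auto; [lia|].
      apply (right_pell_detached (S n') alpha beta P c I) with a x0; auto; try lia.
    + apply (near_pell_reflect (S n')); auto.
      apply HN2; auto; try lia; try lra; rewrite ?Hreff; auto.
      apply (right_pell_detached (S n') _ _ _ _ (map Ropp I)) with ((-1) ^ S n' * a) (- x0);
        rewrite ?Hreff, ?Hr1, ?Hr2; auto; try lia; try lra.
      * intros x Hx. unfold reflect. apply HB2. lra.
      * apply Rmult_integral_contrapositive_currified; auto. apply pow_nonzero. lra.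
Qed.

(** * Elliptic integrals *)

Lemma cos_sqr x : cos x ^ 2 = 1 - sin x ^ 2.
Proof. assert (H := sin2_cos2 x). unfold Rsqr in H. lra. Qed.

(** Legendre's Delta, that is [dn] as a function of the amplitude. In amplitudes the elliptic
    integrals have elementary integrands; [am] is needed only as the continuous inverse of
    [ellint_F]. *)
Definition jdelta (k t : R) : R := sqrt (1 - k ^ 2 * sin t ^ 2).

Section Elliptic.

Variable k : R.
Hypothesis Hk : 0 < k < 1.

Lemma jdelta_arg_pos t : 0 < 1 - k ^ 2 * sin t ^ 2.
Proof.
  assert (H := cos_sqr t). assert (0 <= cos t ^ 2) by apply pow2_ge_0.
  assert (0 <= sin t ^ 2) by apply pow2_ge_0.
  assert (k ^ 2 < 1) by nra. assert (0 <= k ^ 2) by apply pow2_ge_0. nra.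
Qed.

Lemma jdelta_pos t : 0 < jdelta k t.
Proof. apply sqrt_lt_R0, jdelta_arg_pos. Qed.

Lemma jdelta_sqr t : jdelta k t ^ 2 = 1 - k ^ 2 * sin t ^ 2.
Proof. apply pow2_sqrt. left. apply jdelta_arg_pos. Qed.

Lemma jdelta_le_1 t : jdelta k t <= 1.
Proof.
  rewrite <- sqrt_1. apply sqrt_le_1_alt.
  assert (0 <= sin t ^ 2) by apply pow2_ge_0. assert (0 <= k ^ 2) by apply pow2_ge_0. nra.
Qed.

Lemma is_derive_jdelta t : is_derive (jdelta k) t (- k ^ 2 * (sin t * cos t) / jdelta k t).
Proof.
  assert (H := jdelta_arg_pos t). assert (H' := jdelta_pos t). unfold jdelta in *.
  auto_derive; [|].
  - simpl in *. lra.
  - replace (1 + - (k * (k * 1) * (sin t * (sin t * 1)))) with (1 - k ^ 2 * sin t ^ 2) by ring.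
    field. lra.
Qed.

Lemma continuous_jdelta t : continuous (jdelta k) t.
Proof. apply (ex_derive_continuous (jdelta k) t). eexists. apply is_derive_jdelta. Qed.

Lemma continuous_inv_jdelta t : continuous (fun t => / jdelta k t) t.
Proof.
  apply continuous_comp; [apply continuous_jdelta|]. apply continuous_Rinv.
  assert (H := jdelta_pos t). lra.
Qed.

Lemma is_derive_RInt_0r (f : R -> R) x : (forall t, continuous f t) ->
  is_derive (fun x => RInt f 0 x) x (f x).
Proof.
  intros Cf. apply (is_derive_RInt f (fun x => RInt f 0 x) 0 x); auto.
  apply filter_forall. intros y. apply (RInt_correct (V := R_CompleteNormedModule)), (ex_RInt_continuous (V := R_CompleteNormedModule)). auto.
Qed.

Lemma is_derive_ellint_F x : is_derive (fun x => ellint_F x k) x (/ jdelta k x).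
Proof. apply (is_derive_RInt_0r (fun t => / jdelta k t)), continuous_inv_jdelta. Qed.

Lemma ellint_F_0 : ellint_F 0 k = 0.
Proof. unfold ellint_F. apply (RInt_point 0 (fun theta => / sqrt (1 - k ^ 2 * sin theta ^ 2))). Qed.

(** The integrand is at least 1. This one inequality yields injectivity, surjectivity, and that [am]
    is Lipschitz with constant 1. *)
Lemma ellint_F_expands x y : x <= y -> y - x <= ellint_F y k - ellint_F x k.
Proof.
  intros Hxy. destruct (MVT_gen (fun x => ellint_F x k) x y (fun x => / jdelta k x)) as [z [_ E]].
  - intros; apply is_derive_ellint_F.
  - intros; apply ex_derive_continuity_pt. eexists. apply is_derive_ellint_F.
  - simpl in E. rewrite E. assert (H := jdelta_pos z). assert (H' := jdelta_le_1 z).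
    assert (1 <= / jdelta k z) by (rewrite <- Rinv_1; now apply Rinv_le_contravar).
    nra.
Qed.

Lemma ellint_F_inj x y : ellint_F x k = ellint_F y k -> x = y.
Proof.
  intros E. destruct (Rle_or_lt x y) as [H|H].
  - assert (H' := ellint_F_expands x y H). lra.
  - assert (H' := ellint_F_expands y x). lra.
Qed.

Lemma ellint_F_surj u : exists x, ellint_F x k = u.
Proof.
  destruct (IVT_gen (fun x => ellint_F x k) (- Rabs u) (Rabs u) u) as [x [_ E]].
  - intros x. apply ex_derive_continuity_pt. eexists. apply is_derive_ellint_F.
  - assert (H := Rabs_pos u).
    assert (H1 := ellint_F_expands 0 (Rabs u) H). assert (H2 := ellint_F_expands (- Rabs u) 0).
    rewrite ellint_F_0 in *. assert (H3 := Rle_abs u). assert (H4 := Rle_abs (- u)).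
    rewrite Rabs_Ropp in H4. rewrite Rmin_left, Rmax_right; lra.
  - now exists x.
Qed.

Lemma am_ellint_F x : am (ellint_F x k) k = x.
Proof.
  unfold am. apply (iota_unique (V := R_CompleteNormedModule)); auto.
  intros y E. now apply ellint_F_inj.
Qed.

Lemma ellint_F_am u : ellint_F (am u k) k = u.
Proof. destruct (ellint_F_surj u) as [x <-]. now rewrite am_ellint_F. Qed.

Lemma continuous_am u : continuous (fun u => am u k) u.
Proof.
  apply continuity_pt_filterlim. intros eps Heps. exists eps. split; auto.
  intros v [_ Hv]. simpl in *. unfold R_dist in *. eapply Rle_lt_trans; [|exact Hv].
  rewrite <- (ellint_F_am v) at 2. rewrite <- (ellint_F_am u) at 2.
  destruct (Rle_or_lt (am u k) (am v k)) as [H|H].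
  - assert (H' := ellint_F_expands _ _ H). rewrite !Rabs_right; lra.
  - assert (H' := ellint_F_expands (am v k) (am u k) ltac:(lra)). rewrite !Rabs_left1; lra.
Qed.

Definition ellint_E phi := RInt (jdelta k) 0 phi.

Lemma is_derive_ellint_E x : is_derive ellint_E x (jdelta k x).
Proof. apply is_derive_RInt_0r, continuous_jdelta. Qed.

Lemma dn_ellint_F x : dn (ellint_F x k) k = jdelta k x.
Proof. unfold dn, sn. now rewrite am_ellint_F. Qed.

Lemma continuous_dn u : continuous (fun u => dn u k ^ 2) u.
Proof.
  apply continuous_ext with (fun u => jdelta k (am u k) * jdelta k (am u k)).
  { intros v. unfold dn, sn, jdelta. simpl. ring. }
  assert (C : continuous (fun u => jdelta k (am u k)) u).
  { apply (continuous_comp (fun u => am u k) (jdelta k)); [apply continuous_am|apply continuous_jdelta]. }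
  now apply (continuous_mult (fun u => jdelta k (am u k))).
Qed.

(** The substitution u = F(phi) turns dn^2 du into Delta dphi, so the zeta function is expressed by
    incomplete integrals in the amplitude. *)
Lemma zn_ellint_F phi : zn (ellint_F phi k) k = ellint_E phi - ellE k / ellK k * ellint_F phi k.
Proof.
  unfold zn. f_equal. unfold ellint_E.
  rewrite <- ellint_F_0 at 1.
  rewrite <- (RInt_comp (fun t => dn t k ^ 2) (fun x => ellint_F x k) (fun x => / jdelta k x)).
  - apply RInt_ext. intros x _. rewrite dn_ellint_F. change scal with Rmult.
    change (/ jdelta k x * jdelta k x ^ 2 = jdelta k x). field. assert (H := jdelta_pos x). lra.
  - intros; apply continuous_dn.
  - intros; split; [apply is_derive_ellint_F|apply continuous_inv_jdelta].
Qed.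

(** * The complete elliptic integral of the third kind *)

Lemma third_kind_denom_pos u t : 0 < 1 - k ^ 2 * sin u ^ 2 * sin t ^ 2.
Proof.
  assert (H := jdelta_arg_pos u). assert (H2 := cos_sqr t).
  assert (0 <= cos t ^ 2) by apply pow2_ge_0. assert (0 <= sin t ^ 2) by apply pow2_ge_0.
  assert (0 <= k ^ 2 * sin u ^ 2) by (apply Rmult_le_pos; apply pow2_ge_0). nra.
Qed.

(* Jacobi's integrand of the third kind, in the amplitudes u (parameter) and t. *)
Definition third_kind u t :=
  k ^ 2 * (sin u * cos u) * jdelta k u * sin t ^ 2 / ((1 - k ^ 2 * sin u ^ 2 * sin t ^ 2) * jdelta k t).

(** For X = sin^2 u and Y = sin^2 t, the bracket multiplying 1 - k^2 X Y is Delta(u) times the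
    derivative of sin u cos u Delta(u); the last summand comes from differentiating the
    denominator. *)
Definition third_kind_num X Y :=
  ((1 - 2 * X) * (1 - k ^ 2 * X) - k ^ 2 * X * (1 - X)) * (1 - k ^ 2 * X * Y)
  + 2 * k ^ 2 * X * Y * (1 - X) * (1 - k ^ 2 * X).

Definition third_kind_du u t :=
  k ^ 2 * sin t ^ 2 * third_kind_num (sin u ^ 2) (sin t ^ 2) *
  / ((1 - k ^ 2 * sin u ^ 2 * sin t ^ 2) ^ 2 * jdelta k t * jdelta k u).

Lemma is_derive_third_kind u t : is_derive (fun u => third_kind u t) u (third_kind_du u t).
Proof.
  assert (HB := third_kind_denom_pos u t). assert (Hu := jdelta_pos u). assert (Ht := jdelta_pos t).
  assert (Su := jdelta_sqr u). assert (Cu := cos_sqr u).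
  assert (HD := is_derive_jdelta u).
  unfold third_kind. auto_derive.
  - repeat split; auto.
    + eexists; exact HD.
    + apply Rmult_integral_contrapositive_currified; [|lra]. simpl in *. lra.
  - replace (Derive (fun x => jdelta k x) u) with (- k ^ 2 * (sin u * cos u) / jdelta k u)
      by (symmetry; apply is_derive_unique; exact HD).
    unfold third_kind_du, third_kind_num.
    set (s := sin u) in *. set (c := cos u) in *. set (y := sin t) in *.
    set (D := jdelta k u) in *. set (d := jdelta k t) in *. clearbody s c y D d.
    replace (k * (k * 1) * (s * (s * 1)) * (y * (y * 1))) with (k ^ 2 * s ^ 2 * y ^ 2) by ring.
    assert (HB' : 1 - k ^ 2 * s ^ 2 * y ^ 2 <> 0) by lra.
    replace (1 + - (k ^ 2 * s ^ 2 * y ^ 2)) with (1 - k ^ 2 * s ^ 2 * y ^ 2) by ring.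
    remember (1 - k ^ 2 * s ^ 2 * y ^ 2) as b eqn:Eb.
    field_simplify_eq; [|lra].
    clear - Su Cu Eb.
    replace (c ^ 2) with (1 - s ^ 2) by lra.
    replace (D ^ 2) with (1 - k ^ 2 * s ^ 2) by lra. rewrite Eb. ring.
Qed.

Lemma third_kind_du_continuity u t : continuity_2d_pt third_kind_du u t.
Proof.
  assert (HB := third_kind_denom_pos u t). assert (Hu := jdelta_pos u). assert (Ht := jdelta_pos t).
  assert (Cs : forall x, continuity_pt (fun x => sin x ^ 2) x).
  { intros x. apply ex_derive_continuity_pt. auto_derive; auto. }
  assert (CD : forall x, continuity_pt (jdelta k) x).
  { intros x. apply ex_derive_continuity_pt. eexists. apply is_derive_jdelta. }
  assert (X1 : forall f, (forall x, continuity_pt f x) -> continuity_2d_pt (fun u _ => f u) u t).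
  { intros f Hf. apply (continuity_1d_2d_pt_comp f (fun u _ => u)); auto. apply continuity_2d_pt_id1. }
  assert (X2 : forall f, (forall x, continuity_pt f x) -> continuity_2d_pt (fun _ t => f t) u t).
  { intros f Hf. apply (continuity_1d_2d_pt_comp f (fun _ t => t)); auto. apply continuity_2d_pt_id2. }
  assert (Cc := continuity_2d_pt_const u t).
  assert (CB : continuity_2d_pt (fun u t => 1 - k ^ 2 * sin u ^ 2 * sin t ^ 2) u t).
  { apply continuity_2d_pt_minus; auto.
    apply (continuity_2d_pt_mult (fun u t => k ^ 2 * sin u ^ 2) (fun _ t => sin t ^ 2)); auto.
    apply (continuity_2d_pt_mult (fun _ _ => k ^ 2) (fun u _ => sin u ^ 2)); auto. }
  assert (CN : continuity_2d_pt (fun u t => third_kind_num (sin u ^ 2) (sin t ^ 2)) u t).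
  { unfold third_kind_num. apply continuity_2d_pt_plus.
    - apply (continuity_2d_pt_mult (fun u t => (1 - 2 * sin u ^ 2) * (1 - k ^ 2 * sin u ^ 2)
        - k ^ 2 * sin u ^ 2 * (1 - sin u ^ 2)) (fun u t => 1 - k ^ 2 * sin u ^ 2 * sin t ^ 2)); auto.
      apply (X1 (fun u => (1 - 2 * sin u ^ 2) * (1 - k ^ 2 * sin u ^ 2)
        - k ^ 2 * sin u ^ 2 * (1 - sin u ^ 2))).
      intros x. apply ex_derive_continuity_pt. auto_derive; auto.
    - apply (continuity_2d_pt_ext (fun u t => (2 * k ^ 2 * sin u ^ 2 * (1 - sin u ^ 2)
        * (1 - k ^ 2 * sin u ^ 2)) * sin t ^ 2)); [intros; ring|].
      apply (continuity_2d_pt_mult (fun u t => 2 * k ^ 2 * sin u ^ 2 * (1 - sin u ^ 2)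
        * (1 - k ^ 2 * sin u ^ 2)) (fun _ t => sin t ^ 2)); auto.
      apply (X1 (fun u => 2 * k ^ 2 * sin u ^ 2 * (1 - sin u ^ 2) * (1 - k ^ 2 * sin u ^ 2))).
      intros x. apply ex_derive_continuity_pt. auto_derive; auto. }
  unfold third_kind_du. apply continuity_2d_pt_mult.
  - apply (continuity_2d_pt_mult (fun _ t => k ^ 2 * sin t ^ 2)); auto.
    apply (X2 (fun t => k ^ 2 * sin t ^ 2)).
    intros x. apply ex_derive_continuity_pt. auto_derive; auto.
  - apply continuity_2d_pt_inv.
    + apply (continuity_2d_pt_mult (fun u t => (1 - k ^ 2 * sin u ^ 2 * sin t ^ 2) ^ 2 * jdelta k t)
        (fun u _ => jdelta k u)); auto.
      apply (continuity_2d_pt_mult (fun u t => (1 - k ^ 2 * sin u ^ 2 * sin t ^ 2) ^ 2)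
        (fun _ t => jdelta k t)); auto.
      apply (continuity_1d_2d_pt_comp (fun b => b ^ 2)); auto.
      apply ex_derive_continuity_pt. auto_derive; auto.
    + repeat apply Rmult_integral_contrapositive_currified; lra.
Qed.

Lemma third_kind_continuous u t : continuous (third_kind u) t.
Proof.
  assert (HB := third_kind_denom_pos u t). assert (Ht := jdelta_pos t).
  apply (ex_derive_continuous (third_kind u) t). unfold third_kind. auto_derive.
  repeat split; auto.
  - eexists. apply is_derive_jdelta.
  - apply Rmult_integral_contrapositive_currified; [|lra]. simpl in *. lra.
Qed.

(** [third_kind] with argument and parameter exchanged, times Delta(u). The factor sin t cos t makes
    it vanish at 0 and PI / 2, so its t-derivative integrates to 0. *)
Definition third_kind_transpose u t :=
  k ^ 2 * (sin t * cos t) * jdelta k t * sin u ^ 2 / (1 - k ^ 2 * sin u ^ 2 * sin t ^ 2).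

Definition third_kind_transpose_dt u t :=
  k ^ 2 * sin u ^ 2 * third_kind_num (sin t ^ 2) (sin u ^ 2) *
  / ((1 - k ^ 2 * sin u ^ 2 * sin t ^ 2) ^ 2 * jdelta k t).

Lemma is_derive_third_kind_transpose u t :
  is_derive (third_kind_transpose u) t (third_kind_transpose_dt u t).
Proof.
  assert (HD := jdelta_pos t).
  assert (E : forall x, third_kind x u * jdelta k u = third_kind_transpose u x).
  { intros x. unfold third_kind, third_kind_transpose.
    assert (H := jdelta_pos u). assert (HB := third_kind_denom_pos u x). field. lra. }
  apply (is_derive_ext _ _ _ _ E).
  replace (third_kind_transpose_dt u t) with (third_kind_du t u * jdelta k u).
  - apply @is_derive_scal_l. apply is_derive_third_kind.
  - unfold third_kind_transpose_dt, third_kind_du.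
    assert (H := jdelta_pos u). assert (HB := third_kind_denom_pos u t). field. lra.
Qed.

(** The interchange of argument and parameter in differential form. Up to an exact t-derivative,
    only the integrands of the first and the second kind remain, which integrate to K and E. *)
Lemma third_kind_interchange u t :
  jdelta k u * third_kind_du u t =
  jdelta k u ^ 2 * / jdelta k t - jdelta k t + third_kind_transpose_dt u t.
Proof.
  assert (HB := third_kind_denom_pos u t). assert (Hu := jdelta_pos u). assert (Ht := jdelta_pos t).
  unfold third_kind_du, third_kind_transpose_dt, third_kind_num.
  assert (Su := jdelta_sqr u). assert (St := jdelta_sqr t).
  remember (1 - k ^ 2 * sin u ^ 2 * sin t ^ 2) as b eqn:Eb.
  field_simplify_eq; [|lra].
  replace (jdelta k u ^ 2) with (1 - k ^ 2 * sin u ^ 2) by lra.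
  replace (jdelta k t ^ 2) with (1 - k ^ 2 * sin t ^ 2) by lra. rewrite Eb. ring.
Qed.

Definition third_kind_complete u := RInt (third_kind u) 0 (PI / 2).

Lemma is_derive_third_kind_complete u : is_derive third_kind_complete u
  ((jdelta k u ^ 2 * ellK k - ellE k) / jdelta k u).
Proof.
  assert (Hu := jdelta_pos u).
  assert (ED : forall u t, Derive (fun z => third_kind z t) u = third_kind_du u t).
  { intros; apply is_derive_unique, is_derive_third_kind. }
  assert (H1 : is_derive third_kind_complete u (RInt (fun t => Derive (fun z => third_kind z t) u) 0 (PI / 2))).
  { apply is_derive_RInt_param.
    - apply filter_forall. intros x t _. eexists. apply is_derive_third_kind.
    - intros t _. apply (continuity_2d_pt_ext third_kind_du); [intros; now rewrite ED|].
      apply third_kind_du_continuity.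
    - apply filter_forall. intros x. apply (ex_RInt_continuous (V := R_CompleteNormedModule)).
      intros; apply third_kind_continuous. }
  enough (E : RInt (fun t => Derive (fun z => third_kind z t) u) 0 (PI / 2) =
     (jdelta k u ^ 2 * ellK k - ellE k) / jdelta k u) by (now rewrite <- E).
  apply (is_RInt_unique (V := R_CompleteNormedModule)).
  assert (EI : forall t, / jdelta k u *
    (jdelta k u ^ 2 * / jdelta k t - jdelta k t + third_kind_transpose_dt u t) =
    Derive (fun z => third_kind z t) u).
  { intros t. rewrite ED, <- third_kind_interchange. field. lra. }
  apply (is_RInt_ext _ _ _ _ _ (fun t _ => EI t)).
  replace ((jdelta k u ^ 2 * ellK k - ellE k) / jdelta k u)
    with (/ jdelta k u * (jdelta k u ^ 2 * ellK k - ellE k + (0 - 0))) by (field; lra).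
  apply (is_RInt_scal (V := R_NormedModule)).
  apply (is_RInt_plus (V := R_NormedModule)).
  - apply (is_RInt_minus (V := R_NormedModule)).
    + apply (is_RInt_scal (V := R_NormedModule)).
      apply (RInt_correct (V := R_CompleteNormedModule) (fun t => / jdelta k t)).
      apply (ex_RInt_continuous (V := R_CompleteNormedModule)). intros; apply continuous_inv_jdelta.
    + apply (RInt_correct (V := R_CompleteNormedModule) (jdelta k)).
      apply (ex_RInt_continuous (V := R_CompleteNormedModule)). intros; apply continuous_jdelta.
  - replace (0 - 0) with (third_kind_transpose u (PI / 2) - third_kind_transpose u 0).
    + apply (is_RInt_derive (V := R_CompleteNormedModule)).
      * intros; apply is_derive_third_kind_transpose.
      (* Continuity of this derivative is read off the interchange identity, from the continuity of
         [third_kind_du] in both variables. *)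
      * intros t _. apply continuous_ext with
          (fun t => (jdelta k u * third_kind_du u t - jdelta k u ^ 2 * / jdelta k t) + jdelta k t).
        { intros x. rewrite third_kind_interchange.
          change (jdelta k u ^ 2 * / jdelta k x - jdelta k x + third_kind_transpose_dt u x
            - jdelta k u ^ 2 * / jdelta k x + jdelta k x = third_kind_transpose_dt u x). ring. }
        apply (continuous_plus (V := R_NormedModule)); [|apply continuous_jdelta].
        apply (continuous_minus (V := R_NormedModule)).
        -- apply (continuous_scal_r (V := R_NormedModule) (jdelta k u) (third_kind_du u)).
           intros P HP. destruct HP as [eps HP].
           destruct (third_kind_du_continuity u t eps) as [del Hd].
           exists del. intros y Hy. apply HP. change (Rabs (third_kind_du u y - third_kind_du u t) < eps).
           apply Hd; [|exact Hy]. rewrite Rminus_diag, Rabs_R0. apply cond_pos.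
        -- apply (continuous_scal_r (V := R_NormedModule) (jdelta k u ^ 2) (fun t => / jdelta k t)).
           apply continuous_inv_jdelta.
    + unfold third_kind_transpose. rewrite cos_PI2, sin_0. unfold Rdiv. ring.
Qed.

(* Jacobi: the complete integral of the third kind is K times the zeta function. *)
Lemma third_kind_complete_zeta phi : 0 < phi ->
  third_kind_complete phi = ellK k * ellint_E phi - ellE k * ellint_F phi k.
Proof.
  intros Hphi.
  set (D := fun u => third_kind_complete u - (ellK k * ellint_E u - ellE k * ellint_F u k)).
  assert (E : D 0 = D phi).
  { apply (eq_is_derive (V := R_NormedModule)); auto. intros t _.
    assert (Ht := jdelta_pos t).
    replace (@zero R_NormedModule) with
      ((jdelta k t ^ 2 * ellK k - ellE k) / jdelta k t - (ellK k * jdelta k t - ellE k * / jdelta k t)).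
    - apply (is_derive_minus third_kind_complete); [apply is_derive_third_kind_complete|].
      apply (is_derive_minus (fun u => ellK k * ellint_E u) (fun u => ellE k * ellint_F u k)).
      + apply (is_derive_scal ellint_E). apply is_derive_ellint_E.
      + apply (is_derive_scal (fun u => ellint_F u k)). apply is_derive_ellint_F.
    - change (@zero R_NormedModule) with 0. field. lra. }
  assert (E0 : D 0 = 0).
  { unfold D. rewrite ellint_F_0. unfold ellint_E, third_kind_complete.
    rewrite (RInt_point 0 (jdelta k) : RInt (jdelta k) 0 0 = 0).
    assert (EZ : forall x, third_kind 0 x = 0).
    { intros x. unfold third_kind. rewrite sin_0. unfold Rdiv. ring. }
    rewrite (RInt_ext (third_kind 0) (fun _ => 0)) by (intros; apply EZ).
    rewrite RInt_const. change scal with Rmult. simpl. ring. }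
  rewrite E0 in E. unfold D in E. lra.
Qed.

End Elliptic.

(** * Uniformization of the gap *)

Lemma sin_sqr_inj x y : 0 < x < PI / 2 -> 0 < y < PI / 2 -> sin x ^ 2 = sin y ^ 2 -> x = y.
Proof.
  intros Hx Hy E. assert (P0 : PI > 0) by apply PI_RGT_0.
  assert (Sx : 0 < sin x) by (apply sin_gt_0; lra). assert (Sy : 0 < sin y) by (apply sin_gt_0; lra).
  assert (E' : sin x = sin y).
  { assert (H : (sin x - sin y) * (sin x + sin y) = 0) by lra.
    apply Rmult_integral in H. destruct H; lra. }
  rewrite <- (asin_sin x), <- (asin_sin y), E' by lra. reflexivity.
Qed.

Lemma sin_sqr_bounds t : 0 <= sin t ^ 2 <= 1.
Proof.
  split; [apply pow2_ge_0|]. assert (H := cos_sqr t). assert (0 <= cos t ^ 2) by apply pow2_ge_0. lra.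
Qed.

Definition arcosh_of (P : R -> R) x := ln (P x + sqrt (P x ^ 2 - 1)).

Lemma arcosh_of_1 P x : P x = 1 -> arcosh_of P x = 0.
Proof.
  intros E. unfold arcosh_of. rewrite E. replace (1 ^ 2 - 1) with 0 by ring.
  rewrite sqrt_0, Rplus_0_r. apply ln_1.
Qed.

Lemma is_derive_arcosh_of P x : ex_derive P x -> 1 < P x ->
  is_derive (arcosh_of P) x (Derive P x / sqrt (P x ^ 2 - 1)).
Proof.
  intros HD HP. assert (Hq : 0 < P x ^ 2 - 1) by nra.
  assert (Hs : 0 < sqrt (P x ^ 2 - 1)) by now apply sqrt_lt_R0.
  unfold arcosh_of. auto_derive.
  - simpl in *. repeat split; auto.
    replace (P x * (P x * 1) + - (1)) with (P x * (P x * 1) - 1) by ring. lra.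
  - replace (P x * (P x * 1) + - (1)) with (P x ^ 2 - 1) by ring.
    change (Derive (fun x => P x) x) with (Derive P x). simpl pow in *. field. lra.
Qed.

(** At the ends of the gap P equals 1, where the derivative formula fails; Rolle needs continuity
    there. *)
Lemma continuity_pt_arcosh_of P x : continuity_pt P x -> 1 <= P x -> continuity_pt (arcosh_of P) x.
Proof.
  intros HC HP.
  apply (continuity_pt_comp (fun x => P x + sqrt (P x ^ 2 - 1)) ln).
  - apply continuity_pt_plus; auto.
    apply (continuity_pt_comp (fun x => P x ^ 2 - 1) sqrt).
    + apply (continuity_pt_comp P (fun y => y ^ 2 - 1)); auto.
      apply ex_derive_continuity_pt. auto_derive; auto.
    + apply continuity_pt_sqrt. nra.
  - apply ex_derive_continuity_pt. auto_derive.
    assert (H := sqrt_pos (P x ^ 2 - 1)). lra.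
Qed.

(** For v = arcosh y this says that cosh v lies between exp v / 2 and exp v. The resulting factor 2
    is harmless under n-th roots. *)
Lemma cosh_bounds y : 1 <= y ->
  exp (ln (y + sqrt (y ^ 2 - 1))) / 2 <= y <= exp (ln (y + sqrt (y ^ 2 - 1))).
Proof.
  intros Hy. assert (H := sqrt_pos (y ^ 2 - 1)). rewrite exp_ln by lra.
  assert (sqrt (y ^ 2 - 1) <= y); [|lra].
  rewrite <- (sqrt_pow2 y) at 2 by lra. apply sqrt_le_1_alt. lra.
Qed.

Definition modulus alpha beta := sqrt (2 * (beta - alpha) / ((1 - alpha) * (1 + beta))).

Definition critical_point alpha beta rho :=
  alpha + zn rho (modulus alpha beta) * sqrt ((1 - alpha) * (1 + beta)).

Section Gap.

Variables alpha beta : R.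
Hypotheses (Ha : -1 < alpha) (Hab : alpha < beta) (Hb : beta < 1).

Let k := modulus alpha beta.

Lemma modulus_sqr : k ^ 2 = 2 * (beta - alpha) / ((1 - alpha) * (1 + beta)).
Proof.
  apply pow2_sqrt. left. apply Rdiv_lt_0_compat; [lra|]. apply Rmult_lt_0_compat; lra.
Qed.

Lemma modulus_bounds : 0 < k < 1.
Proof.
  assert (HD : 0 < (1 - alpha) * (1 + beta)) by (apply Rmult_lt_0_compat; lra).
  split.
  - apply sqrt_lt_R0. apply Rdiv_lt_0_compat; lra.
  - rewrite <- sqrt_1. apply sqrt_lt_1_alt. split.
    + left. apply Rdiv_lt_0_compat; lra.
    + apply Rmult_lt_reg_r with ((1 - alpha) * (1 + beta)); auto.
      replace (2 * (beta - alpha) / ((1 - alpha) * (1 + beta)) * ((1 - alpha) * (1 + beta)))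
        with (2 * (beta - alpha)) by (field; lra).
      assert (0 < (1 - beta) * (1 + alpha)) by (apply Rmult_lt_0_compat; lra). lra.
Qed.

(** This phi is the amplitude of rho; rho itself is taken as [ellint_F phi k]. *)
Lemma amplitude_exists : exists phi, 0 < phi < PI / 2 /\ sin phi ^ 2 = (1 - alpha) / 2.
Proof.
  set (s := sqrt ((1 - alpha) / 2)).
  assert (Hs : 0 < s < 1).
  { split; [apply sqrt_lt_R0; lra|]. rewrite <- sqrt_1. apply sqrt_lt_1_alt. lra. }
  assert (B := asin_bound_lt s ltac:(lra)). assert (E := sin_asin s ltac:(lra)).
  exists (asin s). split; [split|].
  - apply Rnot_le_lt. intros Hle. assert (PI > 0) by apply PI_RGT_0.
    assert (H' : sin (asin s) <= sin 0) by (apply sin_incr_1; lra).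
    rewrite sin_0, E in H'. lra.
  - lra.
  - rewrite E. apply pow2_sqrt. lra.
Qed.

Lemma ellint_F_increasing x y : x < y <-> ellint_F x k < ellint_F y k.
Proof.
  split; intros H.
  - assert (H' := ellint_F_expands k modulus_bounds x y ltac:(lra)). lra.
  - apply Rnot_le_lt. intros Hle. assert (H' := ellint_F_expands k modulus_bounds y x Hle). lra.
Qed.

Variable phi : R.
Hypotheses (Hphi : 0 < phi < PI / 2) (Sphi : sin phi ^ 2 = (1 - alpha) / 2).

Lemma rho_unique :
  unique (fun r => 0 < r < ellK k /\ sn r k ^ 2 = (1 - alpha) / 2) (ellint_F phi k).
Proof.
  assert (Hk := modulus_bounds).
  split.
  - split; [split|].
    + rewrite <- (ellint_F_0 k). now apply (proj1 (ellint_F_increasing _ _)).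
    + now apply (proj1 (ellint_F_increasing _ _)).
    + unfold sn. now rewrite am_ellint_F.
  - intros r [[Hr1 Hr2] E]. destruct (ellint_F_surj k Hk r) as [x <-]. f_equal.
    unfold sn in E. rewrite am_ellint_F in E by auto.
    apply sin_sqr_inj; auto; [|lra].
    rewrite <- (ellint_F_0 k) in Hr1. split; now apply (proj2 (ellint_F_increasing _ _)).
Qed.

Let c := critical_point alpha beta (ellint_F phi k).
Let m := (beta - alpha) / (1 + beta).
Let r := sqrt ((1 - alpha) * (1 + beta)).

(** A Moebius function of sin^2 t that sends 0, 1, 1 / k^2 and infinity to alpha, beta, 1 and -1. As
    these are the zeros of [gapH], it turns dx / sqrt H into a multiple of dt / Delta(t); this
    accounts for the modulus. Its pole is at sin^2 t = 1 / (k^2 sin^2 phi). *)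
Definition gap_map t := (alpha + (beta - alpha) / (1 + beta) * sin t ^ 2) /
  (1 - (beta - alpha) / (1 + beta) * sin t ^ 2).

(** The quotient of dx / dt by sqrt H. It is regular up to both ends, where 1 / sqrt H is
    singular. *)
Definition gap_speed t := 2 / (sqrt ((1 - alpha) * (1 + beta)) * jdelta (modulus alpha beta) t).

Lemma r_pos : 0 < r.
Proof. apply sqrt_lt_R0. apply Rmult_lt_0_compat; lra. Qed.

Lemma r_sqr : r ^ 2 = (1 - alpha) * (1 + beta).
Proof. apply pow2_sqrt. left. apply Rmult_lt_0_compat; lra. Qed.

Lemma m_bounds : 0 < m < 1.
Proof.
  split; [apply Rdiv_lt_0_compat; lra|].
  unfold m. apply Rmult_lt_reg_r with (1 + beta); [lra|]. field_simplify; lra.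
Qed.

Lemma m_modulus : m = k ^ 2 * sin phi ^ 2.
Proof. rewrite modulus_sqr, Sphi. unfold m. field. lra. Qed.

Lemma gap_denom_pos t : 0 < 1 - m * sin t ^ 2.
Proof. assert (H := sin_sqr_bounds t). assert (H' := m_bounds). nra. Qed.

Lemma gap_speed_pos t : 0 < gap_speed t.
Proof.
  apply Rdiv_lt_0_compat; [lra|]. apply Rmult_lt_0_compat; [apply r_pos|].
  apply jdelta_pos, modulus_bounds.
Qed.

Lemma gap_map_minus_alpha t : gap_map t - alpha = (1 + alpha) * m * sin t ^ 2 / (1 - m * sin t ^ 2).
Proof. assert (H := gap_denom_pos t). unfold gap_map. fold m. field. lra. Qed.

Lemma beta_minus_gap_map t : beta - gap_map t = (beta - alpha) * cos t ^ 2 / (1 - m * sin t ^ 2).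
Proof.
  assert (H := gap_denom_pos t). unfold gap_map. fold m. rewrite cos_sqr.
  assert (E : m * (1 + beta) = beta - alpha) by (unfold m; field; lra).
  apply Rmult_eq_reg_r with (1 - m * sin t ^ 2); [|lra]. field_simplify; try lra.
  replace (- m * beta * sin t ^ 2 - m * sin t ^ 2) with (- (m * (1 + beta)) * sin t ^ 2) by ring.
  nra.
Qed.

Lemma gap_map_0 : gap_map 0 = alpha.
Proof. unfold gap_map. rewrite sin_0. field. lra. Qed.

Lemma gap_map_PI2 : gap_map (PI / 2) = beta.
Proof.
  assert (H := beta_minus_gap_map (PI / 2)). rewrite cos_PI2 in H. unfold Rdiv in H.
  replace ((beta - alpha) * 0 ^ 2 * / (1 - m * sin (PI * / 2) ^ 2)) with 0 in H by ring. lra.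
Qed.

Lemma gap_map_inside t : 0 < t < PI / 2 -> alpha < gap_map t < beta.
Proof.
  intros Ht. assert (P0 : PI > 0) by apply PI_RGT_0.
  assert (HD := gap_denom_pos t). assert (Hm := m_bounds).
  assert (S0 : 0 < sin t) by (apply sin_gt_0; lra). assert (C0 : 0 < cos t) by (apply cos_gt_0; lra).
  assert (E1 := gap_map_minus_alpha t). assert (E2 := beta_minus_gap_map t).
  assert (0 < (1 + alpha) * m * sin t ^ 2 / (1 - m * sin t ^ 2)).
  { apply Rdiv_lt_0_compat; auto. apply Rmult_lt_0_compat; [|now apply pow_lt].
    apply Rmult_lt_0_compat; lra. }
  assert (0 < (beta - alpha) * cos t ^ 2 / (1 - m * sin t ^ 2)).
  { apply Rdiv_lt_0_compat; auto. apply Rmult_lt_0_compat; [lra|]. now apply pow_lt. }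
  lra.
Qed.

Lemma gapH_gap_map t : 0 < t < PI / 2 -> sqrt (gapH alpha beta (gap_map t)) =
  (1 + alpha) * m * (sin t * cos t) * r * jdelta k t / (1 - m * sin t ^ 2) ^ 2.
Proof.
  intros Ht. assert (P0 : PI > 0) by apply PI_RGT_0.
  assert (HD := gap_denom_pos t). assert (Hm := m_bounds). assert (Hr := r_pos).
  assert (S0 : 0 < sin t) by (apply sin_gt_0; lra). assert (C0 : 0 < cos t) by (apply cos_gt_0; lra).
  assert (HDe := jdelta_pos k modulus_bounds t).
  apply sqrt_lem_1.
  - left. apply gapH_pos; auto. now apply gap_map_inside.
  - left. apply Rdiv_lt_0_compat; [|now apply pow_lt].
    assert (0 < sin t * cos t) by now apply Rmult_lt_0_compat.
    assert (0 < (1 + alpha) * m) by (apply Rmult_lt_0_compat; lra).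
    apply Rmult_lt_0_compat; auto. apply Rmult_lt_0_compat; auto. now apply Rmult_lt_0_compat.
  - unfold gapH. rewrite gap_map_minus_alpha, beta_minus_gap_map.
    set (X := gap_map t).
    assert (E1 : X = alpha + (1 + alpha) * m * sin t ^ 2 / (1 - m * sin t ^ 2)).
    { rewrite <- gap_map_minus_alpha. unfold X. ring. }
    rewrite E1.
    assert (EDe := jdelta_sqr k modulus_bounds t). assert (Er := r_sqr).
    assert (Ek : k ^ 2 * (1 - alpha) = 2 * m).
    { rewrite modulus_sqr. unfold m. field. lra. }
    assert (Em : m * (1 + beta) = beta - alpha) by (unfold m; field; lra).
    apply Rmult_eq_reg_r with ((1 - m * sin t ^ 2) ^ 4); [|apply pow_nonzero; lra].
    replace ((1 + alpha) * m * (sin t * cos t) * r * jdelta k t / (1 - m * sin t ^ 2) ^ 2 *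
      ((1 + alpha) * m * (sin t * cos t) * r * jdelta k t / (1 - m * sin t ^ 2) ^ 2) *
      (1 - m * sin t ^ 2) ^ 4)
      with ((1 + alpha) ^ 2 * m ^ 2 * (sin t ^ 2 * cos t ^ 2) * r ^ 2 * jdelta k t ^ 2) by (field; lra).
    rewrite EDe, Er, <- Em.
    replace ((1 - alpha) * (1 + beta) * (1 - k ^ 2 * sin t ^ 2))
      with ((1 + beta) * (1 - alpha - k ^ 2 * (1 - alpha) * sin t ^ 2)) by ring.
    transitivity ((1 + alpha) ^ 2 * m ^ 2 * (sin t ^ 2 * cos t ^ 2) *
      ((1 + beta) * (1 - alpha - k ^ 2 * (1 - alpha) * sin t ^ 2))); [ring|].
    rewrite Ek. field. lra.
Qed.

Lemma is_derive_gap_map t : is_derive gap_map t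
  (2 * (1 + alpha) * m * (sin t * cos t) / (1 - m * sin t ^ 2) ^ 2).
Proof.
  assert (HD := gap_denom_pos t). unfold gap_map. fold m. auto_derive.
  - simpl in *. lra.
  - replace (1 + - (m * (sin t * (sin t * 1)))) with (1 - m * sin t ^ 2) by ring.
    field. lra.
Qed.

Lemma is_derive_gap_map_speed t : 0 < t < PI / 2 ->
  is_derive gap_map t (gap_speed t * sqrt (gapH alpha beta (gap_map t))).
Proof.
  intros Ht. rewrite (gapH_gap_map t Ht). assert (Hr := r_pos).
  assert (HD := gap_denom_pos t). assert (HDe := jdelta_pos k modulus_bounds t).
  replace (gap_speed t * ((1 + alpha) * m * (sin t * cos t) * r * jdelta k t / (1 - m * sin t ^ 2) ^ 2))
    with (2 * (1 + alpha) * m * (sin t * cos t) / (1 - m * sin t ^ 2) ^ 2).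
  - apply is_derive_gap_map.
  - unfold gap_speed. fold r k. field. lra.
Qed.

Definition green_integrand t := gap_speed t * (c - gap_map t).

(** In c - x = (c - alpha) - (x - alpha), the constant gives zn / Delta, and x - alpha, a multiple
    of sin^2 t over the denominator of [gap_map], gives the third kind with parameter phi. *)
Lemma green_integrand_third_kind t :
  green_integrand t = 2 * (zn (ellint_F phi k) k * / jdelta k t - third_kind k phi t).
Proof.
  assert (Hr := r_pos). assert (HDe := jdelta_pos k modulus_bounds t).
  assert (HDp := jdelta_pos k modulus_bounds phi). assert (HD := gap_denom_pos t).
  assert (P0 : PI > 0) by apply PI_RGT_0.
  assert (S0 : 0 < sin phi) by (apply sin_gt_0; lra).
  assert (C0 : 0 < cos phi) by (apply cos_gt_0; lra).
  unfold green_integrand, gap_speed. fold r k.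
  assert (E : c - gap_map t = zn (ellint_F phi k) k * r - (gap_map t - alpha)).
  { unfold c, critical_point. fold k r. ring. }
  rewrite E, gap_map_minus_alpha.
  (* Matches the coefficient (1 + alpha) from x - alpha with the normalisation of Jacobi's
     integrand. Both sides are positive, and their squares agree by the choice of phi. *)
  assert (K1 : (1 + alpha) * sin phi = cos phi * jdelta k phi * r).
  { apply eq_of_sqr_same_sign with 1; try lra.
    - apply Rmult_le_pos; [|lra]. apply Rmult_le_pos; lra.
    - left. repeat apply Rmult_lt_0_compat; lra.
    - rewrite !Rpow_mult_distr, r_sqr, (jdelta_sqr k modulus_bounds), cos_sqr, <- m_modulus, Sphi.
      unfold m. field. lra. }
  unfold third_kind. rewrite <- m_modulus.
  replace (k ^ 2 * (sin phi * cos phi) * jdelta k phi)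
    with (k ^ 2 * sin phi * (cos phi * jdelta k phi * r) / r) by (field; lra).
  rewrite <- K1.
  replace (k ^ 2 * sin phi * ((1 + alpha) * sin phi) / r)
    with ((1 + alpha) * (k ^ 2 * sin phi ^ 2) / r) by (field; lra).
  rewrite <- m_modulus. field. lra.
Qed.

Definition green t := RInt green_integrand 0 t.

Lemma green_0 : green 0 = 0.
Proof. apply (RInt_point 0 green_integrand). Qed.

Lemma continuous_green_integrand t : continuous green_integrand t.
Proof.
  apply continuous_ext with (fun t => 2 * (zn (ellint_F phi k) k * / jdelta k t - third_kind k phi t)).
  { intros x. symmetry. apply green_integrand_third_kind. }
  apply (continuous_scal_r (V := R_NormedModule) 2
    (fun t => zn (ellint_F phi k) k * / jdelta k t - third_kind k phi t)).
  apply (continuous_minus (V := R_NormedModule)).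
  - apply (continuous_scal_r (V := R_NormedModule) (zn (ellint_F phi k) k) (fun t => / jdelta k t)).
    apply continuous_inv_jdelta, modulus_bounds.
  - apply third_kind_continuous, modulus_bounds.
Qed.

Lemma is_derive_green t : is_derive green t (gap_speed t * (c - gap_map t)).
Proof. apply (is_derive_RInt_0r green_integrand), continuous_green_integrand. Qed.

Lemma ellK_pos : 0 < ellK k.
Proof.
  unfold ellK. rewrite <- (ellint_F_0 k). apply (proj1 (ellint_F_increasing _ _)).
  assert (PI > 0) by apply PI_RGT_0. lra.
Qed.

(** The value of c is used here: the two terms integrate to zn K and to the complete integral of the
    third kind, which Jacobi's reduction makes equal. *)
Lemma green_PI2 : green (PI / 2) = 0.
Proof.
  unfold green. apply (is_RInt_unique (V := R_CompleteNormedModule)).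
  apply (is_RInt_ext _ _ _ _ _ (fun t _ => eq_sym (green_integrand_third_kind t))).
  assert (HK := ellK_pos).
  replace 0 with (2 * (zn (ellint_F phi k) k * ellK k - third_kind_complete k phi)) at 2.
  - apply (is_RInt_scal (V := R_NormedModule)).
    apply (is_RInt_minus (V := R_NormedModule)).
    + apply (is_RInt_scal (V := R_NormedModule)).
      apply (RInt_correct (V := R_CompleteNormedModule) (fun t => / jdelta k t)).
      apply (ex_RInt_continuous (V := R_CompleteNormedModule)).
      intros; apply continuous_inv_jdelta, modulus_bounds.
    + apply (RInt_correct (V := R_CompleteNormedModule) (third_kind k phi)).
      apply (ex_RInt_continuous (V := R_CompleteNormedModule)).
      intros; apply third_kind_continuous, modulus_bounds.
  - rewrite third_kind_complete_zeta, zn_ellint_F by (try apply modulus_bounds; lra). field. lra.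
Qed.

(** [green] vanishes at both ends, so by Rolle its derivative has an interior zero; as the speed is
    positive, c is the image of that zero. *)
Lemma critical_point_inside : alpha < c < beta.
Proof.
  assert (P0 : PI > 0) by apply PI_RGT_0.
  destruct (Rolle_Derive green 0 (PI / 2)) as [t [Ht Et]].
  - intros x. eexists. apply is_derive_green.
  - lra.
  - now rewrite green_0, green_PI2.
  - rewrite (is_derive_unique _ _ _ (is_derive_green t)) in Et.
    assert (H := gap_speed_pos t). apply Rmult_integral in Et. destruct Et as [Et|Et]; [lra|].
    assert (H' := gap_map_inside t Ht). lra.
Qed.

(* Rolle's theorem for arcosh P / K - green in the parameter t. *)
Lemma near_pell_critical_point n eps P c' : poly_deg_le n P -> 0 < eps -> P alpha = 1 -> P beta = 1 ->
  alpha < c' < beta -> near_pell n alpha beta eps P c' -> Rabs (c' - c) <= 2 * eps.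
Proof.
  intros HP Heps Pa Pb Hc' [K [w [HK Hw]]].
  assert (P0 : PI > 0) by apply PI_RGT_0.
  set (D := fun t => / K * arcosh_of P (gap_map t) - green t).
  assert (HDer : forall t, 0 < t < PI / 2 ->
    is_derive D t (gap_speed t * (w (gap_map t) * (c' - gap_map t) - (c - gap_map t)))).
  { intros t Ht. assert (Hx := gap_map_inside t Ht). destruct (Hw _ Hx) as [HP1 [_ E]].
    assert (Hh := gapH_pos alpha beta _ Ha Hb Hx).
    assert (Hsh : 0 < sqrt (gapH alpha beta (gap_map t))) by now apply sqrt_lt_R0.
    assert (Hq : 0 < P (gap_map t) ^ 2 - 1) by nra.
    assert (Hs : 0 < sqrt (P (gap_map t) ^ 2 - 1)) by now apply sqrt_lt_R0.
    replace (gap_speed t * (w (gap_map t) * (c' - gap_map t) - (c - gap_map t)))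
      with (/ K * (gap_speed t * sqrt (gapH alpha beta (gap_map t)) *
        (Derive P (gap_map t) / sqrt (P (gap_map t) ^ 2 - 1))) - gap_speed t * (c - gap_map t)).
    - apply (is_derive_minus (fun t => / K * arcosh_of P (gap_map t)) green); [|apply is_derive_green].
      apply (is_derive_scal (fun t => arcosh_of P (gap_map t))).
      apply (is_derive_comp (arcosh_of P) gap_map).
      + apply is_derive_arcosh_of; auto. eapply poly_ex_derive; eassumption.
      + now apply is_derive_gap_map_speed.
    - replace (gap_speed t * sqrt (gapH alpha beta (gap_map t)) *
        (Derive P (gap_map t) / sqrt (P (gap_map t) ^ 2 - 1)))
        with (gap_speed t * (Derive P (gap_map t) * sqrt (gapH alpha beta (gap_map t)))
          / sqrt (P (gap_map t) ^ 2 - 1)) by (field; lra).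
      rewrite E. field. lra. }
  assert (pr : forall t, 0 < t < PI / 2 -> derivable_pt D t).
  { intros t Ht. apply ex_derive_Reals_0. eexists. now apply HDer. }
  assert (HC : forall t, 0 <= t <= PI / 2 -> continuity_pt D t).
  { intros t Ht. unfold D. apply continuity_pt_minus.
    - apply continuity_pt_scal. apply (continuity_pt_comp gap_map (arcosh_of P)).
      + apply ex_derive_continuity_pt. eexists. apply is_derive_gap_map.
      + apply continuity_pt_arcosh_of; [eapply poly_continuity_pt; eassumption|].
        destruct (Req_EM_T t 0) as [->|]; [rewrite gap_map_0; lra|].
        destruct (Req_EM_T t (PI / 2)) as [->|]; [rewrite gap_map_PI2; lra|].
        left. apply Hw. apply gap_map_inside. lra.
    - apply ex_derive_continuity_pt. eexists. apply is_derive_green. }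
  destruct (Rolle D 0 (PI / 2) pr HC) as [t [Ht E]]; [lra| |].
  { unfold D. rewrite gap_map_0, gap_map_PI2, green_0, green_PI2, !arcosh_of_1; auto. }
  rewrite Derive_Reals in E. rewrite (is_derive_unique _ _ _ (HDer t Ht)) in E.
  assert (Hsp := gap_speed_pos t). apply Rmult_integral in E. destruct E as [E|E]; [lra|].
  assert (Hx := gap_map_inside t Ht). destruct (Hw _ Hx) as [_ [Hw1 _]].
  (* At Rolle's point w (c' - x) = c - x, and |c' - x| <= 2. *)
  replace (c' - c) with ((1 - w (gap_map t)) * (c' - gap_map t)) by lra.
  rewrite Rabs_mult. rewrite (Rabs_right (1 - w (gap_map t))) by lra.
  assert (Rabs (c' - gap_map t) <= 2) by (apply Rabs_le; lra).
  assert (Hr := Rabs_pos (c' - gap_map t)). nra.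
Qed.

(** The mean value theorem for arcosh P between c and c'. Its derivative contains the factor c' - z,
    also at most 2 eps in absolute value, so the exponent is quadratic in eps; delta keeps z away
    from the singularities at the ends. *)
Lemma near_pell_value n eps delta P c' : poly_deg_le n P -> 0 < eps -> 0 < delta ->
  2 * eps <= delta -> alpha + 2 * delta <= c -> c + 2 * delta <= beta ->
  P alpha = 1 -> P beta = 1 -> alpha < c' < beta -> near_pell n alpha beta eps P c' ->
  P c' <= 2 * exp (INR n * (4 * eps ^ 2 / delta ^ 2)) * P c.
Proof.
  intros HP Heps Hdel Hed Hc1 Hc2 Pa Pb Hc' HN.
  assert (Hcc := near_pell_critical_point n eps P c' HP Heps Pa Pb Hc' HN).
  destruct HN as [K [w [HK Hw]]].
  assert (Hc := critical_point_inside).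
  set (G := arcosh_of P).
  destruct (MVT_gen G c c' (fun x => Derive P x / sqrt (P x ^ 2 - 1))) as [z [Hz E]].
  { intros x Hx. apply is_derive_arcosh_of; [eapply poly_ex_derive; eassumption|].
    apply Hw. unfold Rmin, Rmax in Hx. destruct (Rle_dec c c'); lra. }
  { intros x Hx. apply continuity_pt_arcosh_of; [eapply poly_continuity_pt; eassumption|].
    left. apply Hw. unfold Rmin, Rmax in Hx. destruct (Rle_dec c c'); lra. }
  apply Rabs_le_between in Hcc.
  assert (Hz' : Rabs (c' - z) <= 2 * eps /\ alpha + delta <= z <= beta - delta).
  { split; [apply Rabs_le|]; unfold Rmin, Rmax in Hz; destruct (Rle_dec c c'); lra. }
  destruct Hz' as [Hz1 Hz2].
  destruct (Hw z ltac:(lra)) as [Pz [Hwz Ez]].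
  assert (Hq : 0 < P z ^ 2 - 1) by nra.
  assert (Hs : 0 < sqrt (P z ^ 2 - 1)) by now apply sqrt_lt_R0.
  set (h := sqrt (gapH alpha beta z)) in *.
  (* Each of 1 - z, 1 + z, z - alpha, beta - z is at least delta, hence H >= delta^4. *)
  assert (Hh : delta ^ 2 <= h).
  { unfold h. rewrite <- (sqrt_pow2 (delta ^ 2)) by (apply pow2_ge_0).
    apply sqrt_le_1_alt. unfold gapH.
    replace ((delta ^ 2) ^ 2) with ((delta * delta) * (delta * delta)) by ring.
    replace (1 - z ^ 2) with ((1 - z) * (1 + z)) by ring.
    apply Rmult_le_compat; try (apply Rmult_le_compat; lra); apply Rmult_le_pos; lra. }
  assert (Hd2 : 0 < delta ^ 2) by now apply pow_lt.
  assert (EG : G c' - G c <= INR n * (4 * eps ^ 2 / delta ^ 2)).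
  { rewrite E.
    assert (E2 : Derive P z / sqrt (P z ^ 2 - 1) = K * w z * (c' - z) / h).
    { apply Rmult_eq_reg_r with (sqrt (P z ^ 2 - 1) * h); [|nra].
      replace (Derive P z / sqrt (P z ^ 2 - 1) * (sqrt (P z ^ 2 - 1) * h)) with (Derive P z * h)
        by (field; lra).
      rewrite Ez. field. lra. }
    rewrite E2. eapply Rle_trans; [apply Rle_abs|].
    unfold Rdiv. rewrite !Rabs_mult.
    rewrite (Rabs_right (/ h)) by (left; apply Rinv_0_lt_compat; lra).
    rewrite (Rabs_right K) by lra.
    assert (Hw1 : Rabs (w z) <= 1).
    { apply Rabs_le. split; [|lra].
      assert (0 <= w z \/ w z < 0) by lra.
      assert (eps <= 1); [|lra]. lra. }
    assert (Hcc' : Rabs (c' - c) <= 2 * eps) by (apply Rabs_le; lra).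
    assert (Hih : / h <= / delta ^ 2) by (apply Rinv_le_contravar; auto).
    assert (Hih0 : 0 < / h) by (apply Rinv_0_lt_compat; lra).
    replace (INR n * (4 * eps ^ 2 * / delta ^ 2))
      with (INR n * 1 * (2 * eps) * / delta ^ 2 * (2 * eps)) by ring.
    assert (R1 := Rabs_pos (w z)). assert (R2 := Rabs_pos (c' - z)). assert (R3 := Rabs_pos (c' - c)).
    apply Rmult_le_compat; auto.
    { repeat apply Rmult_le_pos; lra. }
    apply Rmult_le_compat; auto; [|lra|].
    { repeat apply Rmult_le_pos; lra. }
    apply Rmult_le_compat; auto.
    { repeat apply Rmult_le_pos; lra. }
    apply Rmult_le_compat; lra. }
  assert (Pc := proj1 (Hw c ltac:(lra))). assert (Pc' := proj1 (Hw c' Hc')).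
  assert (B := cosh_bounds (P c) ltac:(lra)). assert (B' := cosh_bounds (P c') ltac:(lra)).
  fold (arcosh_of P c) in B. fold (arcosh_of P c') in B'. fold G in B, B'.
  apply Rle_trans with (exp (G c')); [lra|].
  apply Rle_trans with (exp (INR n * (4 * eps ^ 2 / delta ^ 2) + G c)).
  - assert (Hle : G c' <= INR n * (4 * eps ^ 2 / delta ^ 2) + G c) by lra.
    destruct Hle as [Hlt| ->]; [|lra]. left. now apply exp_increasing.
  - rewrite exp_plus. assert (0 < exp (INR n * (4 * eps ^ 2 / delta ^ 2))) by apply exp_pos. nra.
Qed.

End Gap.

(** * Convergence factors *)

Lemma Lim_seq_unit_interval u : eventually (fun n => 0 <= u n <= 1) ->
  exists l : R, Lim_seq u = l.
Proof.
  intros H.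
  assert (H0 : Rbar_le 0 (Lim_seq u)).
  { rewrite <- (Lim_seq_const 0). apply Lim_seq_le_loc. revert H. apply filter_imp. intros; lra. }
  assert (H1 : Rbar_le (Lim_seq u) 1).
  { rewrite <- (Lim_seq_const 1). apply Lim_seq_le_loc. revert H. apply filter_imp. intros; lra. }
  destruct (Lim_seq u) as [l| |]; [now exists l|now destruct H1|now destruct H0].
Qed.

(** [Lim_seq] is the mean of the upper and the lower limit and so respects eventual inequalities and
    constant factors. The bounds keep it finite, since [real] would send an infinite value to 0.
    Then eta tends to 0 through eta = ln (1 + d). *)
Lemma Lim_seq_le_factor u v :
  eventually (fun n => 0 <= u n <= 1) -> eventually (fun n => 0 <= v n <= 1) ->
  (forall eta, 0 < eta -> eventually (fun n => u n <= exp eta * v n)) ->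
  real (Lim_seq u) <= real (Lim_seq v).
Proof.
  intros Hu Hv H. destruct (Lim_seq_unit_interval u Hu) as [a Ea].
  destruct (Lim_seq_unit_interval v Hv) as [b Eb].
  assert (Hle : forall eta, 0 < eta -> a <= exp eta * b).
  { intros eta He. assert (HL := Lim_seq_le_loc _ _ (H eta He)).
    rewrite Lim_seq_scal_l, Ea, Eb in HL. exact HL. }
  rewrite Ea, Eb. simpl. apply (Rle_plus_epsilon a b). intros d Hd.
  assert (Hb0 : b <= 1).
  { assert (H1 : Rbar_le (Lim_seq v) 1).
    { rewrite <- (Lim_seq_const 1). apply Lim_seq_le_loc. revert Hv. apply filter_imp. intros; lra. }
    rewrite Eb in H1. exact H1. }
  assert (Hb1 : 0 <= b).
  { assert (H1 : Rbar_le 0 (Lim_seq v)).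
    { rewrite <- (Lim_seq_const 0). apply Lim_seq_le_loc. revert Hv. apply filter_imp. intros; lra. }
    rewrite Eb in H1. exact H1. }
  assert (Hl : 0 < ln (1 + d)) by (rewrite <- ln_1; apply ln_increasing; lra).
  specialize (Hle _ Hl). rewrite exp_ln in Hle by lra. nra.
Qed.

Lemma Rpower_unit_interval x y : 0 < x <= 1 -> 0 <= y -> 0 <= Rpower x y <= 1.
Proof.
  intros Hx Hy. unfold Rpower. split; [left; apply exp_pos|].
  assert (Hl : ln x <= 0) by (rewrite <- ln_1; apply ln_le; lra).
  assert (H : y * ln x <= 0) by nra.
  destruct H as [H|H]; [left; rewrite <- exp_0; now apply exp_increasing|].
  rewrite H, exp_0. lra.
Qed.

Section Extremal_problem.

Variables alpha beta : R.
Hypotheses (Ha : -1 < alpha) (Hab : alpha < beta) (Hb : beta < 1).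

(** A finite bound and the point alpha keep the least upper bound from being infinite, so that
    [real] returns the supremum itself. *)
Lemma max_abs_on_le P B : (forall x, two_intervals alpha beta x -> Rabs (P x) <= B) ->
  (forall x, two_intervals alpha beta x -> Rabs (P x) <= max_abs_on (two_intervals alpha beta) P) /\
  max_abs_on (two_intervals alpha beta) P <= B.
Proof.
  intros HB. unfold max_abs_on.
  set (S := fun y => exists x, two_intervals alpha beta x /\ y = Rabs (P x)).
  destruct (Lub_Rbar_correct S) as [H1 H2].
  assert (HS : S (Rabs (P alpha))) by (exists alpha; split; auto; left; lra).
  assert (HU : Rbar_le (Lub_Rbar S) B).
  { apply H2. intros y [x [Hx ->]]. now apply HB. }
  assert (HL := H1 _ HS). simpl in HL.
  destruct (Lub_Rbar S) as [l| |] eqn:E; try (now destruct HL); try (now destruct HU).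
  simpl. split; auto. intros x Hx. apply (H1 (Rabs (P x))). now exists x.
Qed.

Lemma poly_bounded_on n P : poly_deg_le n P ->
  exists B, forall x, two_intervals alpha beta x -> Rabs (P x) <= B.
Proof.
  intros HP. destruct (continuity_ab_maj (fun x => Rabs (P x)) (-1) 1) as [x0 [H _]]; [lra| |].
  - intros x _. apply (continuity_pt_comp P Rabs); [|apply Rcontinuity_abs].
    eapply poly_continuity_pt; eassumption.
  - exists (Rabs (P x0)). intros x Hx. apply H. destruct Hx; lra.
Qed.

Lemma extremal_norm n P c Q xi : extremal n alpha beta P c -> alpha <= xi <= beta ->
  poly_deg_le n Q -> Q xi = 1 -> / P c <= max_abs_on (two_intervals alpha beta) Q.
Proof.
  intros [_ [_ [HM Hopt]]] Hxi HQ Q1.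
  destruct (poly_bounded_on n Q HQ) as [B HB]. destruct (max_abs_on_le Q B HB) as [H _].
  set (s := max_abs_on (two_intervals alpha beta) Q) in *.
  assert (Hs : 0 <= s).
  { eapply Rle_trans; [apply Rabs_pos|]. apply (H alpha). left. lra. }
  apply Rnot_lt_le. intros Hlt.
  (* Dividing Q by t instead of by its norm s also covers s = 0, and still gives an admissible
     polynomial with value above P c at xi. *)
  set (t := (s + / P c) / 2). assert (Ht : s < t < / P c) by (unfold t; lra).
  assert (Ht0 : 0 < / t) by (apply Rinv_0_lt_compat; lra).
  assert (HQt : / t * Q xi <= P c).
  { apply (Hopt (fun x => / t * Q x)); auto. split; [now apply poly_scal|].
    intros x Hx. rewrite Rabs_mult, Rabs_right by lra.
    apply Rmult_le_reg_l with t; [lra|]. rewrite <- Rmult_assoc, Rinv_r by lra.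
    specialize (H x Hx). lra. }
  rewrite Q1, Rmult_1_r in HQt.
  assert (/ P c <= / / t) by (apply Rinv_le_contravar; lra). rewrite Rinv_inv in *. lra.
Qed.

(** The lower bound is uniform in xi because P c is maximal over the whole gap. The constant 1 and P
    / P xi are the competitors for the upper bounds; they also make the infimum finite. *)
Lemma Lr_bounds n P c xi : extremal n alpha beta P c -> alpha <= xi <= beta ->
  / P c <= Lr n (two_intervals alpha beta) xi <= 1 /\
  (0 < P xi -> Lr n (two_intervals alpha beta) xi <= / P xi).
Proof.
  intros Hext Hxi. assert (Hnorm := fun Q => extremal_norm n P c Q xi Hext Hxi).
  destruct Hext as [[HP HB] [_ [HM _]]]. unfold Lr.
  set (T := fun M => exists P0 : R -> R, poly_deg_le n P0 /\ P0 xi = 1 /\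
    M = max_abs_on (two_intervals alpha beta) P0).
  destruct (Glb_Rbar_correct T) as [H1 H2].
  assert (HT1 : T (max_abs_on (two_intervals alpha beta) (fun _ => 1))).
  { exists (fun _ => 1). repeat split. apply poly_const. }
  destruct (max_abs_on_le (fun _ => 1) 1) as [_ M1].
  { intros x _. rewrite Rabs_R1. lra. }
  assert (HL : Rbar_le (/ P c) (Glb_Rbar T)).
  { apply H2. intros M [Q [HQ [Q1 ->]]]. now apply Hnorm. }
  assert (HU := H1 _ HT1). simpl in HU.
  destruct (Glb_Rbar T) as [l| |] eqn:E; try (now destruct HL); try (now destruct HU).
  simpl in *. split; [lra|]. intros Pxi.
  destruct (max_abs_on_le (fun x => / P xi * P x) (/ P xi)) as [_ M2].
  { intros x Hx. assert (H := HB x Hx). assert (Hi := Rinv_0_lt_compat _ Pxi).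
    rewrite Rabs_mult, Rabs_right by lra. nra. }
  eapply Rle_trans; [|exact M2]. apply (H1 (max_abs_on (two_intervals alpha beta) (fun x => / P xi * P x))).
  exists (fun x => / P xi * P x). split; [now apply poly_scal|]. split; auto. field. lra.
Qed.

Lemma kappa_minimal phi xi : 0 < phi < PI / 2 -> sin phi ^ 2 = (1 - alpha) / 2 ->
  alpha < xi < beta ->
  kappa (two_intervals alpha beta) (critical_point alpha beta (ellint_F phi (modulus alpha beta)))
    <= kappa (two_intervals alpha beta) xi.
Proof.
  intros Hphi Sphi Hxi.
  assert (Hc := critical_point_inside alpha beta Ha Hab Hb phi Hphi Sphi).
  set (c := critical_point alpha beta (ellint_F phi (modulus alpha beta))) in *.
  assert (Hunit : forall x, alpha < x < beta -> eventually (fun n =>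
    0 <= Rpower (Lr n (two_intervals alpha beta) x) (/ INR n) <= 1)).
  { intros x Hx. exists 2%nat. intros n Hn.
    destruct (extremal_exists n alpha beta Hn Ha Hab Hb) as [P [c' Hext]].
    destruct (Lr_bounds n P c' x Hext ltac:(lra)) as [HL _].
    assert (0 < / P c') by (apply Rinv_0_lt_compat; destruct Hext as [_ [_ [HM _]]]; lra).
    apply Rpower_unit_interval; [lra|]. left. apply Rinv_0_lt_compat, lt_0_INR. lia. }
  apply Lim_seq_le_factor; auto.
  intros eta Heta.
  set (delta := Rmin ((c - alpha) / 2) ((beta - c) / 2)).
  assert (Hd : 0 < delta) by (apply Rmin_pos; lra).
  assert (Hd1 : delta <= (c - alpha) / 2) by apply Rmin_l.
  assert (Hd2 : delta <= (beta - c) / 2) by apply Rmin_r.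
  (* With eps = delta t / 2 the exponent rate 4 eps^2 / delta^2 is t^2 <= t <= eta / 2, and t <= 1
     gives 2 eps <= delta. *)
  set (t := Rmin 1 (eta / 2)).
  assert (Ht : 0 < t) by (apply Rmin_pos; lra).
  assert (Ht1 : t <= 1) by apply Rmin_l. assert (Ht2 : t <= eta / 2) by apply Rmin_r.
  set (eps := delta / 2 * t).
  assert (Heps : 0 < eps) by (unfold eps; nra).
  destruct (extremal_near_pell alpha beta eps Ha Hab Hb Heps) as [N1 HN1].
  (* Beyond this threshold the factor 2 contributes ln 2 / n <= eta / 2, the other half of eta. *)
  destruct (nfloor_ex (2 * ln 2 / eta)) as [N2 HN2].
  { assert (Hl2 : 0 < ln 2) by (rewrite <- ln_1; apply ln_increasing; lra).
    left. apply Rdiv_lt_0_compat; lra. }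
  exists (N1 + N2 + 2)%nat. intros n Hn.
  destruct (extremal_exists n alpha beta ltac:(lia) Ha Hab Hb) as [P [c' Hext]].
  destruct (HN1 n P c' ltac:(lia) Hext) as [Pa [Pb Hnear]].
  destruct (Lr_bounds n P c' xi Hext ltac:(lra)) as [HL1 _].
  destruct (Lr_bounds n P c' c Hext ltac:(lra)) as [HL2 HL3].
  destruct Hext as [[HP _] [Hc' [HM _]]].
  assert (HV := near_pell_value alpha beta Ha Hab Hb phi Hphi Sphi n eps delta P c' HP Heps Hd
    ltac:(unfold eps; nra) ltac:(fold c; lra) ltac:(fold c; lra) Pa Pb Hc' Hnear).
  fold c in HV.
  assert (Pc : 1 < P c) by (destruct Hnear as [K [w [_ Hw]]]; apply (Hw c); lra).
  specialize (HL3 ltac:(lra)).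
  set (E := exp (INR n * (4 * eps ^ 2 / delta ^ 2))) in *.
  assert (HE : 0 < E) by apply exp_pos.
  assert (Hi : 0 < / P c') by (apply Rinv_0_lt_compat; lra).
  set (x := Lr n (two_intervals alpha beta) c) in *.
  set (y := Lr n (two_intervals alpha beta) xi) in *.
  assert (Hxy : x <= 2 * E * y).
  { apply Rle_trans with (2 * E * / P c').
    - eapply Rle_trans; [exact HL3|]. apply Rmult_le_reg_r with (P c * P c'); [nra|].
      replace (/ P c * (P c * P c')) with (P c') by (field; lra).
      replace (2 * E * / P c' * (P c * P c')) with (2 * E * P c) by (field; lra). exact HV.
    - apply Rmult_le_compat_l; lra. }
  assert (Hn0 : 0 < INR n) by (apply lt_0_INR; lia).
  assert (Hln : ln x <= ln 2 + INR n * (4 * eps ^ 2 / delta ^ 2) + ln y).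
  { rewrite <- (ln_exp (INR n * (4 * eps ^ 2 / delta ^ 2))). fold E.
    rewrite <- ln_mult, <- ln_mult by (try lra; apply Rmult_lt_0_compat; lra).
    apply ln_le; lra. }
  assert (Hsmall : 4 * eps ^ 2 / delta ^ 2 <= eta / 2).
  { replace (4 * eps ^ 2 / delta ^ 2) with (t ^ 2) by (unfold eps; field; lra). nra. }
  assert (H2 : / INR n * ln 2 <= eta / 2).
  { assert (HnN : INR N2 + 1 <= INR n).
    { rewrite <- S_INR. apply le_INR. lia. }
    apply Rmult_le_reg_l with (INR n); auto. rewrite <- Rmult_assoc, Rinv_r, Rmult_1_l by lra.
    assert (H3 : 2 * ln 2 / eta <= INR n) by lra.
    assert (H4 : 2 * ln 2 / eta * eta <= INR n * eta) by (apply Rmult_le_compat_r; lra).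
    replace (2 * ln 2 / eta * eta) with (2 * ln 2) in H4 by (field; lra). lra. }
  unfold Rpower. rewrite <- exp_plus.
  assert (Hfin : / INR n * ln x <= eta + / INR n * ln y).
  { apply Rle_trans with (/ INR n * (ln 2 + INR n * (4 * eps ^ 2 / delta ^ 2) + ln y)).
    - apply Rmult_le_compat_l; auto. left. now apply Rinv_0_lt_compat.
    - replace (/ INR n * (ln 2 + INR n * (4 * eps ^ 2 / delta ^ 2) + ln y))
        with (/ INR n * ln 2 + 4 * eps ^ 2 / delta ^ 2 + / INR n * ln y) by (field; lra). lra. }
  destruct Hfin as [Hf|Hf]; [left; now apply exp_increasing|rewrite Hf; lra].
Qed.

End Extremal_problem.

Theorem theorem4 (alpha beta : R)
  (Hm1 : -1 < alpha) (Hab : alpha < beta) (H1 : beta < 1) :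
  let k := sqrt (2 * (beta - alpha) / ((1 - alpha) * (1 + beta))) in
  0 < k < 1 /\
  exists rho : R,
    unique (fun r => 0 < r < ellK k /\ sn r k ^ 2 = (1 - alpha) / 2) rho /\
    let xi_star := alpha + zn rho k * sqrt ((1 - alpha) * (1 + beta)) in
    alpha < xi_star < beta /\
    forall xi : R, alpha < xi < beta ->
      kappa (two_intervals alpha beta) xi_star
        <= kappa (two_intervals alpha beta) xi.
Proof.
  intros k. split; [now apply modulus_bounds|].
  destruct (amplitude_exists alpha beta Hm1 Hab H1) as [phi [Hphi Sphi]].
  exists (ellint_F phi k). split; [now apply rho_unique|split].
  - exact (critical_point_inside alpha beta Hm1 Hab H1 phi Hphi Sphi).
  - intros xi Hxi. now apply (kappa_minimal alpha beta Hm1 Hab H1 phi xi).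
Qed.
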